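(* (1) Let $\Bbbk$ be a field of characteristic $0$ and $K$ a reflexive set. The natural quasi-isomorphisms of differential graded algebras over $\Bbbk$ $$A_{PL}(K)\to(C_{PL}\otimes A_{PL})(K)\leftarrow C_{PL}(K)$$ are maps of involutive dga's. (2) Let $M$ be a smooth manifold and $\Bbbk=\mathbb{R}$. The natural quasi-isomorphisms of differential graded algebras $$\Omega^*_{dR}(M)\xrightarrow{\alpha_M}A_{dR}(\mathrm{Sing}^\infty_\bullet(M))\xleftarrow{\beta_M}A_{PL}(\mathrm{Sing}^\infty_\bullet(M))\xleftarrow{\gamma_M}A_{PL}(\mathrm{Sing}_\bullet(M))$$ are maps of involutive dga's, where $\Omega^*_{dR}(M)$ has the identity as its involution.
   Context: An involution on a dga is a degree-zero chain map $\overline{(-)}$ with $\overline{\overline a}=a$, $\overline1=1$, $\overline{ab}=(-1)^{|a||b|}\overline b\,\overline a$; maps of involutive dga's are dga maps commuting with involutions. A reflexive set is a simplicial set with maps $r_n\colon K_n\to K_n$, $r_n^2=\mathrm{id}$, $d_ir_n=r_{n-1}d_{n-i}$, $s_ir_n=r_{n+1}s_{n-i}$. An involutive reflexive dga is a simplicial dga $A_\bullet$ with maps $r_n$ satisfying the same identities, each $r_n$ being an involution of the dga $A_n$. For such $K$ and $A$, $A(K)$ is the dga of simplicial maps $K\to A$ (pointwise operations), with involution $\overline\Phi(\sigma)=r_n\Phi(r_n\sigma)$ for $\sigma\in K_n$. Involutive reflexive dga's used: - $C_{PL}[n]=C^*(\Delta[n])$, normalized simplicial cochains with cup product $(\gamma_1\cup\gamma_2)(\sigma)=(-1)^{pq}\gamma_1(d_{p+1}\cdots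 d_{p+q}\sigma)\gamma_2(d_0^p\sigma)$, and $r_n\gamma(\sigma)=(-1)^{p(p+1)/2}\gamma(\overline\sigma)$, $\overline\sigma(i)=n-\sigma(p-i)$, for $\gamma$ of degree $p$, $\sigma\in\Delta[n]_p$. - $A_{PL}[n]=\Lambda(t_0,\dots,t_n,dt_0,\dots,dt_n)/(\sum t_i-1,\sum dt_i)$ (free graded commutative algebra over $\Bbbk$, $|t_i|=0$), with $r_n\colon t_i\mapsto t_{n-i}$. - $A_{dR}[n]=$ smooth differential forms on the geometric simplex $\Delta^n$, with $r_n$ pullback along the flip $(t_0,\dots,t_n)\mapsto(t_n,\dots,t_0)$. - The levelwise tensor product $C_{PL}\otimes A_{PL}$ with $r_n\otimes r_n$. Reflexive sets used: the set $\mathrm{Sing}_\bullet(M)$ of continuous singular simplices and $\mathrm{Sing}^\infty_\bullet(M)$ of smooth ones, with $r_n\sigma(t_0,\dots,t_n)=\sigma(t_n,\dots,t_0)$. Maps: in (1), the maps are induced by $a\mapsto1\otimes a$ and $c\mapsto c\otimes1$. In (2), $\alpha_M(\omega)=(\sigma\mapsto\sigma^*\omega)$, $\beta_M$ is induced by the inclusion $A_{PL\bullet}\hookrightarrow A_{dR\bullet}$, and $\gamma_M$ is induced by the inclusion $\mathrm{Sing}^\infty_\bullet(M)\hookrightarrow\mathrm{Sing}_\bullet(M)$. That all these maps are quasi-isomorphisms of dga's is a known theorem. *)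

(* Defs.v *)
From HB Require Import structures.
From mathcomp Require Import all_boot all_order all_algebra all_fingroup.
From mathcomp Require Import generic_quotient.
From mathcomp Require Import all_classical all_reals all_analysis.
From mathcomp Require Import zify.

Set Implicit Arguments.
Unset Strict Implicit.
Unset Printing Implicit Defensive.
Import Order.TTheory GRing.Theory Num.Theory numFieldNormedType.Exports.
Local Open Scope classical_set_scope.
Local Open Scope ring_scope.
Local Open Scope quotient_scope.

(** * Modules *)

Definition dprod (k : pzRingType) (I : Type) (V : I -> lmodType k) : Type :=
  forall i, V i.

Section DependentProduct.
Variables (k : pzRingType) (I : Type) (V : I -> lmodType k).
Implicit Types f g h : dprod V.

HB.instance Definition _ := gen_eqMixin (dprod V).
HB.instance Definition _ := gen_choiceMixin (dprod V).

Let add f g : dprod V := fun i => f i + g i.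
Let opp f : dprod V := fun i => - f i.
Let scale (c : k) f : dprod V := fun i => c *: f i.

Fact dprod_addA : associative add.
Proof. by move=> f g h; apply: functional_extensionality_dep => i; apply: addrA. Qed.
Fact dprod_addC : commutative add.
Proof. by move=> f g; apply: functional_extensionality_dep => i; apply: addrC. Qed.
Fact dprod_add0 : left_id (fun i => 0) add.
Proof. by move=> f; apply: functional_extensionality_dep => i; apply: add0r. Qed.
Fact dprod_addN : left_inverse (fun i => 0) opp add.
Proof. by move=> f; apply: functional_extensionality_dep => i; apply: addNr. Qed.
HB.instance Definition _ := GRing.isZmodule.Build (dprod V)
  dprod_addA dprod_addC dprod_add0 dprod_addN.

Fact dprod_scaleA a b f : scale a (scale b f) = scale (a * b) f.
Proof. by apply: functional_extensionality_dep => i; apply: scalerA. Qed.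
Fact dprod_scale1 : left_id 1 scale.
Proof. by move=> f; apply: functional_extensionality_dep => i; apply: scale1r. Qed.
Fact dprod_scaleDr : right_distributive scale +%R.
Proof. by move=> a f g; apply: functional_extensionality_dep => i; apply: scalerDr. Qed.
Fact dprod_scaleDl f : {morph scale^~ f : a b / a + b}.
Proof. by move=> a b; apply: functional_extensionality_dep => i; apply: scalerDl. Qed.
HB.instance Definition _ := GRing.Zmodule_isLmodule.Build k (dprod V)
  dprod_scaleA dprod_scale1 dprod_scaleDr dprod_scaleDl.

End DependentProduct.

(** The [k]-module generated by [G], subject to the relations "[r] vanishes" for
    every formal linear combination [r] in [rel]. Two formal combinations are
    identified when they have the same value in every module in which the
    generators are interpreted so that the relations hold. *)
Section PresentedModule.
Variables (k : fieldType) (G : Type).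

Definition lin_eval (V : lmodType k) (f : G -> V) (l : seq (k * G)) : V :=
  \sum_(cg <- l) cg.1 *: f cg.2.

Variable rel : set (seq (k * G)).

Definition pres_eq (l1 l2 : {classic (seq (k * G))}) : bool :=
  `[< forall (V : lmodType k) (f : G -> V),
        (forall r, rel r -> lin_eval f r = 0) ->
        lin_eval f l1 = lin_eval f l2 >].

Fact pres_eq_refl : reflexive pres_eq.
Proof. by move=> l; apply/asboolP. Qed.
Fact pres_eq_sym : symmetric pres_eq.
Proof.
by move=> l m; apply/asboolP/asboolP => h V f fr; rewrite h.
Qed.
Fact pres_eq_trans : transitive pres_eq.
Proof.
move=> l m n /asboolP h /asboolP h'; apply/asboolP => V f fr.
by rewrite h// h'.
Qed.

Definition pres_equiv :=
  EquivRel pres_eq pres_eq_refl pres_eq_sym pres_eq_trans.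

Definition presented : Type := {eq_quot pres_equiv}.
HB.instance Definition _ := Choice.on presented.
HB.instance Definition _ := EqQuotient.on presented.

Definition pres_class (l : seq (k * G)) : presented := \pi_presented l.
Definition pgen (g : G) : presented := pres_class [:: (1, g)].

(** The linear map with prescribed values on the generators; meaningful when
    these values satisfy the relations. *)
Definition lin_ext (V : lmodType k) (f : G -> V) (x : presented) : V :=
  lin_eval f (repr x).

Let add (x y : presented) : presented :=
  pres_class ((repr x : seq (k * G)) ++ repr y).
Let scale (c : k) (x : presented) : presented :=
  pres_class [seq (c * cg.1, cg.2) | cg <- (repr x : seq (k * G))].
Let opp (x : presented) : presented := scale (-1) x.
Let zero : presented := pres_class [::].

Lemma lin_ext_class (V : lmodType k) (f : G -> V) :
  (forall r, rel r -> lin_eval f r = 0) ->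
  forall l, lin_ext f (pres_class l) = lin_eval f l.
Proof.
move=> fr l; rewrite /lin_ext /pres_class.
have /eqmodP/asboolP : repr (\pi_presented (l : {classic _})) = l %[mod presented]
  by rewrite reprK.
by apply.
Qed.

Lemma lin_ext_add (V : lmodType k) (f : G -> V) :
  (forall r, rel r -> lin_eval f r = 0) ->
  forall x y, lin_ext f (add x y) = lin_ext f x + lin_ext f y.
Proof. by move=> fr x y; rewrite lin_ext_class// /lin_eval big_cat. Qed.

Lemma lin_ext_scale (V : lmodType k) (f : G -> V) :
  (forall r, rel r -> lin_eval f r = 0) ->
  forall c x, lin_ext f (scale c x) = c *: lin_ext f x.
Proof.
move=> fr c x; rewrite lin_ext_class// /lin_ext /lin_eval big_map scaler_sumr.
by apply: eq_bigr => i _; rewrite scalerA.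
Qed.

Lemma lin_ext_zero (V : lmodType k) (f : G -> V) :
  (forall r, rel r -> lin_eval f r = 0) -> lin_ext f zero = 0.
Proof. by move=> fr; rewrite lin_ext_class// /lin_eval big_nil. Qed.

Lemma presented_eq (x y : presented) :
  (forall (V : lmodType k) (f : G -> V),
     (forall r, rel r -> lin_eval f r = 0) -> lin_ext f x = lin_ext f y) ->
  x = y.
Proof.
move=> h; rewrite -[x]reprK -[y]reprK; apply/eqmodP/asboolP => V f fr.
exact: h.
Qed.

Let extE := (lin_ext_add, lin_ext_scale, lin_ext_zero).

Fact presented_addA : associative add.
Proof. by move=> x y z; apply: presented_eq => V f fr; rewrite !extE// addrA. Qed.
Fact presented_addC : commutative add.
Proof. by move=> x y; apply: presented_eq => V f fr; rewrite !extE// addrC. Qed.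
Fact presented_add0 : left_id zero add.
Proof. by move=> x; apply: presented_eq => V f fr; rewrite !extE// add0r. Qed.
Fact presented_addN : left_inverse zero opp add.
Proof.
by move=> x; apply: presented_eq => V f fr; rewrite !extE// scaleN1r addNr.
Qed.
HB.instance Definition _ := GRing.isZmodule.Build presented
  presented_addA presented_addC presented_add0 presented_addN.

Fact presented_scaleA a b x : scale a (scale b x) = scale (a * b) x.
Proof. by apply: presented_eq => V f fr; rewrite !extE// scalerA. Qed.
Fact presented_scale1 : left_id 1 scale.
Proof. by move=> x; apply: presented_eq => V f fr; rewrite !extE// scale1r. Qed.
Fact presented_scaleDr : right_distributive scale +%R.
Proof.
by move=> a x y; apply: presented_eq => V f fr; rewrite !extE// scalerDr.
Qed.
Fact presented_scaleDl x : {morph scale^~ x : a b / a + b}.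
Proof.
by move=> a b; apply: presented_eq => V f fr; rewrite !extE// scalerDl.
Qed.
HB.instance Definition _ := GRing.Zmodule_isLmodule.Build k presented
  presented_scaleA presented_scale1 presented_scaleDr presented_scaleDl.

Definition span_of (S : set G) : set presented :=
  [set x | exists l : seq (k * {g : G | S g}),
     x = pres_class [seq (cg.1, sval cg.2) | cg <- l]].

End PresentedModule.
Arguments pgen {k G rel} g.

(** * Involutive differential graded algebras *)

(** As {group gT} and {vspace V} do for groups and vector spaces, this presents
    a graded module inside ambient modules: its part of degree [p] is the set
    [gmem p] of elements of [gcar p]. The product of elements of degrees [p] and
    [q] is indexed by a degree [r] with [p + q = r], so that associativity and
    the sign rules need no transport along equations between degrees. *)
Record invDgaData (k : fieldType) := InvDgaData {
  gcar : nat -> lmodType k;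
  gmem : forall p, set (gcar p);
  gone : gcar 0;
  gmul : forall p q r, (p + q = r)%N -> gcar p -> gcar q -> gcar r;
  gdif : forall p, gcar p -> gcar p.+1;
  ginv : forall p, gcar p -> gcar p
}.
Arguments gmem {k} _ {p}.
Arguments gone {k} _.
Arguments gmul {k _ p q r}.
Arguments gdif {k _ p}.
Arguments ginv {k _ p}.

Section InvolutiveDga.
Variable k : fieldType.
Implicit Types A B : invDgaData k.

Definition graded_linear A B s (f : forall p, gcar A p -> gcar B (s + p)%N) :=
  (forall p x, gmem A x -> gmem B (f p x)) /\
  (forall p (a : k) x y, gmem A x -> gmem A y ->
     f p (a *: x + y) = a *: f p x + f p y).

Definition is_dga A :=
  [/\ [/\ forall p, gmem A (0 : gcar A p),
          forall p (a : k) (x y : gcar A p),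
            gmem A x -> gmem A y -> gmem A (a *: x + y),
          gmem A (gone A) &
          forall p q r (e : (p + q = r)%N) (x : gcar A p) (y : gcar A q),
            gmem A x -> gmem A y -> gmem A (gmul e x y)],
      (forall p q r (e : (p + q = r)%N) (a : k) (x x' : gcar A p) (y : gcar A q),
         gmem A x -> gmem A x' -> gmem A y ->
         gmul e (a *: x + x') y = a *: gmul e x y + gmul e x' y) /\
      (forall p q r (e : (p + q = r)%N) (a : k) (x : gcar A p) (y y' : gcar A q),
         gmem A x -> gmem A y -> gmem A y' ->
         gmul e x (a *: y + y') = a *: gmul e x y + gmul e x y'),
      [/\ forall p (e : (0 + p = p)%N) (x : gcar A p),
            gmem A x -> gmul e (gone A) x = x,
          forall p (e : (p + 0 = p)%N) (x : gcar A p),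
            gmem A x -> gmul e x (gone A) = x &
          forall p q r pq qr s (e1 : (p + q = pq)%N) (e2 : (pq + r = s)%N)
              (e3 : (q + r = qr)%N) (e4 : (p + qr = s)%N)
              (x : gcar A p) (y : gcar A q) (z : gcar A r),
            gmem A x -> gmem A y -> gmem A z ->
            gmul e2 (gmul e1 x y) z = gmul e4 x (gmul e3 y z)],
      graded_linear (s := 1) (fun p (x : gcar A p) => gdif x) /\
      (forall p (x : gcar A p), gmem A x -> gdif (gdif x) = 0) &
      forall p q r (e : (p + q = r)%N) (e1 : (p.+1 + q = r.+1)%N)
          (e2 : (p + q.+1 = r.+1)%N) (x : gcar A p) (y : gcar A q),
        gmem A x -> gmem A y ->
        gdif (gmul e x y) = gmul e1 (gdif x) y + (-1) ^+ p *: gmul e2 x (gdif y)].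

Definition is_involution A :=
  [/\ graded_linear (s := 0) (fun p (x : gcar A p) => ginv x),
      forall p (x : gcar A p), gmem A x -> ginv (gdif x) = gdif (ginv x),
      forall p (x : gcar A p), gmem A x -> ginv (ginv x) = x,
      ginv (gone A) = gone A &
      forall p q r (e : (p + q = r)%N) (e' : (q + p = r)%N)
          (x : gcar A p) (y : gcar A q), gmem A x -> gmem A y ->
        ginv (gmul e x y) = (-1) ^+ (p * q) *: gmul e' (ginv y) (ginv x)].

Definition is_involutive_dga A := is_dga A /\ is_involution A.

Definition is_dga_map A B (f : forall p, gcar A p -> gcar B p) :=
  [/\ graded_linear (s := 0) f,
      f 0%N (gone A) = gone B,
      forall p q r (e : (p + q = r)%N) (x : gcar A p) (y : gcar A q),
        gmem A x -> gmem A y -> f r (gmul e x y) = gmul e (f p x) (f q y) &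
      forall p (x : gcar A p), gmem A x -> f p.+1 (gdif x) = gdif (f p x)].

Definition is_involutive_dga_map A B (f : forall p, gcar A p -> gcar B p) :=
  [/\ is_involutive_dga A, is_involutive_dga B, is_dga_map f &
      forall p (x : gcar A p), gmem A x -> f p (ginv x) = ginv (f p x)].

End InvolutiveDga.

(** * Reflexive sets and simplicial maps *)

Record reflexiveSet := ReflexiveSet {
  cell :> nat -> Type;
  face : forall n, 'I_n.+2 -> cell n.+1 -> cell n;
  degen : forall n, 'I_n.+1 -> cell n -> cell n.+1;
  flip : forall n, cell n -> cell n;
  face_face : forall n (i : 'I_n.+2) (j : 'I_n.+3) (x : cell n.+2),
    (i < j)%N ->
    face i (face j x) = face (inord j.-1) (face (inord i) x);
  degen_degen : forall n (i : 'I_n.+2) (j : 'I_n.+1) (x : cell n),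
    (i <= j)%N ->
    degen i (degen j x) = degen (inord j.+1) (degen (inord i) x);
  face_degen_lt : forall n (i : 'I_n.+3) (j : 'I_n.+2) (x : cell n.+1),
    (i < j)%N ->
    face i (degen j x) = degen (inord j.-1) (face (inord i) x);
  face_degen_eq : forall n (i : 'I_n.+2) (j : 'I_n.+1) (x : cell n),
    (i == j :> nat) || (i == j.+1 :> nat) -> face i (degen j x) = x;
  face_degen_gt : forall n (i : 'I_n.+3) (j : 'I_n.+2) (x : cell n.+1),
    (j.+1 < i)%N ->
    face i (degen j x) = degen (inord j) (face (inord i.-1) x);
  flipK : forall n (x : cell n), flip (flip x) = x;
  face_flip : forall n (i : 'I_n.+2) (x : cell n.+1),
    face i (flip x) = flip (face (rev_ord i) x);
  degen_flip : forall n (i : 'I_n.+1) (x : cell n),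
    degen i (flip x) = flip (degen (rev_ord i) x)
}.

(** The structure maps of an involutive reflexive dga; [r_n] is the involution
    of the dga [lev n]. *)
Record reflexiveDgaData (k : fieldType) := ReflexiveDgaData {
  lev :> nat -> invDgaData k;
  dface : forall n, 'I_n.+2 -> forall p, gcar (lev n.+1) p -> gcar (lev n) p;
  ddegen : forall n, 'I_n.+1 -> forall p, gcar (lev n) p -> gcar (lev n.+1) p
}.

Section SimplicialMaps.
Variables (k : fieldType) (A : reflexiveDgaData k) (K : reflexiveSet).

Definition smap (p : nat) : lmodType k :=
  dprod (fun n => (K n -> gcar (A n) p) : lmodType k).

Definition simplicial p (Phi : smap p) :=
  [/\ forall n (s : K n), gmem (A n) (Phi n s),
      forall n (i : 'I_n.+2) (s : K n.+1),
        Phi n (face i s) = dface i (Phi n.+1 s) &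
      forall n (i : 'I_n.+1) (s : K n),
        Phi n.+1 (degen i s) = ddegen i (Phi n s)].

(** The dga [A(K)]. *)
Definition smap_dga : invDgaData k := {|
  gcar := smap;
  gmem := simplicial;
  gone := fun n s => gone (A n);
  gmul := fun p q r e Phi Psi n s => gmul e (Phi n s) (Psi n s);
  gdif := fun p Phi n s => gdif (Phi n s);
  ginv := fun p Phi n s => ginv (Phi n (flip s)) |}.

End SimplicialMaps.

(** The maps [A(K) -> B(K)] and [A(L) -> A(K)] induced by [f : A -> B] and by
    [g : K -> L]. *)
Definition smap_post (k : fieldType) (A B : reflexiveDgaData k) K
    (f : forall n p, gcar (A n) p -> gcar (B n) p) p
    (Phi : gcar (smap_dga A K) p) : gcar (smap_dga B K) p :=
  fun n s => f n p (Phi n s).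

Definition smap_pre (k : fieldType) (A : reflexiveDgaData k) (K L : reflexiveSet)
    (g : forall n, K n -> L n) p
    (Phi : gcar (smap_dga A L) p) : gcar (smap_dga A K) p :=
  fun n s => Phi n (g n s).

(** * The maps of finite ordinals behind faces and degeneracies *)

Definition codegen n (i : 'I_n.+1) (j : 'I_n.+2) : 'I_n.+1 := inord (unbump i j).

(** * Simplicial cochains of the standard simplices *)

(** The [p]-simplices of [Delta[n]]. *)
Record mono p n := Mono {
  mfun :> 'I_p.+1 -> 'I_n.+1;
  monoP : {homo mfun : i j / (i <= j)%N} }.

Definition mcomp p q n (g : mono q n) (f : mono p q) : mono p n :=
  @Mono p n (g \o f) (fun i j ij => monoP g (monoP f ij)).

Fact coface_mono n (i : 'I_n.+2) : {homo lift i : j l / (j <= l)%N}.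
Proof. by move=> j l; rewrite /= leq_bump2. Qed.
Definition mcoface n (i : 'I_n.+2) : mono n n.+1 := Mono (@coface_mono n i).

Fact codegen_mono n (i : 'I_n.+1) : {homo codegen i : j l / (j <= l)%N}.
Proof.
by move=> j l jl; rewrite /codegen !inordK /unbump;
   move: (ltn_ord j) (ltn_ord l) (ltn_ord i); lia.
Qed.
Definition mcodegen n (i : 'I_n.+1) : mono n.+1 n := Mono (@codegen_mono n i).

Fact front_mono p q r (e : (p + q = r)%N) :
  {homo (fun i : 'I_p.+1 => inord i : 'I_r.+1) : i j / (i <= j)%N}.
Proof.
by move=> i j ij; rewrite !inordK; move: (ltn_ord i) (ltn_ord j); lia.
Qed.
Definition mfront p q r (e : (p + q = r)%N) : mono p r := Mono (front_mono e).

Fact back_mono p q r (e : (p + q = r)%N) :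
  {homo (fun j : 'I_q.+1 => inord (p + j) : 'I_r.+1) : i j / (i <= j)%N}.
Proof.
by move=> i j ij; rewrite !inordK; move: (ltn_ord i) (ltn_ord j); lia.
Qed.
Definition mback p q r (e : (p + q = r)%N) : mono q r := Mono (back_mono e).

Fact mrev_mono p n (s : mono p n) :
  {homo (fun i => rev_ord (s (rev_ord i))) : i j / (i <= j)%N}.
Proof.
move=> i j ij /=.
have /(monoP s) : (rev_ord j <= rev_ord i)%N by rewrite /=; lia.
lia.
Qed.
Definition mrev p n (s : mono p n) : mono p n := Mono (mrev_mono s).

Section CPL.
Variable k : fieldType.

Definition cochain n p : lmodType k := (mono p n -> k^o).

Definition normalized n p : cochain n p -> Prop :=
  match p with
  | 0 => fun=> True
  | p'.+1 => fun c => forall (i : 'I_p'.+1) (s : mono p' n),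
                        c (mcomp s (mcodegen i)) = 0
  end.

(** The differential is dual to the boundary operator, with the Koszul sign;
    this is what the Leibniz rule for the product below requires. *)
Definition CPL_lev n : invDgaData k := {|
  gcar := cochain n;
  gmem := @normalized n;
  gone := fun=> 1;
  gmul := fun p q r e c1 c2 s =>
    (-1) ^+ (p * q) * (c1 (mcomp s (mfront e)) * c2 (mcomp s (mback e)));
  gdif := fun p c s =>
    (-1) ^+ p.+1 * \sum_(i < p.+2) (-1) ^+ i * c (mcomp s (mcoface i));
  ginv := fun p c s => (-1) ^+ ((p * p.+1)./2) * c (mrev s) |}.

Definition CPL : reflexiveDgaData k := {|
  lev := CPL_lev;
  dface := fun n i p (c : cochain n.+1 p) =>
    (fun s => c (mcomp (mcoface i) s)) : cochain n p;
  ddegen := fun n i p (c : cochain n p) =>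
    (fun s => c (mcomp (mcodegen i) s)) : cochain n.+1 p |}.

End CPL.

(** * Polynomial forms *)

Section APL.
Variable k : fieldType.

(** The generators: [(false, i)] is [t_i] and [(true, i)] is [dt_i]. *)
Definition letter n : Type := bool * 'I_n.+1.
Definition word n := seq (letter n).
Definition wdeg n (w : word n) : nat := (\sum_(l <- w) l.1)%N.

(** The two-sided ideal of the free algebra on the letters generated by the
    graded commutators, [\sum_i t_i - 1] and [\sum_i dt_i]. *)
Definition APL_rel n : set (seq (k * word n)) :=
  [set r | exists u v : word n,
     [\/ exists x y : letter n,
           r = [:: (1, u ++ [:: x; y] ++ v);
                   (- (-1) ^+ (x.1 && y.1), u ++ [:: y; x] ++ v)],
         r = (- 1, u ++ v) ::
             [seq (1, u ++ (false, i) :: v) | i <- enum 'I_n.+1] |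
         r = [seq (1, u ++ (true, i) :: v) | i <- enum 'I_n.+1]]].

Definition APL_alg n := presented (@APL_rel n).

Definition lmul n (l : letter n) : APL_alg n -> APL_alg n :=
  lin_ext (fun w => pgen (l :: w)).

Fixpoint word_dif n (w : word n) : APL_alg n :=
  match w with
  | [::] => 0
  | (false, i) :: w' => pgen ((true, i) :: w') + lmul (false, i) (word_dif w')
  | (true, i) :: w' => - lmul (true, i) (word_dif w')
  end.

(** The dga map with [t_j |-> \sum_(i | f i = j) t_i]. *)
Definition APL_pull m n (f : 'I_m.+1 -> 'I_n.+1) : APL_alg n -> APL_alg m :=
  lin_ext (foldr (fun l x => \sum_(i | f i == l.2) lmul (l.1, i) x) (pgen [::])).

Definition APL_lev n : invDgaData k := {|
  gcar := fun=> APL_alg n : lmodType k;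
  gmem := fun p => span_of [set w | wdeg w = p];
  gone := pgen [::];
  gmul := fun p q r e x y =>
    lin_ext (fun u => lin_ext (fun v => pgen (u ++ v) : APL_alg n) y) x;
  gdif := fun p => lin_ext (@word_dif n);
  ginv := fun p => APL_pull (@rev_ord n.+1) |}.

Definition APL : reflexiveDgaData k := {|
  lev := APL_lev;
  dface := fun n i p => APL_pull (lift i);
  ddegen := fun n i p => APL_pull (codegen i) |}.

End APL.

(** * Tensor products *)

Section Tensor.
Variable k : fieldType.

Section TensorModule.
Variables B C : invDgaData k.

Definition tgen : Type := {p : nat & {q : nat & gcar B p * gcar C q}}%type.
Definition TGen p q (b : gcar B p) (c : gcar C q) : tgen :=
  existT _ p (existT _ q (b, c)).

Definition tensor_rel : set (seq (k * tgen)) :=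
  [set r | exists p q,
     (exists a (b b' : gcar B p) (c : gcar C q),
        r = [:: (1, TGen (a *: b + b') c); (- a, TGen b c); (- 1, TGen b' c)]) \/
     (exists a (b : gcar B p) (c c' : gcar C q),
        r = [:: (1, TGen b (a *: c + c')); (- a, TGen b c); (- 1, TGen b c')])].

Definition tensor_mod := presented tensor_rel.

Definition tens p q (b : gcar B p) (c : gcar C q) : tensor_mod := pgen (TGen b c).

(** The linear map with prescribed values on the pure tensors. *)
Definition tens_ext (V : lmodType k)
    (f : forall p q, gcar B p -> gcar C q -> V) : tensor_mod -> V :=
  lin_ext (fun g : tgen => f _ _ (projT2 (projT2 g)).1 (projT2 (projT2 g)).2).

End TensorModule.

(** [tensor_mod] is the tensor product of the sums of all ambient modules; its
    part of degree [r] is spanned by the [b (x) c] with [b] and [c] elements of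
    the two dga's whose degrees add up to [r]. *)
Definition tensor_dga (B C : invDgaData k) : invDgaData k := {|
  gcar := fun=> tensor_mod B C : lmodType k;
  gmem := fun r => span_of [set g | exists p q (b : gcar B p) (c : gcar C q),
           [/\ (p + q = r)%N, gmem B b, gmem C c & g = TGen b c]];
  gone := tens (gone B) (gone C);
  gmul := fun _ _ _ _ x y =>
    tens_ext (fun p q b c => tens_ext (fun p' q' b' c' =>
      (-1) ^+ (q * p') *: tens (gmul erefl b b') (gmul erefl c c')) y) x;
  gdif := fun _ => tens_ext (fun p q b c =>
    tens (gdif b) c + (-1) ^+ p *: tens b (gdif c));
  ginv := fun _ => tens_ext (fun p q b c => tens (ginv b) (ginv c)) |}.

Definition tensor (B C : reflexiveDgaData k) : reflexiveDgaData k := {|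
  lev := fun n => tensor_dga (B n) (C n);
  dface := fun n i _ => tens_ext (fun p q (b : gcar (B n.+1) p) (c : gcar (C n.+1) q) =>
    tens (dface i b) (dface i c));
  ddegen := fun n i _ => tens_ext (fun p q (b : gcar (B n) p) (c : gcar (C n) q) =>
    tens (ddegen i b) (ddegen i c)) |}.

Variables B C : reflexiveDgaData k.

Definition tensor_inl n p (b : gcar (B n) p) : gcar (tensor B C n) p :=
  tens b (gone (C n)).
Definition tensor_inr n p (c : gcar (C n) p) : gcar (tensor B C n) p :=
  tens (gone (B n)) c.

End Tensor.

(** * Smooth functions and alternating forms on normed spaces *)

Section Smooth.
Variables (R : realType) (V W : normedModType R).

Fixpoint Cn (r : nat) (U : set V) (f : V -> W) : Prop :=
  match r with
  | 0 => forall x, U x -> {for x, continuous f}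
  | r'.+1 => (forall x, U x -> differentiable f x) /\
             forall v, Cn r' U ('D_v f)
  end.

Definition smooth_on (U : set V) (f : V -> W) := forall r, Cn r U f.

End Smooth.

Lemma smooth_on_linear (R : realType) (V' V W : normedModType R)
    (L : {linear V' -> V}) (U : set V) (f : V -> W) :
  continuous L -> smooth_on U f -> smooth_on (L @^-1` U) (f \o L).
Proof.
move=> cL sf r; move: (sf r); elim: r f {sf} => [|r IH] f /=.
  by move=> cf x Ux; apply: (@continuous_comp _ _ _ L f x); [exact: cL|exact: cf].
move=> [df Df]; split=> [x Ux|v].
  apply: (@differentiable_comp R V' V W L f x).
    exact: linear_differentiable.
  exact: df.
have -> : 'D_v (f \o L) = 'D_(L v) f \o L.
  apply/funext => x; rewrite /= /derive.
  have -> : (fun h : R => h^-1 *: ((f \o L \o shift x) (h *: v) - (f \o L) x)) =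
    (fun h : R => h^-1 *: ((f \o shift (L x)) (h *: L v) - f (L x))); last by [].
  by apply/funext => h; rewrite /= linearP.
exact: IH.
Qed.

Section Forms.
Variables (R : realType) (E : lmodType R).

Definition aform p : lmodType R := (('I_p -> E) -> R^o).

Definition alternating p (a : aform p) :=
  (forall v i (c : R) (u w : E),
     a [eta v with i |-> c *: u + w] =
     c * a [eta v with i |-> u] + a [eta v with i |-> w]) /\
  (forall v i j, i != j -> v i = v j -> a v = 0).

Definition wedge p q r (e : (p + q = r)%N) (a : aform p) (b : aform q) : aform r :=
  fun v => (p`!%:R * q`!%:R)^-1 *
    \sum_(s : 'S_r) (-1) ^+ s *
      (a (fun i => v (s (cast_ord e (lshift q i)))) *
       b (fun j => v (s (cast_ord e (rshift p j))))).

(** The exterior derivative of a family of forms on [E] parametrized by [X],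
    given directional derivatives of functions on [X]. *)
Definition ext_dif (X : Type) (D : E -> (X -> R^o) -> X -> R^o) p
    (w : X -> aform p) : X -> aform p.+1 :=
  fun x v => \sum_(i < p.+1)
    (-1) ^+ i * D (v i) (fun y => w y (fun j => v (lift i j))) x.

End Forms.

(** * Smooth forms on the geometric simplices *)

Section Simplex.
Variables (R : realType) (n : nat).

Record simplex := Simplex {
  bary :> 'rV[R]_n.+1;
  _ : [forall i, 0 <= bary 0 i] && (\sum_i bary 0 i == 1) }.
HB.instance Definition _ := [isSub for bary].
HB.instance Definition _ := [Choice of simplex by <:].

(** The tangent space of the simplex, at any of its points. *)
Definition tangent_pred : {pred 'rV[R]_n.+1} := fun v => \sum_i v 0 i == 0.
Fact tangent_closed : submod_closed tangent_pred.
Proof.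
split=> [|a u v]; rewrite !unfold_in.
  by rewrite big1// => i _; rewrite mxE.
move=> /eqP u0 /eqP v0; under eq_bigr do rewrite !mxE.
by rewrite big_split/= -mulr_sumr u0 v0 mulr0 addr0.
Qed.
HB.instance Definition _ :=
  GRing.isSubmodClosed.Build R 'rV[R]_n.+1 tangent_pred tangent_closed.

Record tangent := Tangent { tvec :> 'rV[R]_n.+1; _ : tvec \in tangent_pred }.
HB.instance Definition _ := [isSub for tvec].
HB.instance Definition _ := [Choice of tangent by <:].
HB.instance Definition _ := [SubChoice_isSubLmodule of tangent by <:].

(** [F] is smooth near [x] and extends [g] there. *)
Definition local_extension (W : normedModType R) (g : simplex -> W) (x : simplex)
    (F : 'rV[R]_n.+1 -> W) :=
  exists U : set 'rV[R]_n.+1,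
    [/\ open U, U x, smooth_on U F & forall y : simplex, U y -> F y = g y].

Definition smooth_at (W : normedModType R) (g : simplex -> W) (x : simplex) :=
  exists F, local_extension g x F.

(** The derivative of a smooth function along a tangent vector, computed with a
    smooth extension around [x]; it does not depend on the extension. *)
Definition tderive (W : normedModType R) (v : tangent) (g : simplex -> W)
    (x : simplex) : W :=
  'D_(tvec v) (xget (fun=> 0) (local_extension g x)) (bary x).

End Simplex.

Section Push.
Variables (R : realType) (m n : nat) (f : 'I_m.+1 -> 'I_n.+1).

(** The linear map sending the [i]-th vertex to the [f i]-th one. *)
Definition push (x : 'rV[R]_m.+1) : 'rV[R]_n.+1 :=
  \row_j \sum_(i | f i == j) x 0 i.

Fact push_linear : linear push.
Proof.
move=> a x y; apply/rowP => j; rewrite !mxE mulr_sumr -big_split/=.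
by apply: eq_bigr => i _; rewrite !mxE.
Qed.
HB.instance Definition _ :=
  GRing.isLinear.Build R 'rV[R]_m.+1 'rV[R]_n.+1 _ push push_linear.

Lemma push_sum x : \sum_j push x 0 j = \sum_i x 0 i.
Proof.
rewrite (partition_big f predT)//=.
by apply: eq_bigr => j _; rewrite mxE.
Qed.

Fact push_simplex (x : simplex R m) :
  [forall j, 0 <= push x 0 j] && (\sum_j push x 0 j == 1).
Proof.
case: x => x /= /andP[/forallP x0 x1]; rewrite push_sum x1 andbT.
by apply/forallP => j; rewrite mxE sumr_ge0.
Qed.
Definition spush (x : simplex R m) : simplex R n := Simplex (push_simplex x).

Fact push_tangent (v : tangent R m) : push v \in @tangent_pred R n.
Proof. by case: v => v /=; rewrite !unfold_in push_sum. Qed.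
Definition tpush (v : tangent R m) : tangent R n := Tangent (push_tangent v).

Lemma push_continuous : continuous push.
Proof.
move=> x A [P Pn sA].
have Q : \forall y \near x, forall i j, P i j (push y i j).
  refine (@filter_forall _ _ (fun i y => forall j, P i j (push y i j))
    (nbhs x) _ _) => i.
  refine (@filter_forall _ _ (fun j y => P i j (push y i j)) (nbhs x) _ _) => j.
  have : continuous (fun y : 'rV[R]_m.+1 => push y i j).
    have -> : (fun y => push y i j) =
        (fun y : 'rV[R]_m.+1 => \sum_(l | f l == j) y 0 l).
      by apply/funext => y; rewrite mxE.
    apply: continuous_big => [|l _]; last exact: coord_continuous.
    exact: add_continuous.
  by move=> /(_ x); apply; exact: Pn.
by apply: filterS Q => y Py; apply: sA.
Qed.

End Push.

Lemma spush_comp (R : realType) l m n (f : 'I_l.+1 -> 'I_m.+1)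
    (g : 'I_m.+1 -> 'I_n.+1) (x : simplex R l) :
  spush g (spush f x) = spush (g \o f) x.
Proof.
apply/val_inj/rowP => j; rewrite /= !mxE (partition_big f (fun i => g i == j))//=.
apply: eq_bigr => i /eqP gij; rewrite mxE; apply: eq_bigl => h.
by rewrite andb_idl// => /eqP ->; apply/eqP.
Qed.

Lemma spush_id (R : realType) n (x : simplex R n) : spush id x = x.
Proof. by apply/val_inj/rowP => j; rewrite /= mxE big_pred1_eq. Qed.

Section ADR.
Variable R : realType.

Definition dR_form n p : lmodType R := (simplex R n -> aform (tangent R n) p).

Definition smooth_form n p (w : dR_form n p) :=
  (forall x, alternating (w x)) /\
  (forall v x, smooth_at (fun y => w y v) x).

Definition dR_pull m n (f : 'I_m.+1 -> 'I_n.+1) p (w : dR_form n p) : dR_form m p :=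
  fun x v => w (spush f x) (fun i => tpush f (v i)).

Definition ADR_lev n : invDgaData R := {|
  gcar := dR_form n;
  gmem := @smooth_form n;
  gone := fun=> fun=> 1;
  gmul := fun p q r e w1 w2 x => wedge e (w1 x) (w2 x);
  gdif := fun p => ext_dif (@tderive R n R^o) (p := p);
  ginv := fun p => dR_pull (@rev_ord n.+1) (p := p) |}.

Definition ADR : reflexiveDgaData R := {|
  lev := ADR_lev;
  dface := fun n i p => dR_pull (lift i) (p := p);
  ddegen := fun n i p => dR_pull (codegen i) (p := p) |}.

(** The inclusion of polynomial forms: the dga map sending the generators [t_i]
    and [dt_i] to the barycentric coordinates and their differentials. *)
Definition bary_fun n (i : 'I_n.+1) : dR_form n 0 := fun x _ => bary x 0 i.
Definition bary_dif n (i : 'I_n.+1) : dR_form n 1 := fun _ v => tvec (v 0) 0 i.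

Fixpoint word_form n (w : word n) (p : nat) : dR_form n p :=
  match w with
  | [::] => match p with 0 => gone (ADR_lev n) | _.+1 => 0 end
  | (false, i) :: w' =>
      gmul (i := ADR_lev n) (erefl : (0 + p = p)%N) (bary_fun i) (@word_form n w' p)
  | (true, i) :: w' =>
      match p with
      | 0 => 0
      | p'.+1 => gmul (i := ADR_lev n) (erefl : (1 + p' = p'.+1)%N)
                   (bary_dif i) (@word_form n w' p')
      end
  end.

Definition APL_to_ADR n p : gcar (APL R n) p -> gcar (ADR n) p :=
  lin_ext (fun w => @word_form n w p).

End ADR.

(** * Smooth manifolds *)

(** A manifold without boundary of dimension [m], with a smooth atlas;
    [chart_coord c] and [chart_inv c] are only meaningful on the domain of the
    chart [c] and on its image. *)
Record manifold (R : realType) (m : nat) := Manifold {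
  mpoint :> topologicalType;
  chart : Type;
  chart_dom : chart -> set mpoint;
  chart_coord : chart -> mpoint -> 'rV[R]_m;
  chart_inv : chart -> 'rV[R]_m -> mpoint;
  manifold_hausdorff : hausdorff_space mpoint;
  manifold_countable : @second_countable mpoint;
  dom_open : forall c, open (chart_dom c);
  dom_cover : forall x, exists c, chart_dom c x;
  coordK : forall c x, chart_dom c x -> chart_inv c (chart_coord c x) = x;
  coord_continuous_on : forall c (O : set 'rV[R]_m),
    open O -> open (chart_dom c `&` chart_coord c @^-1` O);
  coord_open : forall c (O : set mpoint),
    open O -> O `<=` chart_dom c -> open (chart_coord c @` O);
  transition_smooth : forall c c',
    smooth_on (chart_coord c @` (chart_dom c `&` chart_dom c'))
      (chart_coord c' \o chart_inv c)
}.

Section DeRham.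
Variables (R : realType) (m : nat) (M : manifold R m).

Definition chart_image (c : chart M) : set 'rV[R]_m := chart_coord c @` chart_dom c.

(** A family of forms in the charts; the form in a chart is extended by 0
    outside the image of the chart. *)
Definition local_forms p : lmodType R :=
  dprod (fun _ : chart M => ('rV[R]_m -> aform 'rV[R]_m p) : lmodType R).

Definition global_form p (w : local_forms p) :=
  [/\ forall c y v, ~ chart_image c y -> w c y v = 0,
      forall c y, chart_image c y -> alternating (w c y),
      forall c v, smooth_on (chart_image c) (fun y => w c y v : R^o) &
      forall c c' x v, chart_dom c x -> chart_dom c' x ->
        w c (chart_coord c x) v =
        w c' (chart_coord c' x)
          (fun i => 'D_(v i) (chart_coord c' \o chart_inv c) (chart_coord c x))].

(** The de Rham algebra, with the identity as its involution. *)
Definition deRham : invDgaData R := {|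
  gcar := local_forms;
  gmem := global_form;
  gone := fun c y _ => if `[< chart_image c y >] then 1 else 0;
  gmul := fun p q r e w1 w2 c y => wedge e (w1 c y) (w2 c y);
  gdif := fun p w c y =>
    if `[< chart_image c y >]
    then ext_dif (fun v (f : 'rV[R]_m -> R^o) => 'D_v f) (w c) y else 0;
  ginv := fun p w => w |}.

Definition cont_simplex n (s : simplex R n -> M) :=
  continuous (s : initial_topology (@bary R n) -> M).

Definition smooth_simplex n (s : simplex R n -> M) :=
  cont_simplex s /\
  forall c x, chart_dom c (s x) -> smooth_at (chart_coord c \o s) x.

End DeRham.

Fact cont_simplex_push (R : realType) m (M : manifold R m) l n
    (f : 'I_l.+1 -> 'I_n.+1) (s : simplex R n -> M) :
  cont_simplex s -> cont_simplex (s \o spush f).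
Proof.
move=> cs x.
apply: (@continuous_comp (initial_topology (@bary R l))
  (initial_topology (@bary R n)) _ (spush f) s x); last exact: cs.
move: x; apply: continuous_comp_initial => x.
apply: (@continuous_comp (initial_topology (@bary R l)) _ _ (@bary R l) (push f)).
  exact: initial_continuous.
exact: push_continuous.
Qed.

Fact smooth_simplex_push (R : realType) m (M : manifold R m) l n
    (f : 'I_l.+1 -> 'I_n.+1) (s : simplex R n -> M) :
  smooth_simplex s -> smooth_simplex (s \o spush f).
Proof.
move=> [cs ss]; split; first exact: cont_simplex_push.
move=> c x cx; have [F [U [oU Ux sF FE]]] := ss c (spush f x) cx.
exists (F \o push f), (push f @^-1` U); split => //.
- by apply: open_comp => // y _; exact: push_continuous.
- exact: (smooth_on_linear (@push_continuous _ _ _ f) sF).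
- by move=> y Uy; exact: (FE (spush f y) Uy).
Qed.

(** * Singular simplices *)

(** The identities between the maps of finite ordinals behind faces,
    degeneracies and the flip. *)
Section Ordinals.
Variable n : nat.

Fact coface_coface (i : 'I_n.+2) (j : 'I_n.+3) : (i < j)%N ->
  lift j \o lift i =1 lift (inord i) \o lift (inord j.-1).
Proof.
move=> ij l; apply/val_inj; rewrite /= !inordK /bump; move: (ltn_ord i) (ltn_ord j); lia.
Qed.

Fact codegen_codegen (i : 'I_n.+2) (j : 'I_n.+1) : (i <= j)%N ->
  codegen j \o codegen i =1 codegen (inord i) \o codegen (inord j.+1).
Proof.
move: i j => [i hi] [j hj] /= ij [l hl]; apply/val_inj; move: hl.
rewrite /codegen/= => hl; rewrite !inordK /unbump; lia.
Qed.

Fact codegen_coface_lt (i : 'I_n.+3) (j : 'I_n.+2) : (i < j)%N ->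
  codegen j \o lift i =1 lift (inord i) \o codegen (inord j.-1).
Proof.
move: i j => [i hi] [j hj] /= ij [l hl]; apply/val_inj; move: hl.
rewrite /codegen/= => hl; rewrite !inordK /unbump /bump; lia.
Qed.

Fact codegen_coface_eq (i : 'I_n.+2) (j : 'I_n.+1) :
  (i == j :> nat) || (i == j.+1 :> nat) -> codegen j \o lift i =1 id.
Proof.
move: i j => [i hi] [j hj] /= ij [l hl]; apply/val_inj; move: hl.
rewrite /codegen/= => hl; rewrite !inordK /unbump /bump; lia.
Qed.

Fact codegen_coface_gt (i : 'I_n.+3) (j : 'I_n.+2) : (j.+1 < i)%N ->
  codegen j \o lift i =1 lift (inord i.-1) \o codegen (inord j).
Proof.
move: i j => [i hi] [j hj] /= ij [l hl]; apply/val_inj; move: hl.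
rewrite /codegen/= => hl; rewrite !inordK /unbump /bump; lia.
Qed.

Fact rev_coface (i : 'I_n.+2) :
  @rev_ord n.+2 \o lift i =1 lift (rev_ord i) \o @rev_ord n.+1.
Proof.
move: i => [i hi] [l hl]; apply/val_inj; move: hl => /= hl.
rewrite /= /bump; lia.
Qed.

Fact rev_codegen (i : 'I_n.+1) :
  @rev_ord n.+1 \o codegen i =1 codegen (rev_ord i) \o @rev_ord n.+2.
Proof.
move: i => [i hi] [l hl]; apply/val_inj; move: hl => /= hl.
rewrite /codegen/= !inordK /unbump /=; lia.
Qed.

End Ordinals.

(** A kind of singular simplices, closed under vertex maps. *)
Record singKind (R : realType) (T : Type) := SingKind {
  sing_prop : forall n, (simplex R n -> T) -> Prop;
  sing_push : forall m n (f : 'I_m.+1 -> 'I_n.+1) (s : simplex R n -> T),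
    sing_prop s -> sing_prop (s \o spush f) }.

Section Singular.
Variables (R : realType) (T : Type) (S : singKind R T).

Definition sing_cell n : Type := {s : simplex R n -> T | sing_prop S s}.

Definition sing_pull m n (f : 'I_m.+1 -> 'I_n.+1) (s : sing_cell n) : sing_cell m :=
  exist _ (sval s \o spush f) (sing_push f (svalP s)).

Lemma sing_pull_comp l m n (f : 'I_l.+1 -> 'I_m.+1) (g : 'I_m.+1 -> 'I_n.+1) s :
  sing_pull f (sing_pull g s) = sing_pull (g \o f) s.
Proof. by apply: eq_exist; apply/funext => x /=; rewrite spush_comp. Qed.

Lemma sing_pull_id n (f : 'I_n.+1 -> 'I_n.+1) s : f =1 id -> sing_pull f s = s.
Proof.
move=> /funext ->; case: s => s Ps; apply: eq_exist.
by apply/funext => x /=; rewrite spush_id.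
Qed.

Lemma sing_pull_eq m n (f g : 'I_m.+1 -> 'I_n.+1) s :
  f =1 g -> sing_pull f s = sing_pull g s.
Proof. by move=> /funext ->. Qed.

(** The flip is [(t_0, ..., t_n) |-> (t_n, ..., t_0)]. *)
Definition sing : reflexiveSet.
Proof.
refine (@ReflexiveSet sing_cell
  (fun n i => sing_pull (lift i)) (fun n i => sing_pull (codegen i))
  (fun n => sing_pull (@rev_ord n.+1)) _ _ _ _ _ _ _ _) => *;
  rewrite ?sing_pull_comp.
- exact/sing_pull_eq/coface_coface.
- exact/sing_pull_eq/codegen_codegen.
- exact/sing_pull_eq/codegen_coface_lt.
- exact/sing_pull_id/codegen_coface_eq.
- exact/sing_pull_eq/codegen_coface_gt.
- by apply: sing_pull_id => i; exact: rev_ordK.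
- exact/sing_pull_eq/rev_coface.
- exact/sing_pull_eq/rev_codegen.
Defined.

End Singular.

Section ManifoldMaps.
Variables (R : realType) (m : nat) (M : manifold R m).

Definition Sing : reflexiveSet :=
  sing (SingKind (@cont_simplex_push R m M)).
Definition SingInfty : reflexiveSet :=
  sing (SingKind (@smooth_simplex_push R m M)).

Definition SingInfty_incl n (s : SingInfty n) : Sing n :=
  exist _ (sval s) (proj1 (svalP s)).

Definition chart_at (x : M) : chart M := sval (cid (dom_cover x)).

(** The pullback of [w] along [s]; it does not depend on the chosen charts. *)
Definition form_pull n (s : simplex R n -> M) p (w : local_forms M p) : dR_form R n p :=
  fun x v => let c := chart_at (s x) in
    w c (chart_coord c (s x)) (fun i => tderive (v i) (chart_coord c \o s) x).

Definition alpha_map p (w : gcar (deRham M) p) : gcar (smap_dga (ADR R) SingInfty) p :=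
  fun n s => form_pull (sval s) w.

Definition beta_map : forall p, gcar (smap_dga (APL R) SingInfty) p ->
                            gcar (smap_dga (ADR R) SingInfty) p :=
  smap_post (@APL_to_ADR R).

Definition gamma_map : forall p, gcar (smap_dga (APL R) Sing) p ->
                             gcar (smap_dga (APL R) SingInfty) p :=
  smap_pre SingInfty_incl.

End ManifoldMaps.

(* Main.v *)
(** Everything in [A(K)] is pointwise, so the theorem reduces to statements about the
    levels of each simplicial dga: they are involutive dga's, the faces and
    degeneracies are dga maps exchanged by the involutions as in a reflexive set,
    and the maps between them commute with all this structure.

    For cochains the signs work because (p+q)(p+q+1)/2 = p(p+1)/2 + q(q+1)/2 + pq.
    For polynomial forms all operations are determined by words in the generators.
    For smooth forms, wedge products and exterior derivatives are antisymmetrizations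
    over permutations, which absorb inner antisymmetrizations over blocks; this gives
    associativity and the Leibniz rule, while the symmetry of second derivatives
    gives [d d = 0] and the compatibility of [d] with pullbacks. The derivatives on a
    simplex do not depend on the smooth extension, because the tangent space at a
    point is spanned by the directions of the vertices. *)

Require Import Defs.
From HB Require Import structures.
From mathcomp Require Import all_boot all_order all_algebra all_fingroup.
From mathcomp Require Import generic_quotient.
From mathcomp Require Import all_classical all_reals all_analysis.
From mathcomp Require Import zify ring.
Set Implicit Arguments.
Unset Strict Implicit.
Unset Printing Implicit Defensive.
Import Order.TTheory GRing.Theory Num.Theory numFieldNormedType.Exports.
Local Open Scope classical_set_scope.
Local Open Scope ring_scope.

(* [trigo] exports another [alternating]. *)
Local Notation alternating := Defs.alternating.

(** * Presented modules *)

(** The laws of a dga are asked of the members [gmem] only. Derivatives on a simplex are taken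
    through a chosen extension and behave well only on smooth functions, so smooth forms satisfy
    their laws only as members; cochains and polynomial forms have operations that are linear on the
    whole ambient modules, as tensoring them demands. A simplex is not open in a vector space,
    whereas the image of a chart is. The same identities between forms are needed on both, so they
    are derived from a list of rules for commuting derivations, [is_calculus], which both kinds of
    functions satisfy. One pullback formula then serves twice: along transition maps it makes the
    exterior derivative independent of the chart, and along a smooth simplex read in a chart it
    shows that pulling back commutes with [d]. The division by p! q! in the wedge product cancels
    the multiplicity with which an inner sum over the permutations of a block is absorbed, so that
    no constants remain in associativity and in the Leibniz rule. *)

Definition lin (k : pzRingType) (V W : lmodType k) (F : V -> W) :=
  forall a x y, F (a *: x + y) = a *: F x + F y.

Section Lin.
Variable k : pzRingType.
Implicit Types U V W : lmodType k.

Lemma lin0 V W (F : V -> W) : lin F -> F 0 = 0.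
Proof.
move=> lF; have := lF (-1) 0 0.
by rewrite scaler0 addr0 scaleN1r addNr.
Qed.

Lemma linD V W (F : V -> W) : lin F -> forall x y, F (x + y) = F x + F y.
Proof. by move=> lF x y; rewrite -[x]scale1r lF !scale1r. Qed.

Lemma linZ V W (F : V -> W) : lin F -> forall a x, F (a *: x) = a *: F x.
Proof. by move=> lF a x; rewrite -[a *: x]addr0 lF (lin0 lF) addr0. Qed.

Lemma linN V W (F : V -> W) : lin F -> forall x, F (- x) = - F x.
Proof. by move=> lF x; rewrite -scaleN1r linZ// scaleN1r. Qed.

Lemma lin_sum V W (F : V -> W) : lin F ->
  forall I (r : seq I) (P : pred I) (x : I -> V),
    F (\sum_(i <- r | P i) x i) = \sum_(i <- r | P i) F (x i).
Proof.
by move=> lF I r P x; apply: big_morph; [exact: linD|exact: lin0].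
Qed.

Lemma lin_idfun V : lin (fun x : V => x). Proof. by []. Qed.

Lemma lin_cst0 V W : lin (fun _ : V => 0 : W).
Proof. by move=> a x y; rewrite scaler0 addr0. Qed.

Lemma lin_comp U V W (F : V -> W) (G : U -> V) :
  lin F -> lin G -> lin (fun x => F (G x)).
Proof. by move=> lF lG a x y; rewrite lG lF. Qed.

Lemma lin_add V W (F G : V -> W) :
  lin F -> lin G -> lin (fun x => F x + G x).
Proof. by move=> lF lG a x y; rewrite lG lF scalerDr addrACA. Qed.

Lemma lin_bigsum V W I (r : seq I) (P : pred I) (F : I -> V -> W) :
  (forall i, P i -> lin (F i)) -> lin (fun x => \sum_(i <- r | P i) F i x).
Proof.
move=> lF a x y; rewrite scaler_sumr -big_split/=.
by apply: eq_bigr => i Pi; rewrite lF.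
Qed.

End Lin.

Lemma lin_scale (k : comPzRingType) (V W : lmodType k) c (F : V -> W) :
  lin F -> lin (fun x => c *: F x).
Proof. by move=> lF a x y; rewrite lF scalerDr !scalerA mulrC. Qed.

Section PresentedTheory.
Variables (k : fieldType) (G : Type) (rel : set (seq (k * G))).
Local Notation pres := (presented rel).
Implicit Types (V : lmodType k) (S : set G).

Definition respects V (f : G -> V) := forall r, rel r -> lin_eval f r = 0.

Lemma lin_ext_lin V (f : G -> V) : respects f -> lin (lin_ext f : pres -> V).
Proof.
move=> fr a x y.
rewrite -(lin_ext_scale fr a x).
exact: lin_ext_add.
Qed.

Lemma lin_ext_pgen V (f : G -> V) : respects f ->
  forall g, lin_ext f (pgen g : pres) = f g.
Proof. by move=> fr g; rewrite lin_ext_class// /lin_eval big_seq1 scale1r. Qed.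

Lemma pres_classE l : pres_class rel l = \sum_(cg <- l) cg.1 *: pgen cg.2.
Proof.
apply: presented_eq => V f fr; rewrite lin_ext_class//.
have lf := lin_ext_lin fr.
rewrite (lin_sum lf); apply: eq_bigr => -[c g] _ /=.
by rewrite (linZ lf) lin_ext_pgen.
Qed.

Lemma presE (x : pres) : exists l : seq (k * G),
  x = \sum_(cg <- l) cg.1 *: pgen cg.2.
Proof.
exists (repr x : seq (k * G)); rewrite -pres_classE.
by rewrite /pres_class reprK.
Qed.

(** Equality in the quotient is tested in the modules where the relations hold, so the relations
    hold for the generators themselves. The bilinearity of [tens] and the relations between
    polynomial forms come from here. *)
Lemma pgen_respects : respects (fun g => pgen g : pres).
Proof.
move=> r rr; rewrite /lin_eval -pres_classE.
apply: presented_eq => V f fr; rewrite lin_ext_class// fr//.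
by rewrite (lin0 (lin_ext_lin fr)).
Qed.

Lemma spanP S (x : pres) : span_of S x <->
  exists l : seq (k * {g : G | S g}), x = \sum_(cg <- l) cg.1 *: pgen (sval cg.2).
Proof.
by split=> -[l ->]; exists l; rewrite pres_classE big_map.
Qed.

Lemma span0 S : span_of S (0 : pres).
Proof. by apply/spanP; exists [::]; rewrite big_nil. Qed.

Lemma span_lin S a (x y : pres) :
  span_of S x -> span_of S y -> span_of S (a *: x + y).
Proof.
move=> /spanP[l ->] /spanP[m ->]; apply/spanP.
exists ([seq (a * cg.1, cg.2) | cg <- l] ++ m).
rewrite big_cat big_map scaler_sumr; congr (_ + _).
by apply: eq_bigr => i _; rewrite scalerA.
Qed.

Lemma span_pgen S g : S g -> span_of S (pgen g : pres).
Proof.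
move=> Sg; apply/spanP; exists [:: (1, exist _ g Sg)].
by rewrite big_seq1 scale1r.
Qed.

Lemma spanD S (x y : pres) : span_of S x -> span_of S y -> span_of S (x + y).
Proof. by move=> Sx Sy; rewrite -[x]scale1r; exact: span_lin. Qed.

Lemma spanZ S a (x : pres) : span_of S x -> span_of S (a *: x).
Proof. by move=> Sx; rewrite -[a *: x]addr0; apply: span_lin => //; exact: span0. Qed.

Lemma span_sum S I (r : seq I) (P : pred I) (x : I -> pres) :
  (forall i, P i -> span_of S (x i)) -> span_of S (\sum_(i <- r | P i) x i).
Proof.
by move=> Sx; elim/big_ind : _ => //; [exact: span0|move=> *; exact: spanD].
Qed.

(** The homogeneous companion of [pres_lin_eq]: an identity whose sign depends on the degree holds
    only on the part of that degree. *)
Lemma span_lin_eq S V (F F' : pres -> V) : lin F -> lin F' ->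
  (forall g, S g -> F (pgen g) = F' (pgen g)) ->
  forall x, span_of S x -> F x = F' x.
Proof.
move=> lF lF' FF' _ /spanP[l ->]; rewrite (lin_sum lF) (lin_sum lF').
by apply: eq_bigr => -[c [g Sg]] _ /=; rewrite (linZ lF) (linZ lF') FF'.
Qed.

Lemma pres_lin_eq V (F F' : pres -> V) : lin F -> lin F' ->
  (forall g, F (pgen g) = F' (pgen g)) -> F =1 F'.
Proof.
move=> lF lF' FF' x; have [l ->] := presE x; rewrite (lin_sum lF) (lin_sum lF').
by apply: eq_bigr => -[c g] _ /=; rewrite (linZ lF) (linZ lF') FF'.
Qed.

End PresentedTheory.

Lemma span_lin_map (k : fieldType) G G' (rel : set (seq (k * G)))
    (rel' : set (seq (k * G'))) (S : set G) (S' : set G')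
    (F : presented rel -> presented rel') : lin F ->
  (forall g, S g -> span_of S' (F (pgen g))) ->
  forall x, span_of S x -> span_of S' (F x).
Proof.
move=> lF FS _ /spanP[l ->]; rewrite (lin_sum lF).
by apply: span_sum => -[c [g Sg]] _; rewrite (linZ lF); apply/spanZ/FS.
Qed.

(** * Reflexive dga's and their simplicial maps *)

Definition is_reflexive_dga (k : fieldType) (A : reflexiveDgaData k) :=
  [/\ forall n, is_involutive_dga (A n),
      forall n (i : 'I_n.+2), is_dga_map (A := A n.+1) (B := A n) (dface i),
      forall n (i : 'I_n.+1), is_dga_map (A := A n) (B := A n.+1) (ddegen i),
      forall n (i : 'I_n.+2) p (x : gcar (A n.+1) p), gmem (A n.+1) x ->
        dface i (ginv x) = ginv (dface (rev_ord i) x) &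
      forall n (i : 'I_n.+1) p (x : gcar (A n) p), gmem (A n) x ->
        ddegen i (ginv x) = ginv (ddegen (rev_ord i) x)].

Section SimplicialMapDga.
Variables (k : fieldType).
Implicit Types (A B : reflexiveDgaData k) (K : reflexiveSet).

Lemma smap_eq A K p (Phi Psi : gcar (smap_dga A K) p) :
  (forall n s, Phi n s = Psi n s) -> Phi = Psi.
Proof.
move=> e; apply: functional_extensionality_dep => n.
by apply/funext => s; exact: e.
Qed.

Lemma smap_linE A K p a (Phi Psi : gcar (smap_dga A K) p) n s :
  (a *: Phi + Psi) n s = a *: Phi n s + Psi n s.
Proof. by []. Qed.

Lemma smap_is_dga A K : is_reflexive_dga A -> is_dga (smap_dga A K).
Proof.
move=> [Adga Aface Adegen _ _].
have Ad n : is_dga (A n) by case: (Adga n).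
split.
- split.
  + move=> p; split=> [n s|n i s|n i s].
    * by case: (Ad n) => -[].
    * rewrite /=; case: (Aface n i) => -[_ l] _ _ _.
      (* Faces are linear only on members; with coefficient -1 at 0 the rule reads f 0 = - f 0 + f
         0, so f 0 = 0. *)
      have /= := l p (-1) 0 0.
      case: (Ad n.+1) => -[+ _ _ _ _ _ _ _] => /(_ p) z /(_ z z).
      by rewrite scaler0 addr0 scaleN1r addNr => ->.
    * rewrite /=; case: (Adegen n i) => -[_ l] _ _ _.
      have /= := l p (-1) 0 0.
      case: (Ad n) => -[+ _ _ _ _ _ _ _] => /(_ p) z /(_ z z).
      by rewrite scaler0 addr0 scaleN1r addNr => ->.
  + move=> p a x y [xm xf xd] [ym yf yd]; split=> [n s|n i s|n i s].
    * by rewrite smap_linE; case: (Ad n) => -[_ + _ _ _ _ _ _]; apply.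
    * rewrite !smap_linE xf yf; case: (Aface n i) => -[_ l] _ _ _.
      by rewrite -l.
    * rewrite !smap_linE xd yd; case: (Adegen n i) => -[_ l] _ _ _.
      by rewrite -l.
  + split=> [n s|n i s|n i s].
    * by case: (Ad n) => -[].
    * by rewrite /=; case: (Aface n i).
    * by rewrite /=; case: (Adegen n i).
  + move=> p q r e x y [xm xf xd] [ym yf yd]; split=> [n s|n i s|n i s] /=.
    * by case: (Ad n) => -[_ _ _ + _ _ _ _]; apply.
    * by rewrite xf yf; case: (Aface n i) => _ _ -> .
    * by rewrite xd yd; case: (Adegen n i) => _ _ -> .
- split=> p q r e a x y z [xm _ _] [ym _ _] [zm _ _]; apply: smap_eq => n s /=.
  + by case: (Ad n) => _ [+ _] _ _ _; apply.
  + by case: (Ad n) => _ [_ +] _ _ _; apply.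
- split.
  + move=> p e x [xm _ _]; apply: smap_eq => n s /=.
    by case: (Ad n) => _ _ [+ _ _] _ _; apply.
  + move=> p e x [xm _ _]; apply: smap_eq => n s /=.
    by case: (Ad n) => _ _ [_ + _] _ _; apply.
  + move=> p q r pq qr t e1 e2 e3 e4 x y z [xm _ _] [ym _ _] [zm _ _].
    apply: smap_eq => n s /=.
    by case: (Ad n) => _ _ [_ _ +] _ _; apply.
- split; first split.
  + move=> p x [xm xf xd]; split=> [n s|n i s|n i s] /=.
    * by case: (Ad n) => _ _ _ [[+ _] _] _; apply.
    * by rewrite xf; case: (Aface n i) => _ _ _ ->.
    * by rewrite xd; case: (Adegen n i) => _ _ _ ->.
  + move=> p a x y [xm _ _] [ym _ _]; apply: smap_eq => n s /=.
    by case: (Ad n) => _ _ _ [[_ +] _] _; apply.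
  + move=> p x [xm _ _]; apply: smap_eq => n s /=.
    by case: (Ad n) => _ _ _ [_ +] _; apply.
- move=> p q r e e1 e2 x y [xm _ _] [ym _ _]; apply: smap_eq => n s /=.
  by case: (Ad n) => _ _ _ _ +; apply.
Qed.

Lemma smap_is_involution A K :
  is_reflexive_dga A -> is_involution (smap_dga A K).
Proof.
move=> [Adga Aface Adegen Rface Rdegen].
have Ai n : is_involution (A n) by case: (Adga n).
split.
- split=> [p x [xm xf xd]|p a x y [xm _ _] [ym _ _]].
  + split=> [n s|n i s|n i s] /=.
    * by case: (Ai n) => -[+ _] _ _ _ _; apply.
    (* The index of the face is reversed once by the flip of [K] and once by the involution of [A];
       the two reversals cancel. *)
    * by rewrite Rface// -xf face_flip rev_ordK.
    * by rewrite Rdegen// -xd degen_flip rev_ordK.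
  + apply: smap_eq => n s /=; rewrite smap_linE.
    by case: (Ai n) => -[_ +] _ _ _ _; apply.
- move=> p x [xm _ _]; apply: smap_eq => n s /=.
  by case: (Ai n) => _ + _ _ _; apply.
- move=> p x [xm _ _]; apply: smap_eq => n s /=; rewrite flipK.
  by case: (Ai n) => _ _ + _ _; apply.
- by apply: smap_eq => n s /=; case: (Ai n) => _ _ _ + _.
- move=> p q r e e' x y [xm _ _] [ym _ _]; apply: smap_eq => n s /=.
  by case: (Ai n) => _ _ _ _ +; apply.
Qed.

Lemma smap_involutive_dga A K :
  is_reflexive_dga A -> is_involutive_dga (smap_dga A K).
Proof.
by move=> Ar; split; [exact: smap_is_dga|exact: smap_is_involution].
Qed.

Definition is_reflexive_dga_map A B (f : forall n p, gcar (A n) p -> gcar (B n) p) :=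
  [/\ forall n, is_dga_map (f n),
      forall n p (x : gcar (A n) p), gmem (A n) x -> f n p (ginv x) = ginv (f n p x),
      forall n (i : 'I_n.+2) p (x : gcar (A n.+1) p), gmem (A n.+1) x ->
        f n p (dface i x) = dface i (f n.+1 p x) &
      forall n (i : 'I_n.+1) p (x : gcar (A n) p), gmem (A n) x ->
        f n.+1 p (ddegen i x) = ddegen i (f n p x)].

Lemma smap_post_involutive A B K (f : forall n p, gcar (A n) p -> gcar (B n) p) :
  is_reflexive_dga A -> is_reflexive_dga B -> is_reflexive_dga_map f ->
  is_involutive_dga_map (smap_post f (K := K)).
Proof.
move=> rA rB [fd fi ff fs].
split; [exact: smap_involutive_dga|exact: smap_involutive_dga|split|].
- split=> [p x [xm xf xd]|p a x y [xm _ _] [ym _ _]].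
  + split=> [n s|n i s|n i s]; rewrite /smap_post.
    * by case: (fd n) => -[+ _] _ _ _; apply.
    * by rewrite xf ff.
    * by rewrite xd fs.
  + apply: smap_eq => n s; rewrite /smap_post !smap_linE.
    by case: (fd n) => -[_ +] _ _ _; apply.
- by apply: smap_eq => n s; rewrite /smap_post; case: (fd n).
- move=> p q r e x y [xm _ _] [ym _ _]; apply: smap_eq => n s; rewrite /smap_post/=.
  by case: (fd n) => _ _ + _; apply.
- move=> p x [xm _ _]; apply: smap_eq => n s; rewrite /smap_post/=.
  by case: (fd n) => _ _ _; apply.
- by move=> p x [xm _ _]; apply: smap_eq => n s; rewrite /smap_post/= fi.
Qed.

End SimplicialMapDga.

(** * Tensor products *)

Lemma sign_odd_eq (k : pzRingType) a b : odd a = odd b -> (-1) ^+ a = (-1) ^+ b :> k.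
Proof. by move=> ab; rewrite -signr_odd ab signr_odd. Qed.

(** Decides an equality of parities of polynomials in the degrees by a truth table; with
    [sign_odd_eq] it settles the Koszul signs. *)
Ltac parity :=
  rewrite ?(oddD, oddM, oddS) /=;
  repeat match goal with |- context [odd ?x] => case: (odd x) end; by [].

Section DgaProjections.
Variables (k : fieldType) (A : invDgaData k).
Hypothesis dA : is_dga A.

Lemma dga_mem0 p : gmem A (0 : gcar A p).
Proof. by case: dA => -[+ _ _ _ _ _ _ _]; apply. Qed.
Lemma dga_mem_lin p a (x y : gcar A p) :
  gmem A x -> gmem A y -> gmem A (a *: x + y).
Proof. by case: dA => -[_ + _ _ _ _ _ _]; apply. Qed.
Lemma dga_mem1 : gmem A (gone A).
Proof. by case: dA => -[_ _ + _ _ _ _ _]. Qed.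
Lemma dga_memM p q r (e : (p + q = r)%N) (x : gcar A p) (y : gcar A q) :
  gmem A x -> gmem A y -> gmem A (gmul e x y).
Proof. by case: dA => -[_ _ _ + _ _ _ _]; apply. Qed.
Lemma dga_mul1 p (e : (0 + p = p)%N) (x : gcar A p) :
  gmem A x -> gmul e (gone A) x = x.
Proof. by case: dA => _ _ [+ _ _] _ _; apply. Qed.
Lemma dga_mulr1 p (e : (p + 0 = p)%N) (x : gcar A p) :
  gmem A x -> gmul e x (gone A) = x.
Proof. by case: dA => _ _ [_ + _] _ _; apply. Qed.
Lemma dga_mulA p q r pq qr s (e1 : (p + q = pq)%N) (e2 : (pq + r = s)%N)
    (e3 : (q + r = qr)%N) (e4 : (p + qr = s)%N)
    (x : gcar A p) (y : gcar A q) (z : gcar A r) :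
  gmem A x -> gmem A y -> gmem A z ->
  gmul e2 (gmul e1 x y) z = gmul e4 x (gmul e3 y z).
Proof. by case: dA => _ _ [_ _ +] _ _; apply. Qed.
Lemma dga_memd p (x : gcar A p) : gmem A x -> gmem A (gdif x).
Proof. by case: dA => _ _ _ [[+ _] _] _; apply. Qed.
Lemma dga_dd p (x : gcar A p) : gmem A x -> gdif (gdif x) = 0.
Proof. by case: dA => _ _ _ [_ +] _; apply. Qed.
Lemma dga_leibniz p q r (e : (p + q = r)%N) (e1 : (p.+1 + q = r.+1)%N)
    (e2 : (p + q.+1 = r.+1)%N) (x : gcar A p) (y : gcar A q) :
  gmem A x -> gmem A y ->
  gdif (gmul e x y) = gmul e1 (gdif x) y + (-1) ^+ p *: gmul e2 x (gdif y).
Proof. by case: dA => _ _ _ _; apply. Qed.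

(** The Leibniz rule for 1 = 1 * 1 gives d 1 = d 1 + d 1. *)
Lemma dga_dif1 : gdif (gone A) = 0.
Proof.
have m1 := dga_mem1; have md1 := dga_memd m1.
have := dga_leibniz (erefl : (0 + 0 = 0)%N) (erefl : (1 + 0 = 1)%N)
  (erefl : (0 + 1 = 1)%N) m1 m1.
rewrite !dga_mul1// dga_mulr1// scale1r => /eqP.
by rewrite -subr_eq subrr => /eqP.
Qed.

End DgaProjections.

(** [tensor_mod] is built from all the ambient modules, not only from the elements
    of the dga's, so maps on it need operations that are linear everywhere. *)
Definition ambient_linear (k : fieldType) (A : invDgaData k) :=
  [/\ forall p q r (e : (p + q = r)%N) (y : gcar A q),
        lin (fun x : gcar A p => gmul e x y),
      forall p q r (e : (p + q = r)%N) (x : gcar A p), lin (@gmul k A p q r e x),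
      forall p, lin (@gdif k A p) &
      forall p, lin (@ginv k A p)].

Section TensorDga.
Variables (k : fieldType) (B C : invDgaData k).
Local Notation T := (tensor_mod B C).

Definition bilin (V : lmodType k) (f : forall p q, gcar B p -> gcar C q -> V) :=
  (forall p q c, lin (fun b => f p q b c)) /\ (forall p q b, lin (f p q b)).

Lemma tens_bilin : bilin (fun p q (b : gcar B p) (c : gcar C q) => tens b c).
Proof.
split=> p q; [move=> c a b b'|move=> b a c c'].
- have /(_ [:: (1, TGen (a *: b + b') c); (- a, TGen b c); (- 1, TGen b' c)]) :=
    @pgen_respects k _ (@tensor_rel k B C).
  rewrite /lin_eval !big_cons big_nil addr0 scale1r !scaleNr scale1r/=.
  move=> H; apply/eqP; rewrite -subr_eq0 opprD; apply/eqP/H.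
  by exists p, q; left; exists a, b, b', c.
- have /(_ [:: (1, TGen b (a *: c + c')); (- a, TGen b c); (- 1, TGen b c')]) :=
    @pgen_respects k _ (@tensor_rel k B C).
  rewrite /lin_eval !big_cons big_nil addr0 scale1r !scaleNr scale1r/=.
  move=> H; apply/eqP; rewrite -subr_eq0 opprD; apply/eqP/H.
  by exists p, q; right; exists a, b, c, c'.
Qed.

Lemma tens_linl p q (c : gcar C q) : lin (fun b : gcar B p => tens b c).
Proof. by case: tens_bilin => + _; apply. Qed.
Lemma tens_linr p q (b : gcar B p) : lin (fun c : gcar C q => tens b c).
Proof. by case: tens_bilin => _; apply. Qed.

Section Ext.
Variables (V : lmodType k) (f : forall p q, gcar B p -> gcar C q -> V).
Hypothesis bf : bilin f.

Lemma tens_ext_respects : respects (@tensor_rel k B C)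
  (fun g : tgen B C => f (projT2 (projT2 g)).1 (projT2 (projT2 g)).2).
Proof.
case: bf => fl fr.
move=> _ [p [q [[a [b [b' [c ->]]]]|[a [b [c [c' ->]]]]]]];
  rewrite /lin_eval !big_cons big_nil addr0/= scale1r !scaleNr scale1r.
- by rewrite fl -opprD subrr.
- by rewrite fr -opprD subrr.
Qed.

Lemma tens_ext_lin : lin (tens_ext f).
Proof. exact/lin_ext_lin/tens_ext_respects. Qed.

Lemma tens_extE p q (b : gcar B p) (c : gcar C q) : tens_ext f (tens b c) = f b c.
Proof. exact: (lin_ext_pgen tens_ext_respects). Qed.

End Ext.

Lemma tens_lin_eq (V : lmodType k) (F F' : T -> V) : lin F -> lin F' ->
  (forall p q (b : gcar B p) (c : gcar C q), F (tens b c) = F' (tens b c)) ->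
  F =1 F'.
Proof.
by move=> lF lF' FF'; apply: pres_lin_eq => // -[p [q [b c]]]; exact: FF'.
Qed.

Lemma tens_mem_lin_eq r (V : lmodType k) (F F' : T -> V) : lin F -> lin F' ->
  (forall p q (b : gcar B p) (c : gcar C q), (p + q = r)%N ->
     gmem B b -> gmem C c -> F (tens b c) = F' (tens b c)) ->
  forall x, gmem (tensor_dga B C) (x : gcar (tensor_dga B C) r) -> F x = F' x.
Proof.
move=> lF lF' FF'; apply: span_lin_eq => // _ [p [q [b [c [e mb mc ->]]]]].
exact: FF'.
Qed.

Lemma tens_mem p q r (b : gcar B p) (c : gcar C q) : (p + q = r)%N ->
  gmem B b -> gmem C c ->
  gmem (tensor_dga B C) (tens b c : gcar (tensor_dga B C) r).
Proof. by move=> e mb mc; apply: span_pgen; exists p, q, b, c. Qed.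

Lemma tens_mem_map r r' (B' C' : invDgaData k) (F : T -> tensor_mod B' C') :
  lin F ->
  (forall p q (b : gcar B p) (c : gcar C q), (p + q = r)%N ->
     gmem B b -> gmem C c ->
     gmem (tensor_dga B' C') (F (tens b c) : gcar (tensor_dga B' C') r')) ->
  forall x, gmem (tensor_dga B C) (x : gcar (tensor_dga B C) r) ->
    gmem (tensor_dga B' C') (F x : gcar (tensor_dga B' C') r').
Proof.
move=> lF Fm; apply: span_lin_map => // _ [p [q [b [c [e mb mc ->]]]]].
exact: Fm.
Qed.

End TensorDga.

Section TensorMap.
Variables (k : fieldType) (B C B' C' : invDgaData k).
Variables (f : forall p, gcar B p -> gcar B' p) (g : forall p, gcar C p -> gcar C' p).
Hypotheses (lf : forall p, lin (f (p := p))) (lg : forall p, lin (g (p := p))).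

Definition tens_map : tensor_mod B C -> tensor_mod B' C' :=
  tens_ext (fun p q (b : gcar B p) (c : gcar C q) => tens (f b) (g c)).

Lemma tens_map_bilin :
  bilin (fun p q (b : gcar B p) (c : gcar C q) => tens (f b) (g c)).
Proof.
split=> p q; [move=> c|move=> b].
- exact: (lin_comp (@tens_linl k B' C' p q (g c))).
- exact: (lin_comp (@tens_linr k B' C' p q (f b))).
Qed.

Lemma tens_map_lin : lin tens_map.
Proof. exact/tens_ext_lin/tens_map_bilin. Qed.

Lemma tens_mapE p q (b : gcar B p) (c : gcar C q) :
  tens_map (tens b c) = tens (f b) (g c).
Proof. exact/tens_extE/tens_map_bilin. Qed.

End TensorMap.

(** * Product, differential and involution of a tensor product *)

Section TensorOps.
Variables (k : fieldType) (B C : invDgaData k).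
Hypotheses (aB : ambient_linear B) (aC : ambient_linear C).
Local Notation T := (tensor_mod B C).
Local Notation TT := (tensor_dga B C).

(** The operations of [tensor_dga] ignore their degree indices, so this one copy is convertible to
    the product in all degrees. *)
Definition tmul (x y : T) : T := @gmul k TT 0 0 0 erefl x y.
Definition tdif (x : T) : T := @gdif k TT 0 x.

Lemma tdif_bilin : bilin (fun p q (b : gcar B p) (c : gcar C q) =>
  tens (gdif b) c + (-1) ^+ p *: tens b (gdif c)).
Proof.
case: aB aC => _ _ dB _ [_ _ dC _].
split=> p q; [move=> c|move=> b]; apply: lin_add.
- exact: (lin_comp (@tens_linl k B C _ _ c)).
- by apply: lin_scale; exact: tens_linl.
- exact: tens_linr.
- by apply: lin_scale; exact: (lin_comp (@tens_linr k B C _ _ b)).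
Qed.

Lemma tdif_lin : lin tdif.
Proof. exact/tens_ext_lin/tdif_bilin. Qed.

Lemma tdifE p q (b : gcar B p) (c : gcar C q) :
  tdif (tens b c) = tens (gdif b) c + (-1) ^+ p *: tens b (gdif c).
Proof. exact: (tens_extE tdif_bilin). Qed.

Lemma tmul_inner_bilin p q (b : gcar B p) (c : gcar C q) :
  bilin (fun p' q' (b' : gcar B p') (c' : gcar C q') =>
    (-1) ^+ (q * p') *: tens (gmul erefl b b') (gmul erefl c c')).
Proof.
case: aB aC => _ mB _ _ [_ mC _ _].
split=> p' q'; [move=> c'|move=> b']; apply: lin_scale.
- exact: (lin_comp (@tens_linl k B C _ _ _) (mB _ _ _ _ _)).
- exact: (lin_comp (@tens_linr k B C _ _ _) (mC _ _ _ _ _)).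
Qed.

Lemma tmul_outer_bilin (y : T) :
  bilin (fun p q (b : gcar B p) (c : gcar C q) =>
    tens_ext (fun p' q' (b' : gcar B p') (c' : gcar C q') =>
      (-1) ^+ (q * p') *: tens (gmul erefl b b') (gmul erefl c c')) y).
Proof.
case: aB aC => mB _ _ _ [mC _ _ _].
split=> p q; [move=> c a b b'|move=> b a c c'].
- move: y; apply: tens_lin_eq.
  + exact/tens_ext_lin/tmul_inner_bilin.
  + by apply: lin_add; [apply: lin_scale|]; apply/tens_ext_lin/tmul_inner_bilin.
  + move=> p' q' b1 c1; rewrite !tens_extE; try exact: tmul_inner_bilin.
    by rewrite mB (tens_linl _ a) scalerDr !scalerA mulrC.
- move: y; apply: tens_lin_eq.
  + exact/tens_ext_lin/tmul_inner_bilin.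
  + by apply: lin_add; [apply: lin_scale|]; apply/tens_ext_lin/tmul_inner_bilin.
  + move=> p' q' b1 c1; rewrite !tens_extE; try exact: tmul_inner_bilin.
    by rewrite mC (tens_linr _ a) scalerDr !scalerA mulrC.
Qed.

Lemma tmul_linl y : lin (tmul ^~ y).
Proof. exact/tens_ext_lin/tmul_outer_bilin. Qed.

(** The degrees [s] and [t] are free up to an equation, so that two bracketings or two orders of a
    product can be brought to the same ambient modules of [B] and [C]. *)
Lemma tmulE p q p' q' s t (e : (p + p' = s)%N) (e' : (q + q' = t)%N)
    (b : gcar B p) (c : gcar C q) (b' : gcar B p') (c' : gcar C q') :
  tmul (tens b c) (tens b' c') =
  (-1) ^+ (q * p') *: tens (gmul e b b') (gmul e' c c').
Proof.
subst s t; rewrite /tmul /= tens_extE; last exact: tmul_outer_bilin.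
by rewrite tens_extE//; exact: tmul_inner_bilin.
Qed.

Lemma tmul_linr x : lin (tmul x).
Proof.
move=> a y z; move: x; apply: tens_lin_eq.
- exact: tmul_linl.
- by apply: lin_add; [apply: lin_scale|]; exact: tmul_linl.
- move=> p q b c; rewrite /tmul /= !tens_extE; try exact: tmul_outer_bilin.
  exact/tens_ext_lin/tmul_inner_bilin.
Qed.

Hypotheses (dB : is_dga B) (dC : is_dga C).

Lemma tmulA p q r (x y z : T) :
  gmem TT (x : gcar TT p) -> gmem TT (y : gcar TT q) -> gmem TT (z : gcar TT r) ->
  tmul (tmul x y) z = tmul x (tmul y z).
Proof.
move=> mx my mz.
move: x mx; apply: tens_mem_lin_eq;
  [by apply: lin_comp; exact: tmul_linl|exact: tmul_linl|move=> p1 q1 b1 c1 _ mb1 mc1].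
move: y my; apply: tens_mem_lin_eq;
  [by apply: lin_comp (@tmul_linl _) (@tmul_linr _)
  |by apply: lin_comp (@tmul_linr _) (@tmul_linl _)|move=> p2 q2 b2 c2 _ mb2 mc2].
move: z mz; apply: tens_mem_lin_eq;
  [exact: tmul_linr|by apply: lin_comp; exact: tmul_linr
  |move=> p3 q3 b3 c3 _ mb3 mc3].
rewrite !(tmulE erefl erefl) (linZ (@tmul_linl _)) (linZ (@tmul_linr _)).
rewrite (tmulE erefl erefl) (tmulE (addnA _ _ _) (addnA _ _ _)).
rewrite (dga_mulA dB _ _ erefl (addnA _ _ _))//.
rewrite (dga_mulA dC _ _ erefl (addnA _ _ _))// !scalerA -!exprD.
(* Either bracketing moves each factor from [C] past the later factors from [B], with total exponent
   q1 p2 + q1 p3 + q2 p3. *)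
congr (_ *: _); apply: sign_odd_eq; parity.
Qed.

Lemma tdif_leibniz p q (x y : T) :
  gmem TT (x : gcar TT p) -> gmem TT (y : gcar TT q) ->
  tdif (tmul x y) = tmul (tdif x) y + (-1) ^+ p *: tmul x (tdif y).
Proof.
move=> mx my.
move: x mx; apply: tens_mem_lin_eq.
- exact: lin_comp tdif_lin (@tmul_linl _).
- apply: lin_add; first exact: lin_comp (@tmul_linl _) tdif_lin.
  by apply: lin_scale; exact: tmul_linl.
move=> p1 q1 b1 c1 e1 mb1 mc1.
move: y my; apply: tens_mem_lin_eq.
- exact: lin_comp tdif_lin (@tmul_linr _).
- apply: lin_add; first exact: tmul_linr.
  by apply: lin_scale; exact: lin_comp (@tmul_linr _) tdif_lin.
move=> p2 q2 b2 c2 _ mb2 mc2.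
rewrite (tmulE erefl erefl) (linZ tdif_lin) !tdifE.
rewrite (linD (@tmul_linl _)) (linZ (@tmul_linl _)).
rewrite (linD (@tmul_linr _)) (linZ (@tmul_linr _)).
rewrite (tmulE (addSn _ _) erefl) (tmulE erefl (addSn _ _)).
rewrite (tmulE (addnS _ _) erefl) (tmulE erefl (addnS _ _)).
rewrite (dga_leibniz dB _ (addSn _ _) (addnS _ _))//.
rewrite (dga_leibniz dC _ (addSn _ _) (addnS _ _))//.
rewrite (linD (@tens_linl k B C _ _ _)) (linZ (@tens_linl k B C _ _ _)).
rewrite (linD (@tens_linr k B C _ _ _)) (linZ (@tens_linr k B C _ _ _)).
rewrite !scalerDr !scalerA -!exprD -!addrA; congr (_ + _).
(* On the left the differential hits [b1], [b2], [c1], [c2] in this order, on the right [b1], [c1],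
   [b2], [c2]; the middle terms are exchanged. *)
rewrite addrCA; congr (_ + _); last congr (_ + _); congr (_ *: _);
  apply: sign_odd_eq; rewrite -?e1; parity.
Qed.

Lemma tdif_dif p (x : T) : gmem TT (x : gcar TT p) -> tdif (tdif x) = 0.
Proof.
move: x; apply: tens_mem_lin_eq.
- exact: lin_comp tdif_lin tdif_lin.
- exact: lin_cst0.
move=> p1 q1 b1 c1 _ mb1 mc1.
rewrite tdifE (linD tdif_lin) (linZ tdif_lin) !tdifE (dga_dd dB)// (dga_dd dC)//.
rewrite (lin0 (@tens_linl k B C _ _ _)) (lin0 (@tens_linr k B C _ _ _)).
by rewrite add0r scaler0 addr0 exprS mulN1r scaleNr addNr.
Qed.

Lemma tmul_mem p q r (e : (p + q = r)%N) (x y : T) :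
  gmem TT (x : gcar TT p) -> gmem TT (y : gcar TT q) ->
  gmem TT (tmul x y : gcar TT r).
Proof.
move=> mx my; move: x mx; apply: tens_mem_map; first exact: tmul_linl.
move=> p1 q1 b1 c1 e1 mb1 mc1.
move: y my; apply: tens_mem_map; first exact: tmul_linr.
move=> p2 q2 b2 c2 e2 mb2 mc2.
rewrite (tmulE erefl erefl); apply: spanZ; apply: tens_mem.
- by rewrite addnACA e1 e2.
- exact: dga_memM.
- exact: dga_memM.
Qed.

Lemma tdif_mem p (x : T) : gmem TT (x : gcar TT p) -> gmem TT (tdif x : gcar TT p.+1).
Proof.
move: x; apply: tens_mem_map; first exact: tdif_lin.
move=> p1 q1 b1 c1 e1 mb1 mc1; rewrite tdifE; apply: spanD; last apply: spanZ.
- by apply: tens_mem => //; [rewrite -e1|exact: dga_memd].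
- by apply: tens_mem => //; [rewrite -e1 addnS|exact: dga_memd].
Qed.

Lemma tensor_is_dga : is_dga TT.
Proof.
split.
- split.
  + by move=> p; exact: span0.
  + by move=> p a x y; exact: span_lin.
  + by apply: tens_mem => //; exact: dga_mem1.
  + by move=> p q r e x y mx my; exact: tmul_mem mx my.
- by split=> p q r e a x y z _ _ _; [exact: tmul_linl|exact: tmul_linr].
- split.
  + move=> p e; apply: tens_mem_lin_eq => //; first exact: tmul_linr.
    move=> p1 q1 b1 c1 _ mb1 mc1; rewrite [LHS](tmulE (add0n _) (add0n _)).
    by rewrite scale1r !dga_mul1.
  + move=> p e; apply: tens_mem_lin_eq => //; first exact: tmul_linl.
    move=> p1 q1 b1 c1 _ mb1 mc1; rewrite [LHS](tmulE (addn0 _) (addn0 _)).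
    by rewrite muln0 scale1r !dga_mulr1.
  + by move=> p q r pq qr s e1 e2 e3 e4 x y z; exact: tmulA.
- split; last exact: tdif_dif.
  by split=> [|p a x y _ _]; [exact: tdif_mem|exact: tdif_lin].
- by move=> p q r e e1 e2 x y; exact: tdif_leibniz.
Qed.

Hypotheses (iB : is_involution B) (iC : is_involution C).

Definition tinv : T -> T := tens_map (@ginv k B) (@ginv k C).

Let linvB p : lin (@ginv k B p). Proof. by case: aB. Qed.
Let linvC p : lin (@ginv k C p). Proof. by case: aC. Qed.
Let tinv_lin : lin tinv := tens_map_lin linvB linvC.
Let tinvE p q (b : gcar B p) (c : gcar C q) :
  tinv (tens b c) = tens (ginv b) (ginv c).
Proof. exact: tens_mapE. Qed.

Lemma tensor_is_involution : is_involution TT.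
Proof.
case: iB iC => -[imB _] idB iiB i1B iMB [[imC _] idC iiC i1C iMC].
split.
- split=> [p|p a x y _ _]; last exact: tinv_lin.
  apply: tens_mem_map; first exact: tinv_lin.
  move=> p1 q1 b c e mb mc.
  rewrite [X in gmem _ X](tinvE b c); apply: tens_mem => //.
  + exact: imB.
  + exact: imC.
- move=> p; apply: tens_mem_lin_eq.
  + exact: lin_comp tinv_lin tdif_lin.
  + exact: lin_comp tdif_lin tinv_lin.
  move=> p1 q1 b c _ mb mc; change (tinv (tdif (tens b c)) = tdif (tinv (tens b c))).
  rewrite tinvE !tdifE (linD tinv_lin) (linZ tinv_lin) !tinvE.
  by rewrite idB// idC.
- move=> p; apply: tens_mem_lin_eq => //.
  + exact: lin_comp tinv_lin tinv_lin.
  move=> p1 q1 b c _ mb mc; change (tinv (tinv (tens b c)) = tens b c).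
  by rewrite !tinvE iiB// iiC.
- by rewrite [LHS]tinvE i1B i1C.
- move=> p q r e e' x y mx my.
  change (tinv (tmul x y) = (-1) ^+ (p * q) *: tmul (tinv y) (tinv x)).
  move: x mx; apply: tens_mem_lin_eq.
  + exact: lin_comp tinv_lin (@tmul_linl _).
  + by apply: lin_scale; exact: lin_comp (@tmul_linr _) tinv_lin.
  move=> p1 q1 b1 c1 e1 mb1 mc1.
  move: y my; apply: tens_mem_lin_eq.
  + exact: lin_comp tinv_lin (@tmul_linr _).
  + apply: lin_scale.
    exact: (lin_comp (F := tmul^~ (tinv (tens b1 c1))) (@tmul_linl _) tinv_lin).
  move=> p2 q2 b2 c2 e2 mb2 mc2.
  rewrite (tmulE erefl erefl) (linZ tinv_lin) !tinvE (tmulE (addnC _ _) (addnC _ _)).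
  rewrite (iMB _ _ _ _ (addnC _ _))// (iMC _ _ _ _ (addnC _ _))//.
  rewrite (linZ (@tens_linl k B C _ _ _)) (linZ (@tens_linr k B C _ _ _)).
  rewrite !scalerA -!exprD.
  (* Reversing the products in [B] and in [C] costs p1 p2 + q1 q2, and the Koszul rule costs q1 p2
     on the left and q2 p1 on the right; together these are the terms of (p1 + q1)(p2 + q2). *)
  congr (_ *: _); apply: sign_odd_eq; rewrite -e1 -e2; parity.
Qed.

End TensorOps.

(** * Tensor products of dga maps *)

Section TensorMapDga.
Variables (k : fieldType) (B C B' C' : invDgaData k).
Hypotheses (aB : ambient_linear B) (aC : ambient_linear C).
Hypotheses (aB' : ambient_linear B') (aC' : ambient_linear C').
Variables (f : forall p, gcar B p -> gcar B' p) (g : forall p, gcar C p -> gcar C' p).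
Hypotheses (lf : forall p, lin (f (p := p))) (lg : forall p, lin (g (p := p))).

Lemma tens_map_is_dga_map : is_dga_map f -> is_dga_map g ->
  is_dga_map (A := tensor_dga B C) (B := tensor_dga B' C') (fun _ => tens_map f g).
Proof.
move=> [[fm _] f1 fM fd] [[gm _] g1 gM gd].
have l : lin (tens_map f g) := tens_map_lin lf lg.
have E := tens_mapE lf lg.
split.
- split=> [p|p a x y _ _]; last exact: l.
  apply: tens_mem_map => // p1 q1 b c e mb mc; rewrite E.
  by apply: tens_mem => //; [exact: fm|exact: gm].
- by rewrite [LHS]E f1 g1.
- move=> p q r e x y mx my.
  change (tens_map f g (tmul x y) = tmul (tens_map f g x) (tens_map f g y)).
  move: x mx; apply: tens_mem_lin_eq.
  + exact: (lin_comp (F := tens_map f g) l (tmul_linl aB aC y)).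
  + exact: (lin_comp (tmul_linl aB' aC' (tens_map f g y)) l).
  move=> p1 q1 b1 c1 _ mb1 mc1.
  move: y my; apply: tens_mem_lin_eq.
  + exact: (lin_comp l (tmul_linr aB aC (tens b1 c1))).
  + exact: (lin_comp (tmul_linr aB' aC' (tens_map f g (tens b1 c1))) l).
  move=> p2 q2 b2 c2 _ mb2 mc2.
  rewrite !E !(tmulE _ _ erefl erefl)// (linZ l) E fM// gM//.
- move=> p; apply: tens_mem_lin_eq.
  + exact: (lin_comp l (tdif_lin aB aC)).
  + exact: (lin_comp (tdif_lin aB' aC') l).
  move=> p1 q1 b c _ mb mc.
  change (tens_map f g (tdif (tens b c)) = tdif (tens_map f g (tens b c))).
  by rewrite E !tdifE// (linD l) (linZ l) !E fd// gd.
Qed.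

End TensorMapDga.

Definition ambient_linear_reflexive (k : fieldType) (A : reflexiveDgaData k) :=
  [/\ forall n, ambient_linear (A n),
      forall n (i : 'I_n.+2) p, lin (@dface k A n i p) &
      forall n (i : 'I_n.+1) p, lin (@ddegen k A n i p)].

(** * Tensor products of reflexive dga's and the inclusions of their factors *)

Section TensorReflexive.
Variables (k : fieldType) (B C : reflexiveDgaData k).
Hypotheses (aB : ambient_linear_reflexive B) (aC : ambient_linear_reflexive C).
Hypotheses (rB : is_reflexive_dga B) (rC : is_reflexive_dga C).

Lemma tensor_reflexive : is_reflexive_dga (tensor B C).
Proof.
case: aB aC rB rC => alB fB sB [alC fC sC].
case=> dB dfB dsB ffB fsB [dC dfC dsC ffC fsC].
have lB n p : lin (@ginv k (B n) p) by case: (alB n).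
have lC n p : lin (@ginv k (C n) p) by case: (alC n).
split.
- move=> n; case: (dB n) (dC n) => dBn iBn [dCn iCn]; split.
  + exact: tensor_is_dga.
  + exact: tensor_is_involution.
- by move=> n i; apply: tens_map_is_dga_map.
- by move=> n i; apply: tens_map_is_dga_map.
- move=> n i p x; move: x; apply: (@tens_mem_lin_eq k (B n.+1) (C n.+1) p).
  + exact: lin_comp (tens_map_lin (fB _ _) (fC _ _)) (tens_map_lin (lB _) (lC _)).
  + exact: lin_comp (tens_map_lin (lB _) (lC _)) (tens_map_lin (fB _ _) (fC _ _)).
  move=> p1 q1 b c _ mb mc.
  change (tens_map (@dface k B n i) (@dface k C n i)
      (tens_map (@ginv k (B n.+1)) (@ginv k (C n.+1)) (tens b c)) =
    tens_map (@ginv k (B n)) (@ginv k (C n))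
      (tens_map (@dface k B n (rev_ord i)) (@dface k C n (rev_ord i)) (tens b c))).
  by rewrite !tens_mapE// ffB// ffC.
- move=> n i p x; move: x; apply: (@tens_mem_lin_eq k (B n) (C n) p).
  + exact: lin_comp (tens_map_lin (sB _ _) (sC _ _)) (tens_map_lin (lB _) (lC _)).
  + exact: lin_comp (tens_map_lin (lB _) (lC _)) (tens_map_lin (sB _ _) (sC _ _)).
  move=> p1 q1 b c _ mb mc.
  change (tens_map (@ddegen k B n i) (@ddegen k C n i)
      (tens_map (@ginv k (B n)) (@ginv k (C n)) (tens b c)) =
    tens_map (@ginv k (B n.+1)) (@ginv k (C n.+1))
      (tens_map (@ddegen k B n (rev_ord i)) (@ddegen k C n (rev_ord i)) (tens b c))).
  by rewrite !tens_mapE// fsB// fsC.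
Qed.

Lemma dga_map1 (A A' : invDgaData k) (f : forall p, gcar A p -> gcar A' p) :
  is_dga_map f -> f 0 (gone A) = gone A'.
Proof. by case. Qed.

Lemma tensor_inl_reflexive : is_reflexive_dga_map (@tensor_inl k B C).
Proof.
case: aB aC rB rC => alB fB sB [alC fC sC].
case=> dB dfB dsB ffB fsB [dC dfC dsC ffC fsC].
split.
- move=> n; have [[dBn iBn] [dCn iCn]] := (dB n, dC n); split.
  + split=> [p b mb|p a b b' _ _]; last exact: tens_linl.
    by apply: tens_mem => //; [rewrite addn0|exact: dga_mem1].
  + by [].
  + move=> p q r e b b' mb mb'; apply/esym.
    rewrite [LHS](tmulE (alB n) (alC n) e (erefl : (0 + 0 = 0)%N)) scale1r.
    by rewrite dga_mul1//; exact: dga_mem1.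
  + move=> p b mb; apply/esym; rewrite [LHS](tdifE (alB n) (alC n)).
    rewrite (dga_dif1 dCn) (lin0 (@tens_linr k (B n) (C n) _ _ _)).
    by rewrite scaler0 addr0.
- move=> n p b mb; have [[dBn iBn] [dCn iCn]] := (dB n, dC n).
  rewrite [RHS]tens_mapE; [|by case: (alB n)|by case: (alC n)].
  by case: iCn => _ _ _ ->.
- move=> n i p b mb; rewrite [RHS]tens_mapE; [|exact: fB|exact: fC].
  by rewrite (dga_map1 (dfC n i)).
- move=> n i p b mb; rewrite [RHS]tens_mapE; [|exact: sB|exact: sC].
  by rewrite (dga_map1 (dsC n i)).
Qed.

Lemma tensor_inr_reflexive : is_reflexive_dga_map (@tensor_inr k B C).
Proof.
case: aB aC rB rC => alB fB sB [alC fC sC].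
case=> dB dfB dsB ffB fsB [dC dfC dsC ffC fsC].
split.
- move=> n; have [[dBn iBn] [dCn iCn]] := (dB n, dC n); split.
  + split=> [p c mc|p a c c' _ _]; last exact: tens_linr.
    by apply: tens_mem => //; exact: dga_mem1.
  + by [].
  + move=> p q r e c c' mc mc'; apply/esym.
    rewrite [LHS](tmulE (alB n) (alC n) (erefl : (0 + 0 = 0)%N) e) muln0 scale1r.
    by rewrite dga_mul1//; exact: dga_mem1.
  + move=> p c mc; apply/esym; rewrite [LHS](tdifE (alB n) (alC n)).
    rewrite (dga_dif1 dBn) (lin0 (@tens_linl k (B n) (C n) _ _ _)).
    by rewrite scale1r add0r.
- move=> n p c mc; have [[dBn iBn] [dCn iCn]] := (dB n, dC n).
  rewrite [RHS]tens_mapE; [|by case: (alB n)|by case: (alC n)].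
  by case: iBn => _ _ _ ->.
- move=> n i p c mc; rewrite [RHS]tens_mapE; [|exact: fB|exact: fC].
  by rewrite (dga_map1 (dfB n i)).
- move=> n i p c mc; rewrite [RHS]tens_mapE; [|exact: sB|exact: sC].
  by rewrite (dga_map1 (dsB n i)).
Qed.

End TensorReflexive.

(** * Simplicial cochains *)

Ltac inord_lia :=
  rewrite /= /codegen /=;
  repeat match goal with |- context [nat_of_ord (@inord ?n ?m)] =>
    rewrite (@inordK n m); [|by rewrite /unbump /bump; lia] end;
  rewrite /unbump /bump; lia.

Lemma mono_eq p n (f g : mono p n) : (forall i, f i = g i) -> f = g.
Proof.
case: f g => f fP [g gP] /= /funext fg; subst g; congr Mono; exact: Prop_irrelevance.
Qed.

Lemma mono_nat_eq p n (f g : mono p n) : (forall i, f i = g i :> nat) -> f = g.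
Proof. by move=> fg; apply: mono_eq => i; apply/val_inj/fg. Qed.

Lemma mcompA p q r n (h : mono r n) (g : mono q r) (f : mono p q) :
  mcomp (mcomp h g) f = mcomp h (mcomp g f).
Proof. exact: mono_eq. Qed.

Lemma mrev_comp p q n (g : mono q n) (f : mono p q) :
  mrev (mcomp g f) = mcomp (mrev g) (mrev f).
Proof. by apply: mono_eq => i /=; rewrite rev_ordK. Qed.

Lemma mrevK p n (f : mono p n) : mrev (mrev f) = f.
Proof. by apply: mono_eq => i /=; rewrite !rev_ordK. Qed.

Lemma mrev_coface n (i : 'I_n.+2) : mrev (mcoface i) = mcoface (rev_ord i).
Proof. by apply: mono_eq => j /=; rewrite [LHS]rev_coface/= rev_ordK. Qed.

Lemma mrev_codegen n (i : 'I_n.+1) : mrev (mcodegen i) = mcodegen (rev_ord i).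
Proof. by apply: mono_eq => j /=; rewrite [LHS]rev_codegen/= rev_ordK. Qed.

Lemma mrev_front p q r (e : (p + q = r)%N) (e' : (q + p = r)%N) :
  mrev (mfront e) = mback e'.
Proof.
apply: mono_nat_eq => i /=; move: (ltn_ord i) => hi.
inord_lia.
Qed.

Lemma mrev_back p q r (e : (p + q = r)%N) (e' : (q + p = r)%N) :
  mrev (mback e) = mfront e'.
Proof. by rewrite -(mrev_front e' e) mrevK. Qed.

Lemma mcodegen_coface_eq n (i : 'I_n.+2) (j : 'I_n.+1) p (s : mono n p) :
  (i == j :> nat) || (i == j.+1 :> nat) -> mcomp s (mcomp (mcodegen j) (mcoface i)) = s.
Proof.
by move=> ij; apply: mono_eq => l /=; congr (s _); exact: codegen_coface_eq.
Qed.

(** The bijection (i, j) -> (j, i - 1) from the pairs with j < i to those with i <= j matches equal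
    values of [F] with opposite signs. *)
Lemma simplicial_double_sum (k : pzRingType) n (F : nat -> nat -> k) :
  (forall i j, (j < i < n.+2)%N -> F i j = F j i.-1) ->
  \sum_(i < n.+2) \sum_(j < n.+1) (-1) ^+ i * ((-1) ^+ j * F i j) = 0.
Proof.
move=> FE; rewrite pair_big/= (bigID (fun ij : 'I_n.+2 * 'I_n.+1 => (ij.2 < ij.1)%N))/=.
rewrite [X in _ + X](reindex_onto
  (fun ij : 'I_n.+2 * 'I_n.+1 => (inord ij.2, inord ij.1.-1))
  (fun ij : 'I_n.+2 * 'I_n.+1 => (inord ij.2.+1, inord ij.1)))/=; last first.
  move=> [[i hi] [j hj]] /=; rewrite -leqNgt => ij.
  by congr pair; apply/val_inj; rewrite /= !inordK//; lia.
rewrite [X in _ + X](eq_bigl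
  (fun ij : 'I_n.+2 * 'I_n.+1 => (ij.2 < ij.1)%N)); last first.
  move=> [[i hi] [j hj]] /=; apply/andP/idP.
  - move=> [+ /eqP[/(congr1 val) + /(congr1 val)]] /=.
    rewrite !inordK/= ?inordK; lia.
  - move=> ij; rewrite !inordK/= ?inordK; try lia; split; first lia.
    by apply/eqP; congr pair; apply/val_inj; rewrite /= !inordK//; lia.
rewrite -big_split big1//= => -[[i hi] [j hj]] /= ij.
rewrite !inordK/=; try lia.
rewrite (FE i j) ?ij// !mulrA -!exprD.
have -> : (-1) ^+ (i + j) = - (-1) ^+ (j + i.-1) :> k.
  by rewrite -[RHS]mulN1r -exprS; apply: sign_odd_eq; rewrite -addnS prednK 1?addnC//; lia.
by rewrite mulNr addNr.
Qed.

Section CPLTheory.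
Variables (k : fieldType).

Lemma cochain_eq n p (c c' : cochain k n p) : (forall s, c s = c' s) -> c = c'.
Proof. by move=> /funext. Qed.

Lemma cochain_linE n p a (c c' : cochain k n p) s : (a *: c + c') s = a * c s + c' s.
Proof. by []. Qed.

Definition cmul n p q r (e : (p + q = r)%N) (c : cochain k n p) (c' : cochain k n q) :
  cochain k n r := @gmul k (CPL_lev k n) p q r e c c'.
Definition cdif n p (c : cochain k n p) : cochain k n p.+1 :=
  @gdif k (CPL_lev k n) p c.
Definition crev n p (c : cochain k n p) : cochain k n p :=
  @ginv k (CPL_lev k n) p c.

Lemma cmulE n p q r (e : (p + q = r)%N) (c : cochain k n p) (c' : cochain k n q) s :
  cmul e c c' s = (-1) ^+ (p * q) * (c (mcomp s (mfront e)) * c' (mcomp s (mback e))).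
Proof. by []. Qed.
Lemma cdifE n p (c : cochain k n p) s :
  cdif c s = (-1) ^+ p.+1 * \sum_(i < p.+2) (-1) ^+ i * c (mcomp s (mcoface i)).
Proof. by []. Qed.
Lemma crevE n p (c : cochain k n p) s :
  crev c s = (-1) ^+ ((p * p.+1)./2) * c (mrev s).
Proof. by []. Qed.

Lemma CPL_ambient_linear n : ambient_linear (CPL_lev k n).
Proof.
split.
- move=> p q r e c a c1 c2; apply: cochain_eq => s.
  rewrite /= !cochain_linE; ring.
- move=> p q r e c a c1 c2; apply: cochain_eq => s.
  rewrite /= !cochain_linE; ring.
- move=> p a c c'; apply: cochain_eq => s.
  change (cdif (a *: c + c') s = a * cdif c s + cdif c' s).
  rewrite !cdifE !mulr_sumr -big_split/=; apply: eq_bigr => i _.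
  rewrite cochain_linE; ring.
- move=> p a c c'; apply: cochain_eq => s.
  rewrite /= !cochain_linE; ring.
Qed.

Lemma normalized_lin n p a (c c' : cochain k n p) :
  normalized c -> normalized c' -> normalized (a *: c + c').
Proof.
case: p c c' => [//|p] c c' nc nc' i s.
by rewrite cochain_linE (nc i s) (nc' i s) mulr0 addr0.
Qed.

(** If vertices i and i + 1 of a simplex coincide, then its front p-face is degenerate when i < p,
    and its back q-face otherwise. *)
Lemma normalized_mul n p q r (e : (p + q = r)%N) (c : cochain k n p)
  (c' : cochain k n q) : normalized c -> normalized c' -> normalized (cmul e c c').
Proof.
case: r e => [//|r] e nc nc' i s; rewrite cmulE.
have [ip|pi] := ltnP i p.
- case: p e c nc ip => [//|p] e c nc ip.
  have er : (p + q = r)%N by lia.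
  rewrite (_ : mcomp _ (mfront e) = mcomp (mcomp s (mfront er)) (mcodegen (inord i))).
    by rewrite nc mul0r mulr0.
  rewrite !mcompA; congr mcomp; apply: mono_nat_eq => -[j hj].
  inord_lia.
- case: q e c' nc' => [|q] e c' nc'; first by move: (ltn_ord i); lia.
  have er : (p + q = r)%N by lia.
  have hi := ltn_ord i.
  rewrite (_ : mcomp _ (mback e) = mcomp (mcomp s (mback er)) (mcodegen (inord (i - p)))).
    by rewrite nc' mulr0 mulr0.
  rewrite !mcompA; congr mcomp; apply: mono_nat_eq => -[j hj].
  inord_lia.
Qed.

(** Of the faces of a degenerate simplex, two are equal and carry opposite signs, and all others are
    degenerate again. *)
Lemma normalized_dif n p (c : cochain k n p) : normalized c -> normalized (cdif c).
Proof.
move=> nc i s; rewrite cdifE.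
(* [lift ord_max i] is the index i and [lift ord0 i] is i + 1: the two faces that undo the
   degeneracy. *)
rewrite (bigD1 (lift ord_max i))//= (bigD1 (lift ord0 i))/=; last first.
  by apply/eqP => /(congr1 val); rewrite /= /bump; move: (ltn_ord i); lia.
rewrite big1 ?addr0 => [|j /andP[/eqP j1 /eqP j2]].
  rewrite !mcompA !mcodegen_coface_eq/= /bump/= ?eqxx ?orbT//; last first.
    by move: (ltn_ord i); lia.
  by rewrite leqNgt (ltn_ord i)/= add0n add1n [in X in _ + X]exprS mulN1r mulNr subrr mulr0.
case: p c nc i s j j1 j2 => [|p] c nc i s j j1 j2.
  by case: i j j1 j2 => -[|//] hi [[|[|//]]] hj; [case|move=> _ []]; apply/val_inj.
rewrite mcompA; have [ji|ij] := ltnP j i.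
  rewrite (_ : mcomp _ _ = mcomp (mcoface (inord j)) (mcodegen (inord i.-1))).
    by rewrite -mcompA nc mulr0.
  by apply: mono_eq => l; exact: codegen_coface_lt.
have {}ij : (i.+1 < j)%N.
  rewrite ltn_neqAle; apply/andP; split.
    by apply/eqP => ij'; apply: j2; apply/val_inj; rewrite /= -ij' /bump.
  rewrite ltn_neqAle ij andbT; apply/eqP => ij'; apply: j1; apply/val_inj.
  by rewrite /= /bump leqNgt ltn_ord.
rewrite (_ : mcomp _ _ = mcomp (mcoface (inord j.-1)) (mcodegen (inord i))).
  by rewrite -mcompA nc mulr0.
by apply: mono_eq => l; exact: codegen_coface_gt.
Qed.

Lemma cdif_cdif n p (c : cochain k n p) : cdif (cdif c) = 0.
Proof.
apply: cochain_eq => s; rewrite cdifE.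
under eq_bigr do rewrite cdifE mulrCA mulr_sumr.
rewrite -mulr_sumr.
have := @simplicial_double_sum k p.+1 (fun i j =>
  c (mcomp (mcomp s (mcoface (inord i))) (mcoface (inord j)))).
under eq_bigr do under eq_bigr do rewrite !inord_val.
move=> ->; first by rewrite !mulr0.
move=> i j ij; congr c; rewrite !mcompA; congr mcomp; apply: mono_nat_eq => -[l hl].
inord_lia.
Qed.

(** Here f i and g j stand for the values of two cochains on the faces of the front (p+1)-part and
    of the back (q+1)-part of a simplex; omitting vertex i yields the face min(i, p+1) of the first
    and i - p of the second. On the right, the last term of the first sum cancels the first term of
    the second. *)
Lemma cmul_sum_split (f g : nat -> k) p q :
  \sum_(i < (p + q).+2) (-1) ^+ i * (f (minn i p.+1) * g (i - p)%N) =
  (\sum_(i < p.+2) (-1) ^+ i * f i) * g 0 +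
  (-1) ^+ p * (f p.+1 * \sum_(j < q.+2) (-1) ^+ j * g j).
Proof.
rewrite -(big_mkord xpredT (fun i => (-1) ^+ i * (f (minn i p.+1) * g (i - p)%N))).
rewrite (@big_cat_nat _ _ _ p.+1)//=; last by lia.
rewrite big_mkord [in RHS]big_ord_recr/= mulrDl -addrA; congr (_ + _).
  rewrite mulr_suml; apply: eq_bigr => i _; move: (ltn_ord i) => hi.
  have -> : minn i p.+1 = i by apply/minn_idPl; exact: ltnW.
  by have /eqP -> : (i - p == 0)%N; rewrite ?mulrA// subn_eq0 -ltnS.
rewrite [in RHS]big_ord_recl/= mulrDr mulrDr -mulrA expr0 mul1r addrA exprS -mulrA.
rewrite mulN1r addNr add0r -{1}[p.+1]add0n big_addn big_mkord.
rewrite (_ : ((p + q).+2 - p.+1 = q.+1)%N); last by lia.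
rewrite !mulr_sumr; apply: eq_bigr => i _.
rewrite (_ : minn (i + p.+1) p.+1 = p.+1); last by lia.
rewrite (_ : (i + p.+1 - p)%N = (bump 0 i)); last by rewrite /bump; lia.
rewrite /bump add1n (_ : (i + p.+1)%N = (p + i.+1)%N); last by lia.
by rewrite exprD; ring.
Qed.

Lemma cdif_leibniz n p q r (e : (p + q = r)%N) (e1 : (p.+1 + q = r.+1)%N)
    (e2 : (p + q.+1 = r.+1)%N) (c : cochain k n p) (c' : cochain k n q) :
  cdif (cmul e c c') = cmul e1 (cdif c) c' + (-1) ^+ p *: cmul e2 c (cdif c').
Proof.
apply: cochain_eq => s.
change (cdif (cmul e c c') s =
  cmul e1 (cdif c) c' s + (-1) ^+ p * cmul e2 c (cdif c') s).
rewrite !cmulE !cdifE.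
pose f i := c (mcomp (mcomp s (mfront e1)) (mcoface (inord i))).
pose g i := c' (mcomp (mcomp s (mback e2)) (mcoface (inord i))).
have fE (i : 'I_p.+2) : c (mcomp (mcomp s (mfront e1)) (mcoface i)) = f i.
  by rewrite /f inord_val.
have gE (i : 'I_q.+2) : c' (mcomp (mcomp s (mback e2)) (mcoface i)) = g i.
  by rewrite /g inord_val.
under [in RHS]eq_bigr do rewrite fE.
under [X in _ = _ + _ * (_ * (_ * (_ * X)))]eq_bigr do rewrite gE.
have -> : c (mcomp s (mfront e2)) = f p.+1.
  rewrite /f mcompA; congr (c (mcomp s _)); apply: mono_nat_eq => -[l hl]; inord_lia.
have -> : c' (mcomp s (mback e1)) = g 0.
  rewrite /g mcompA; congr (c' (mcomp s _)); apply: mono_nat_eq => -[l hl]; inord_lia.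
have -> : \sum_(i < r.+2) (-1) ^+ i * cmul e c c' (mcomp s (mcoface i)) =
  (-1) ^+ (p * q) * \sum_(i < r.+2) (-1) ^+ i * (f (minn i p.+1) * g (i - p)%N).
  rewrite mulr_sumr; apply: eq_bigr => i _; rewrite cmulE mulrCA; do 3!congr (_ * _).
    rewrite /f !mcompA; congr (c (mcomp s _)); apply: mono_nat_eq => -[l hl].
    by move: (ltn_ord i) => hi; inord_lia.
  rewrite /g !mcompA; congr (c' (mcomp s _)); apply: mono_nat_eq => -[l hl].
  by move: (ltn_ord i) => hi; inord_lia.
rewrite -[in \sum_(i < r.+2) _]e cmul_sum_split.
set F := \sum_(i < _) _; set H := \sum_(i < _) _.
rewrite !mulrDr; congr (_ + _).
  rewrite !mulrA -!exprD; congr (_ * _ * _); apply: sign_odd_eq; rewrite -e; parity.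
rewrite (mulrCA (f p.+1)) !mulrA -!exprD; congr (_ * _ * _).
by apply: sign_odd_eq; rewrite -e; parity.
Qed.

Lemma cmulA n p q r pq qr t (e1 : (p + q = pq)%N) (e2 : (pq + r = t)%N)
    (e3 : (q + r = qr)%N) (e4 : (p + qr = t)%N)
    (x : cochain k n p) (y : cochain k n q) (z : cochain k n r) :
  cmul e2 (cmul e1 x y) z = cmul e4 x (cmul e3 y z).
Proof.
apply: cochain_eq => s; rewrite !cmulE !mcompA.
have -> : mcomp (mfront e2) (mfront e1) = mfront e4.
  by apply: mono_nat_eq => -[l hl]; inord_lia.
have -> : mcomp (mback e4) (mback e3) = mback e2.
  by apply: mono_nat_eq => -[l hl]; inord_lia.
have -> : mcomp (mfront e2) (mback e1) = mcomp (mback e4) (mfront e3).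
  by apply: mono_nat_eq => -[l hl]; inord_lia.
set a := x _; set b := y _; set d := z _.
have -> : (-1) ^+ (pq * r) = (-1) ^+ (p * q) * (-1) ^+ (p * qr) * (-1) ^+ (q * r) :> k.
  by rewrite -!exprD; apply: sign_odd_eq; rewrite -e1 -e3; parity.
have : (-1) ^+ (p * q) * (-1) ^+ (p * q) = 1 :> k by rewrite -expr2 sqrr_sign.
move: ((-1) ^+ (p * q)) ((-1) ^+ (p * qr)) ((-1) ^+ (q * r)) => u v w uu.
by transitivity (u * u * (v * (a * (w * (b * d))))); [ring|rewrite uu mul1r].
Qed.

Lemma CPL_is_dga n : is_dga (CPL_lev k n).
Proof.
split.
- split.
  + by case.
  + by move=> p a x y; exact: normalized_lin.
  + by [].
  + by move=> p q r e x y; exact: normalized_mul.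
- case: (CPL_ambient_linear n) => l1 l2 _ _.
  by split=> p q r e a x y z _ _ _; [exact: l1|exact: l2].
- split.
  + move=> p e x _; apply: cochain_eq => s.
    rewrite /= mul0n expr0 !mul1r; congr x.
    by apply: mono_eq => -[i hi]; congr (s _); apply: val_inj; inord_lia.
  + move=> p e x _; apply: cochain_eq => s.
    rewrite /= muln0 expr0 mulr1 !mul1r; congr x.
    by apply: mono_eq => -[i hi]; congr (s _); apply: val_inj; inord_lia.
  + by move=> p q r pq qr s e1 e2 e3 e4 x y z _ _ _; exact: cmulA.
- case: (CPL_ambient_linear n) => _ _ l _; split; last by move=> p x _; exact: cdif_cdif.
  by split=> [p x|p a x y _ _]; [exact: normalized_dif|exact: l].
- by move=> p q r e e1 e2 x y _ _; exact: cdif_leibniz.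
Qed.

Lemma odd_triangle p q :
  odd (((p + q) * (p + q).+1)./2) =
  odd ((p * p.+1)./2) (+) odd ((q * q.+1)./2) (+) (odd p && odd q).
Proof.
rewrite -oddM -!oddD; congr odd.
have E m : ((m * m.+1)./2).*2 = (m * m.+1)%N.
  by rewrite halfK oddM/= andbN subn0.
apply/double_inj; rewrite !doubleD !E -mul2n; lia.
Qed.

Lemma crev_crev n p (c : cochain k n p) : crev (crev c) = c.
Proof.
apply: cochain_eq => s; rewrite !crevE mrevK mulrA -expr2.
by rewrite sqrr_sign mul1r.
Qed.

Lemma normalized_rev n p (c : cochain k n p) : normalized c -> normalized (crev c).
Proof.
case: p c => [//|p] c nc i s.
by rewrite crevE mrev_comp mrev_codegen nc mulr0.
Qed.

(** Reversal turns face i into face p + 1 - i. The resulting sign (-1)^(p+1) is accounted for by the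
    difference p + 1 of consecutive triangular numbers. *)
Lemma crev_dif n p (c : cochain k n p) : crev (cdif c) = cdif (crev c).
Proof.
apply: cochain_eq => s; rewrite crevE !cdifE.
under [in RHS]eq_bigr do rewrite crevE mrev_comp mrev_coface.
rewrite [in RHS](reindex_inj rev_ord_inj)/=.
rewrite !mulr_sumr; apply: eq_bigr => i _; rewrite rev_ordK !mulrA -!exprD.
congr (_ * _); apply: sign_odd_eq; move: (ltn_ord i) => hi.
have := odd_triangle p 1; rewrite !addn1 !oddD oddB//= => ->.
parity.
Qed.

Lemma crev_mul n p q r (e : (p + q = r)%N) (e' : (q + p = r)%N)
    (c : cochain k n p) (c' : cochain k n q) :
  crev (cmul e c c') = (-1) ^+ (p * q) *: cmul e' (crev c') (crev c).
Proof.
apply: cochain_eq => s.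
change (crev (cmul e c c') s = (-1) ^+ (p * q) * cmul e' (crev c') (crev c) s).
rewrite crevE !cmulE !crevE !mrev_comp (mrev_front e' e) (mrev_back e' e).
set a := c _; set b := c' _.
have -> : (-1) ^+ ((r * r.+1)./2) =
    (-1) ^+ ((p * p.+1)./2) * (-1) ^+ ((q * q.+1)./2) * (-1) ^+ (p * q) :> k.
  by rewrite -!exprD; apply: sign_odd_eq; rewrite -e odd_triangle !oddD oddM.
by rewrite (mulnC q p); ring.
Qed.

Lemma CPL_is_involution n : is_involution (CPL_lev k n).
Proof.
split.
- case: (CPL_ambient_linear n) => _ _ _ l.
  by split=> [p x|p a x y _ _]; [exact: normalized_rev|exact: l].
- by move=> p x _; exact: crev_dif.
- by move=> p x _; exact: crev_crev.
- by apply: cochain_eq => s /=; rewrite expr0 mul1r.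
- by move=> p q r e e' x y _ _; exact: crev_mul.
Qed.

Lemma CPL_pull_is_dga_map m n (h : mono m n) :
  is_dga_map (A := CPL_lev k n) (B := CPL_lev k m)
    (fun p (c : cochain k n p) (s : mono p m) => c (mcomp h s)).
Proof.
split.
- split=> [[|p] c // nc i s|//].
  by rewrite -mcompA nc.
- by [].
- by move=> p q r e x y _ _; apply: cochain_eq => s; rewrite /= !mcompA.
- move=> p x _; apply: cochain_eq => s.
  by rewrite [LHS]/= [RHS]/=; congr (_ * _); apply: eq_bigr => i _; rewrite mcompA.
Qed.

Lemma CPL_reflexive : is_reflexive_dga (CPL k).
Proof.
split.
- by move=> n; split; [exact: CPL_is_dga|exact: CPL_is_involution].
- by move=> n i; exact: CPL_pull_is_dga_map.
- by move=> n i; exact: CPL_pull_is_dga_map.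
- move=> n i p x _; apply: cochain_eq => s /=; rewrite mrev_comp mrev_coface//.
- move=> n i p x _; apply: cochain_eq => s /=; rewrite mrev_comp mrev_codegen//.
Qed.

Lemma CPL_linear : ambient_linear_reflexive (CPL k).
Proof. by split=> // n; exact: CPL_ambient_linear. Qed.

End CPLTheory.

(** * Polynomial forms *)

Section APLTheory.
Variables (k : fieldType).

Section Level.
Variable n : nat.
Local Notation A := (APL_alg k n).
Local Notation word := (word n).
Local Notation "[' w ]" := (pgen w : A) (at level 0, w at level 200, format "[' w ]").
Implicit Types (u v w : word) (l : letter n) (x y z : A).

Lemma wdeg_nil : wdeg ([::] : word) = 0. Proof. by rewrite /wdeg big_nil. Qed.
Lemma wdeg_cons l w : wdeg (l :: w) = (l.1 + wdeg w)%N.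
Proof. by rewrite /wdeg big_cons. Qed.
Lemma wdeg_cat u v : wdeg (u ++ v) = (wdeg u + wdeg v)%N.
Proof. by rewrite /wdeg big_cat. Qed.

Lemma APL_respectsP (V : lmodType k) (f : word -> V) :
  respects (@APL_rel k n) f <->
  [/\ forall u v (x y : letter n),
        f (u ++ [:: x; y] ++ v) = (-1) ^+ (x.1 && y.1) *: f (u ++ [:: y; x] ++ v),
      forall u v, \sum_i f (u ++ (false, i) :: v) = f (u ++ v) &
      forall u v, \sum_i f (u ++ (true, i) :: v) = 0].
Proof.
split=> [fr|[f1 f2 f3] r [u [v [[x [y ->]]|->|->]]]].
- split=> [u v x y|u v|u v].
  + have /fr : APL_rel [:: (1 : k, u ++ [:: x; y] ++ v);
                   (- (-1) ^+ (x.1 && y.1), u ++ [:: y; x] ++ v)].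
      by exists u, v; apply: Or31; exists x, y.
    rewrite /lin_eval !big_cons big_nil addr0 scale1r scaleNr => /eqP.
    by rewrite subr_eq0 => /eqP.
  + have /fr : APL_rel ((- 1 : k, u ++ v) ::
             [seq (1, u ++ (false, i) :: v) | i <- enum 'I_n.+1]).
      by exists u, v; apply: Or32.
    rewrite /lin_eval big_cons big_map scaleN1r addrC => /eqP.
    rewrite subr_eq0 big_enum/= => /eqP <-.
    by apply: eq_bigr => i _; rewrite scale1r.
  + have /fr : APL_rel [seq (1 : k, u ++ (true, i) :: v) | i <- enum 'I_n.+1].
      by exists u, v; apply: Or33.
    rewrite /lin_eval big_map big_enum/= => H; rewrite -[RHS]H.
    by apply: eq_bigr => i _; rewrite scale1r.
- by rewrite /lin_eval !big_cons big_nil addr0 scale1r scaleNr f1 subrr.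
- rewrite /lin_eval big_cons big_map scaleN1r big_enum/= -f2 addrC.
  by apply/eqP; rewrite subr_eq0; apply/eqP/eq_bigr => i _; rewrite scale1r.
- rewrite /lin_eval big_map big_enum/= -[RHS](f3 u v).
  by apply: eq_bigr => i _; rewrite scale1r.
Qed.

Lemma APL_swap u v (x y : letter n) :
  [' u ++ [:: x; y] ++ v] = (-1) ^+ (x.1 && y.1) *: [' u ++ [:: y; x] ++ v].
Proof. by have /APL_respectsP[+ _ _] := @pgen_respects k _ (@APL_rel k n); apply. Qed.
Lemma APL_sum_t u v : \sum_i [' u ++ (false, i) :: v] = [' u ++ v].
Proof. by have /APL_respectsP[_ + _] := @pgen_respects k _ (@APL_rel k n); apply. Qed.
Lemma APL_sum_dt u v : \sum_i [' u ++ (true, i) :: v] = 0.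
Proof. by have /APL_respectsP[_ _ +] := @pgen_respects k _ (@APL_rel k n); apply. Qed.

Definition amul x y : A := @gmul k (APL_lev k n) 0 0 0 erefl x y.
Local Notation "x ** y" := (amul x y) (at level 40, left associativity).

(** Every relation comes with arbitrary words on both sides, so concatenation with a fixed word
    sends relations to relations. *)
Let inner_respects u : respects (@APL_rel k n) (fun v => [' u ++ v]).
Proof.
apply/APL_respectsP; split=> [u' v x y|u' v|u' v].
- by rewrite !(catA u); exact: APL_swap.
- by rewrite catA -APL_sum_t; apply: eq_bigr => i _; rewrite catA.
- by rewrite -[RHS](APL_sum_dt (u ++ u') v); apply: eq_bigr => i _; rewrite catA.
Qed.

Let outer_respects y : respects (@APL_rel k n)
  (fun u => lin_ext (fun v => pgen (u ++ v) : A) y).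
Proof.
apply/APL_respectsP; split=> [u' v a b|u' v|u' v]; move: y; apply: pres_lin_eq.
- exact/lin_ext_lin/inner_respects.
- exact/lin_scale/lin_ext_lin/inner_respects.
- by move=> w; rewrite !lin_ext_pgen//; rewrite -!catA; exact: APL_swap.
- by apply: lin_bigsum => i _; exact/lin_ext_lin/inner_respects.
- exact/lin_ext_lin/inner_respects.
- move=> w; rewrite lin_ext_pgen// -catA -APL_sum_t; apply: eq_bigr => i _.
  by rewrite lin_ext_pgen// -catA.
- by apply: lin_bigsum => i _; exact/lin_ext_lin/inner_respects.
- exact: lin_cst0.
- move=> w; rewrite -[RHS](APL_sum_dt u' (v ++ w)); apply: eq_bigr => i _.
  by rewrite lin_ext_pgen// -catA.
Qed.

Lemma amul_linl y : lin (amul ^~ y).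
Proof. exact/lin_ext_lin/outer_respects. Qed.

Lemma amulE u v : [' u] ** [' v] = [' u ++ v].
Proof. by rewrite /amul/= !lin_ext_pgen. Qed.

Lemma amul_linr x : lin (amul x).
Proof.
move=> a y z; move: x; apply: pres_lin_eq; first exact: amul_linl.
- by apply: lin_add; [apply: lin_scale|]; exact: amul_linl.
- move=> u; rewrite /amul /= !lin_ext_pgen//.
  exact/lin_ext_lin/inner_respects.
Qed.

Lemma amulA x y z : x ** y ** z = x ** (y ** z).
Proof.
move: x; apply: pres_lin_eq.
- exact: (lin_comp (amul_linl z) (amul_linl y)).
- exact: amul_linl.
move=> u; move: y; apply: pres_lin_eq.
- exact: (lin_comp (amul_linl z) (amul_linr _)).
- exact: (lin_comp (amul_linr _) (amul_linl z)).
move=> v; move: z; apply: pres_lin_eq.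
- exact: amul_linr.
- exact: (lin_comp (amul_linr _) (amul_linr _)).
by move=> w; rewrite !amulE catA.
Qed.

Lemma amul1 x : ['[::]] ** x = x.
Proof.
move: x; apply: pres_lin_eq; [exact: amul_linr|exact: lin_idfun|].
by move=> u; rewrite amulE.
Qed.
Lemma amulr1 x : x ** ['[::]] = x.
Proof.
move: x; apply: pres_lin_eq; [exact: amul_linl|exact: lin_idfun|].
by move=> u; rewrite amulE cats0.
Qed.
Lemma amul0 x : 0 ** x = 0. Proof. exact: lin0 (amul_linl x). Qed.
Lemma amulr0 x : x ** 0 = 0. Proof. exact: lin0 (amul_linr x). Qed.

Lemma amul_letter_comm u l v :
  [' u ++ l :: v] = (-1) ^+ (wdeg u * l.1) *: [' l :: u ++ v].
Proof.
elim: u => [|l' u IH] /=; first by rewrite wdeg_nil mul0n scale1r.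
rewrite -[LHS](@amulE [:: l']) IH (linZ (amul_linr _)) amulE.
have /= -> := @APL_swap [::] (u ++ v) l' l.
rewrite scalerA -exprD wdeg_cons; congr (_ *: _).
by apply: sign_odd_eq; move: (l'.1) (l.1) => [] []; parity.
Qed.

Lemma amul_word_comm u v :
  [' u ++ v] = (-1) ^+ (wdeg u * wdeg v) *: [' v ++ u].
Proof.
elim: v => [|l v IH]; first by rewrite cats0 wdeg_nil muln0 scale1r.
rewrite amul_letter_comm -[pgen (l :: _)](@amulE [:: l]) IH (linZ (amul_linr _)) amulE.
by rewrite scalerA -exprD wdeg_cons; congr (_ *: _); apply: sign_odd_eq; parity.
Qed.

Definition hom p : set A := span_of [set w | wdeg w = p].

Lemma hom_pgen p w : wdeg w = p -> hom p ['w].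
Proof. by move=> e; exact: span_pgen. Qed.

Lemma amulC p q x y : hom p x -> hom q y -> x ** y = (-1) ^+ (p * q) *: (y ** x).
Proof.
move=> hx hy; move: x hx; apply: span_lin_eq.
- exact: amul_linl.
- by apply: lin_scale; exact: amul_linr.
move=> u <-; move: y hy; apply: span_lin_eq.
- exact: amul_linr.
- by apply: lin_scale; exact: amul_linl.
by move=> v <-; rewrite !amulE -amul_word_comm.
Qed.

Lemma hom_mul p q r x y : (p + q = r)%N -> hom p x -> hom q y -> hom r (x ** y).
Proof.
move=> e hx hy; move: x hx; apply: span_lin_map; first exact: amul_linl.
move=> u /= hu; move: y hy; apply: span_lin_map; first exact: amul_linr.
by move=> v /= hv; rewrite amulE; apply: hom_pgen; rewrite wdeg_cat hu hv.
Qed.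

Local Notation wdif := (@word_dif k n).

Lemma lmulE l x : lmul l x = ['[:: l]] ** x.
Proof.
by move: x; apply: pres_lin_eq; [apply/lin_ext_lin; exact: (inner_respects [:: l])
  |exact: amul_linr|move=> w; rewrite /lmul lin_ext_pgen ?amulE//;
   exact: (inner_respects [:: l])].
Qed.

Lemma word_dif_cons l w : wdif (l :: w) =
  wdif [:: l] ** ['w] + (-1) ^+ l.1 *: (['[:: l]] ** wdif w) :> A.
Proof.
case: l => -[] i /=; rewrite !lmulE amulr0.
  by rewrite oppr0 amul0 add0r scaleN1r.
by rewrite addr0 amulE scale1r.
Qed.

Lemma word_dif_cat u v : wdif (u ++ v) =
  wdif u ** ['v] + (-1) ^+ (wdeg u) *: (['u] ** wdif v) :> A.
Proof.
elim: u => [|l u IH]; first by rewrite wdeg_nil scale1r amul1 amul0 add0r.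
rewrite cat_cons word_dif_cons IH [wdif (l :: u)]word_dif_cons.
rewrite (linD (amul_linr _)) (linD (amul_linl _)) !(linZ (amul_linr _)).
rewrite (linZ (amul_linl _)) scalerDr -!amulA !amulE addrA; congr (_ + _).
  by congr (_ + _); rewrite amulA amulE.
by rewrite scalerA -exprD wdeg_cons.
Qed.

(* The differential of [u ++ w ++ v] in terms of the value [a] and the differential
   [d] of [w], of degree [m]: it is linear in [(a, d)], so that relations between
   values and differentials of words hold in every context. *)
Let dif_ctx u v m (a d : A) : A :=
  wdif u ** (a ** ['v]) + (-1) ^+ wdeg u *: (['u] ** (d ** ['v])) +
  (-1) ^+ (wdeg u + m) *: (['u] ** (a ** wdif v)).

Let dif_ctxE u v w : wdif (u ++ w ++ v) = dif_ctx u v (wdeg w) ['w] (wdif w).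
Proof.
rewrite !word_dif_cat (linD (amul_linr _)) (linZ (amul_linr _)) scalerDr.
by rewrite scalerA -exprD addrA /dif_ctx amulE.
Qed.

Let dif_ctx_lin u v m : lin (fun ad : A * A => dif_ctx u v m ad.1 ad.2).
Proof.
have l1 : lin (fun ad : A * A => ad.1) by [].
have l2 : lin (fun ad : A * A => ad.2) by [].
apply: lin_add; first apply: lin_add.
- exact: (lin_comp (amul_linr _) (lin_comp (amul_linl _) l1)).
- by apply: lin_scale; exact: (lin_comp (amul_linr _) (lin_comp (amul_linl _) l2)).
- by apply: lin_scale; exact: (lin_comp (amul_linr _) (lin_comp (amul_linl _) l1)).
Qed.

Let dif_ctxZ u v m c a d : dif_ctx u v m (c *: a) (c *: d) = c *: dif_ctx u v m a d.
Proof. exact: (linZ (dif_ctx_lin u v m) c (a, d)). Qed.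

Let dif_ctx_sum u v m (I : finType) (a d : I -> A) :
  dif_ctx u v m (\sum_i a i) (\sum_i d i) = \sum_i dif_ctx u v m (a i) (d i).
Proof.
rewrite -(lin_sum (dif_ctx_lin u v m) _ _ (fun i => (a i, d i))).
have -> : \sum_i (a i, d i) = (\sum_i a i, \sum_i d i) :> A * A.
  by elim/big_rec3 : _ => // i x y z _ ->.
by [].
Qed.

Lemma word_dif1 l : wdif [:: l] = if l.1 then 0 else ['[:: (true, l.2)]] :> A.
Proof. by case: l => -[] i /=; rewrite lmulE amulr0 ?oppr0 ?addr0. Qed.

Lemma word_dif_respects : respects (@APL_rel k n) (@word_dif k n).
Proof.
apply/APL_respectsP; split=> [u v x y|u v|u v].
- rewrite !dif_ctxE !wdeg_cons wdeg_nil !addn0 (addnC x.1 y.1).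
  rewrite -dif_ctxZ; congr dif_ctx; first by have := APL_swap [::] [::] x y.
  rewrite !(word_dif_cons _ [:: _]) !word_dif1.
  case: x y => -[] i [[] j] /=; rewrite ?amul0 ?amulr0 ?scaler0 ?addr0 ?add0r//=.
  + by rewrite scaler0.
  + rewrite !amulE expr0 expr1 scale1r scaleN1r; have /= -> := APL_swap [::] [::] (true, i).
    by rewrite expr1 scaleN1r opprK.
  + by rewrite !amulE expr0 scale1r; have /= -> := APL_swap [::] [::] (true, i).
  + rewrite !scale1r !amulE addrC; congr (_ + _);
      by rewrite (@APL_swap [::] [::])/= scale1r.
- under eq_bigr do rewrite -cat1s dif_ctxE wdeg_cons wdeg_nil/= addn0.
  (* The right side of sum t = 1 is the empty word in the same context and of the same degree 0, so
     values and differentials can be compared outside the context. *)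
  rewrite -dif_ctx_sum -[u ++ v]/(u ++ [::] ++ v) dif_ctxE wdeg_nil.
  congr dif_ctx; first by have := APL_sum_t [::] [::].
  by under eq_bigr do rewrite lmulE amulr0 addr0; have := APL_sum_dt [::] [::].
- under eq_bigr do rewrite -cat1s dif_ctxE wdeg_cons wdeg_nil/= addn0.
  rewrite -dif_ctx_sum; under [X in dif_ctx _ _ _ _ X]eq_bigr do
    rewrite lmulE amulr0 oppr0.
  have /= -> := APL_sum_dt [::] [::]; rewrite big1_eq.
  exact: (lin0 (dif_ctx_lin u v 1)).
Qed.

Definition adif x : A := @gdif k (APL_lev k n) 0 x.

Lemma adif_lin : lin adif. Proof. exact/lin_ext_lin/word_dif_respects. Qed.
Lemma adifE w : adif ['w] = wdif w.
Proof. by rewrite /adif/= lin_ext_pgen//; exact: word_dif_respects. Qed.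

Lemma hom_dif p x : hom p x -> hom p.+1 (adif x).
Proof.
move: x; apply: span_lin_map; first exact: adif_lin.
move=> w <-; rewrite adifE; elim: w => [|l w IH]; first exact: span0.
rewrite word_dif_cons word_dif1; apply: spanD; last first.
  apply: spanZ; apply: (hom_mul (p := l.1) _ _ IH); first by rewrite wdeg_cons addnS.
  by apply: hom_pgen; rewrite wdeg_cons wdeg_nil addn0.
case: l => -[] i /=; first by rewrite amul0; exact: span0.
by rewrite amulE; apply: hom_pgen; rewrite !wdeg_cons.
Qed.

Lemma adif_leibniz p x y : hom p x ->
  adif (x ** y) = adif x ** y + (-1) ^+ p *: (x ** adif y).
Proof.
move=> hx; move: x hx; apply: span_lin_eq.
- exact: (lin_comp adif_lin (amul_linl y)).
- apply: lin_add; first exact: (lin_comp (amul_linl y) adif_lin).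
  by apply: lin_scale; exact: amul_linl.
move=> u <-; move: y; apply: pres_lin_eq.
- exact: (lin_comp adif_lin (amul_linr _)).
- apply: lin_add; first exact: amul_linr.
  by apply: lin_scale; exact: (lin_comp (amul_linr _) adif_lin).
by move=> v; rewrite amulE !adifE word_dif_cat.
Qed.

Lemma adif_adif x : adif (adif x) = 0.
Proof.
move: x; apply: pres_lin_eq; [exact: (lin_comp adif_lin adif_lin)|exact: lin_cst0|].
move=> w; rewrite adifE; elim: w => [|l w IH]; first exact: (lin0 adif_lin).
rewrite word_dif_cons (linD adif_lin) (linZ adif_lin) word_dif1.
have hl : hom l.1 ['[:: l]] by apply: hom_pgen; rewrite wdeg_cons wdeg_nil addn0.
rewrite (adif_leibniz _ hl) IH amulr0 scaler0 addr0 adifE word_dif1.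
case: l {hl} => -[] i /=.
  by rewrite !amul0 (lin0 adif_lin) scaler0 addr0.
have hl : hom 1 ['[:: (true, i)]] by apply: hom_pgen; rewrite wdeg_cons wdeg_nil.
by rewrite (adif_leibniz _ hl) !adifE word_dif1/= amul0 add0r scale1r scaleN1r addNr.
Qed.

Lemma APL_is_dga : is_dga (APL_lev k n).
Proof.
split.
- split.
  + by move=> p; exact: span0.
  + by move=> p a x y; exact: span_lin.
  + by apply: hom_pgen; exact: wdeg_nil.
  + by move=> p q r e x y; exact: hom_mul.
- by split=> p q r e a x y z _ _ _; [exact: amul_linl|exact: amul_linr].
- split.
  + by move=> p e x _; exact: amul1.
  + by move=> p e x _; exact: amulr1.
  + by move=> p q r pq qr s e1 e2 e3 e4 x y z _ _ _; exact: amulA.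
- split; last by move=> p x _; exact: adif_adif.
  by split=> [p x|p a x y _ _]; [exact: hom_dif|exact: adif_lin].
- by move=> p q r e e1 e2 x y hx _; exact: adif_leibniz.
Qed.

End Level.

Local Notation "x ** y" := (amul x y) (at level 40, left associativity).

(** * Pullback of polynomial forms along vertex maps *)

Section Pull.
Variables (m n : nat) (f : 'I_m.+1 -> 'I_n.+1).

Definition lpull (l : letter n) : APL_alg k m := \sum_(i | f i == l.2) pgen [:: (l.1, i)].

Definition wpull (w : word n) : APL_alg k m :=
  foldr (fun l x => \sum_(i | f i == l.2) lmul (l.1, i) x) (pgen [::]) w.

Lemma wpull_cons l w : wpull (l :: w) = lpull l ** wpull w.
Proof.
rewrite /= (lin_sum (amul_linl _)).
by apply: eq_bigr => i _; rewrite lmulE.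
Qed.

Lemma wpull_cat u v : wpull (u ++ v) = wpull u ** wpull v.
Proof.
elim: u => [|l u IH]; first by rewrite [RHS]amul1.
by rewrite cat_cons !wpull_cons IH amulA.
Qed.

Lemma wpull1 l : wpull [:: l] = lpull l.
Proof. by rewrite wpull_cons amulr1. Qed.

Lemma hom_lpull (l : letter n) : hom l.1 (lpull l).
Proof.
by apply: span_sum => i _; apply: hom_pgen; rewrite wdeg_cons wdeg_nil addn0.
Qed.

Lemma hom_wpull w : hom (wdeg w) (wpull w).
Proof.
elim: w => [|l w IH]; first by apply: hom_pgen; rewrite !wdeg_nil.
by rewrite wpull_cons; apply: (hom_mul _ (hom_lpull l) IH); rewrite wdeg_cons.
Qed.

(** The fibres of [f] partition the vertices; this is why pullback preserves the relations sum t = 1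
    and sum dt = 0. *)
Lemma lpull_sum b : \sum_j lpull (b, j) = \sum_i pgen [:: (b, i)].
Proof.
by rewrite [RHS](partition_big f predT).
Qed.

Lemma wpull_respects : respects (@APL_rel k n) wpull.
Proof.
apply/APL_respectsP; split=> [u v x y|u v|u v].
- rewrite !wpull_cat !wpull_cons !amulr1 (amulC (hom_lpull x) (hom_lpull y)).
  rewrite (linZ (amul_linl _)) (linZ (amul_linr _)); congr (_ *: _).
  by apply: sign_odd_eq; move: (x.1) (y.1) => [] [].
- under eq_bigr do rewrite wpull_cat wpull_cons -amulA.
  rewrite -(lin_sum (amul_linl _)) -(lin_sum (amul_linr _)) lpull_sum.
  by have /= -> := @APL_sum_t m [::] [::]; rewrite amulr1 wpull_cat.
- under eq_bigr do rewrite wpull_cat wpull_cons -amulA.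
  rewrite -(lin_sum (amul_linl _)) -(lin_sum (amul_linr _)) lpull_sum.
  by have /= -> := @APL_sum_dt m [::] [::]; rewrite amulr0 amul0.
Qed.

Lemma APL_pull_lin : lin (APL_pull f : APL_alg k n -> APL_alg k m).
Proof. exact/lin_ext_lin/wpull_respects. Qed.

Lemma APL_pullE w : APL_pull f (pgen w) = wpull w.
Proof. exact/lin_ext_pgen/wpull_respects. Qed.

Lemma APL_pullM x y : APL_pull f (x ** y) = APL_pull f x ** APL_pull f y.
Proof.
move: x; apply: pres_lin_eq.
- exact: (lin_comp APL_pull_lin (amul_linl y)).
- exact: (lin_comp (amul_linl _) APL_pull_lin).
move=> u; move: y; apply: pres_lin_eq.
- exact: (lin_comp APL_pull_lin (amul_linr _)).
- exact: (lin_comp (amul_linr _) APL_pull_lin).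
by move=> v; rewrite amulE !APL_pullE wpull_cat.
Qed.

Lemma hom_APL_pull p x : hom p x -> hom p (APL_pull f x).
Proof.
move: x; apply: span_lin_map; first exact: APL_pull_lin.
by move=> w <-; rewrite APL_pullE; exact: hom_wpull.
Qed.

Lemma adif_lpull (l : letter n) : adif (lpull l) = if l.1 then 0 else lpull (true, l.2).
Proof.
rewrite (lin_sum (@adif_lin m)); under eq_bigr do rewrite adifE word_dif1.
by case: l => -[] j //=; rewrite big1_eq.
Qed.

Lemma APL_pull_dif x : APL_pull f (adif x) = adif (APL_pull f x).
Proof.
move: x; apply: pres_lin_eq.
- exact: (lin_comp APL_pull_lin (@adif_lin n)).
- exact: (lin_comp (@adif_lin m) APL_pull_lin).
move=> w; rewrite adifE APL_pullE; elim: w => [|l w IH].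
  by rewrite /= (lin0 APL_pull_lin) adifE.
rewrite word_dif_cons (linD APL_pull_lin) (linZ APL_pull_lin) !APL_pullM !APL_pullE.
rewrite IH wpull1 wpull_cons (adif_leibniz _ (hom_lpull l)) adif_lpull word_dif1.
by congr (_ ** _ + _); case: l => -[] j /=; rewrite ?(lin0 APL_pull_lin)// APL_pullE wpull1.
Qed.

Lemma APL_pull_is_dga_map : is_dga_map (A := APL_lev k n) (B := APL_lev k m)
  (fun _ => APL_pull f).
Proof.
split.
- by split=> [p x|p a x y _ _]; [exact: hom_APL_pull|exact: APL_pull_lin].
- exact: APL_pullE.
- by move=> p q r e x y _ _; exact: APL_pullM.
- by move=> p x _; exact: APL_pull_dif.
Qed.

End Pull.

Lemma APL_pull_comp a b c (f : 'I_a.+1 -> 'I_b.+1) (g : 'I_b.+1 -> 'I_c.+1)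
    (x : APL_alg k c) : APL_pull f (APL_pull g x) = APL_pull (g \o f) x.
Proof.
move: x; apply: pres_lin_eq.
- exact: (lin_comp (APL_pull_lin f) (APL_pull_lin g)).
- exact: APL_pull_lin.
move=> w; rewrite !APL_pullE; elim: w => [|l w IH]; first by rewrite APL_pullE.
rewrite !wpull_cons APL_pullM IH; congr (_ ** _).
rewrite (lin_sum (APL_pull_lin f)) [RHS](partition_big f (fun j => g j == l.2))//=.
apply: eq_bigr => j /eqP gj; rewrite APL_pullE wpull1; apply: eq_bigl => i /=.
by rewrite andb_idl// => /eqP ->; apply/eqP.
Qed.

Lemma APL_pull_id n (f : 'I_n.+1 -> 'I_n.+1) (x : APL_alg k n) :
  f =1 id -> APL_pull f x = x.
Proof.
move=> /funext ->; move: x; apply: pres_lin_eq; [exact: APL_pull_lin|exact: lin_idfun|].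
move=> w; rewrite APL_pullE; elim: w => // l w IH.
rewrite wpull_cons IH /lpull (big_pred1 l.2) => [|i]; last by rewrite eq_sym.
by rewrite amulE -surjective_pairing.
Qed.

Lemma APL_pull_eq m n (f g : 'I_m.+1 -> 'I_n.+1) (x : APL_alg k n) :
  f =1 g -> APL_pull f x = APL_pull g x.
Proof. by move=> /funext ->. Qed.

Lemma APL_is_involution n : is_involution (APL_lev k n).
Proof.
split.
- by split=> [p x|p a x y _ _]; [exact: hom_APL_pull|exact: APL_pull_lin].
- by move=> p x _; exact: APL_pull_dif.
- move=> p x _; rewrite /= APL_pull_comp APL_pull_id// => i; exact: rev_ordK.
- exact: APL_pullE.
(* The flip is an algebra map; graded commutativity turns it into an anti-automorphism with the
   required sign. *)
- move=> p q r e e' x y hx hy; rewrite [LHS]APL_pullM.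
  exact: amulC (hom_APL_pull _ hx) (hom_APL_pull _ hy).
Qed.

Lemma APL_reflexive : is_reflexive_dga (APL k).
Proof.
split.
- by move=> n; split; [exact: APL_is_dga|exact: APL_is_involution].
- by move=> n i; exact: APL_pull_is_dga_map.
- by move=> n i; exact: APL_pull_is_dga_map.
- move=> n i p x _; rewrite /= !APL_pull_comp; exact/APL_pull_eq/rev_coface.
- move=> n i p x _; rewrite /= !APL_pull_comp; exact/APL_pull_eq/rev_codegen.
Qed.

Lemma APL_linear : ambient_linear_reflexive (APL k).
Proof.
split=> [n|n i p|n i p]; [|exact: APL_pull_lin|exact: APL_pull_lin].
split.
- by move=> p q r e y; exact: amul_linl.
- by move=> p q r e x; exact: amul_linr.
- by move=> p; exact: adif_lin.
- by move=> p; exact: APL_pull_lin.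
Qed.

End APLTheory.

Lemma cochain_polynomial_zigzag (k : fieldType) (K : reflexiveSet) :
  is_involutive_dga_map (smap_post (@tensor_inr k (CPL k) (APL k)) (K := K)) /\
  is_involutive_dga_map (smap_post (@tensor_inl k (CPL k) (APL k)) (K := K)).
Proof.
have [lC rC] := (CPL_linear k, CPL_reflexive k).
have [lA rA] := (APL_linear k, APL_reflexive k).
have rT := tensor_reflexive lC lA rC rA.
by split; apply: smap_post_involutive => //;
  [exact: tensor_inr_reflexive|exact: tensor_inl_reflexive].
Qed.

(** * Antisymmetrization and the wedge product *)

Section ExtendPerm.
Variables (T U : finType) (h : T -> U).
Hypothesis h_inj : injective h.

(** Acts as [s] on the image of [h] and fixes the rest. It makes the permutations of a block of
    slots, or of all slots but the first, into permutations of all slots. *)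
Definition perm_ext_fun (s : {perm T}) (x : U) : U :=
  if [pick i | h i == x] is Some i then h (s i) else x.

Lemma perm_ext_fun_in s i : perm_ext_fun s (h i) = h (s i).
Proof.
rewrite /perm_ext_fun; case: pickP => [j /eqP/h_inj ->//|/(_ i)].
by rewrite eqxx.
Qed.

Lemma perm_ext_fun_out s x : (forall i, h i != x) -> perm_ext_fun s x = x.
Proof.
by move=> hx; rewrite /perm_ext_fun; case: pickP => // j; rewrite (negbTE (hx j)).
Qed.

Lemma perm_ext_funP x : (exists i, x = h i) \/ (forall i, h i != x).
Proof.
case: (pickP (fun i => h i == x)) => [i /eqP <-|hx]; first by left; exists i.
by right => i; rewrite hx.
Qed.

Lemma perm_ext_fun_inj s : injective (perm_ext_fun s).
Proof.
apply: (can_inj (g := perm_ext_fun s^-1%g)) => x.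
case: (perm_ext_funP x) => [[i ->]|hx].
  by rewrite !perm_ext_fun_in permK.
by rewrite !perm_ext_fun_out.
Qed.

Definition perm_ext s : {perm U} := perm (@perm_ext_fun_inj s).

Lemma perm_ext_in s i : perm_ext s (h i) = h (s i).
Proof. by rewrite permE perm_ext_fun_in. Qed.
Lemma perm_ext_out s x : (forall i, h i != x) -> perm_ext s x = x.
Proof. by move=> hx; rewrite permE perm_ext_fun_out. Qed.

(** Extension is multiplicative and sends transpositions to transpositions. *)
Lemma odd_perm_ext s : perm_ext s = s :> bool.
Proof.
have [ts -> _] := prod_tpermP s.
have ext1 : perm_ext 1 = 1%g.
  apply/permP => x; rewrite perm1; case: (perm_ext_funP x) => [[i ->]|/perm_ext_out->//].
  by rewrite perm_ext_in perm1.
have extM a b : perm_ext (a * b) = (perm_ext a * perm_ext b)%g.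
  apply/permP => x; rewrite permM; case: (perm_ext_funP x) => [[i ->]|hx].
    by rewrite !perm_ext_in permM.
  by rewrite !perm_ext_out.
elim: ts => [|t ts IH]; first by rewrite big_nil ext1 !odd_perm1.
rewrite big_cons extM !odd_permM IH; congr (_ (+) _).
have -> : perm_ext (tperm t.1 t.2) = tperm (h t.1) (h t.2).
  apply/permP => x; case: (perm_ext_funP x) => [[i ->]|hx].
    by rewrite perm_ext_in (inj_tperm _ _ _ h_inj).
  by rewrite perm_ext_out// tpermD.
by rewrite !odd_tperm (inj_eq h_inj).
Qed.

End ExtendPerm.

(** * The exchange of two blocks and its sign *)

Section BlockSwap.
Variables (p q r : nat) (e : (p + q = r)%N).

(** Moves the first p indices behind the last q ones; its parity is the origin of the sign (-1)^(p
    q) in graded commutativity. *)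
Definition bswap_fun (i : 'I_r) : 'I_r :=
  insubd i (if (i < p)%N then i + q else i - p)%N.

Lemma bswap_funE i : bswap_fun i = (if (i < p)%N then i + q else i - p)%N :> nat.
Proof.
rewrite /bswap_fun val_insubd; case: ifP => // /negbT.
by move: (ltn_ord i); case: ifP; lia.
Qed.

Lemma bswap_fun_inj : injective bswap_fun.
Proof.
move=> i j /(congr1 val); rewrite /= !bswap_funE => ij; apply/val_inj => /=.
by move: (ltn_ord i) (ltn_ord j) ij; do 2!case: ifP; lia.
Qed.

Definition bswap : 'S_r := perm bswap_fun_inj.

Lemma bswapE i : bswap i = (if (i < p)%N then i + q else i - p)%N :> nat.
Proof. by rewrite permE bswap_funE. Qed.

End BlockSwap.

(** The index 0 is sent to q, past q indices; removing it leaves the exchange of blocks of sizes p -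
    1 and q. *)
Lemma odd_bswap p q r (e : (p + q = r)%N) : bswap e = odd (p * q) :> bool.
Proof.
elim: p r e => [|p IH] r e.
  rewrite (_ : bswap e = 1%g) ?odd_perm1//; apply/permP => i; rewrite perm1.
  by apply/val_inj; rewrite /= bswapE ltn0 subn0.
case: r e => [//|r] e; have er : (p + q = r)%N by lia.
have qr : (q < r.+1)%N by lia.
rewrite (_ : bswap e = lift_perm ord0 (Ordinal qr) (bswap er)).
  by rewrite odd_lift_perm IH/= mulSn oddD.
apply/permP => i; apply/val_inj; rewrite /= bswapE.
case: (unliftP ord0 i) => [j|] ->.
  rewrite lift_perm_lift /= bswapE /bump/= add1n ltnS subSS.
  by have := ltn_ord j; case: (ltnP j p) => /= *; lia.
by rewrite lift_perm_id.
Qed.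

(** * Antisymmetrization *)

Section AltSum.
Variables (R : realType) (E : lmodType R).

(** Antisymmetrization without division by n!; wedge products and exterior derivatives are multiples
    of it. *)
Definition altsum n (F : ('I_n -> E) -> R) (v : 'I_n -> E) : R :=
  \sum_(s : 'S_n) (-1) ^+ s * F (fun i => v (s i)).

Lemma eq_altsum n (F G : ('I_n -> E) -> R) v :
  (forall s : 'S_n, F (fun i => v (s i)) = G (fun i => v (s i))) ->
  altsum F v = altsum G v.
Proof. by move=> FG; apply: eq_bigr => s _; rewrite FG. Qed.

Lemma altsumZ n a (F : ('I_n -> E) -> R) v :
  altsum (fun u => a * F u) v = a * altsum F v.
Proof. by rewrite mulr_sumr; apply: eq_bigr => s _; rewrite mulrCA. Qed.

Lemma altsumD n (F G : ('I_n -> E) -> R) v :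
  altsum (fun u => F u + G u) v = altsum F v + altsum G v.
Proof. by rewrite -big_split; apply: eq_bigr => s _; rewrite /= mulrDr. Qed.

Lemma altsum_sum n (I : finType) (F : I -> ('I_n -> E) -> R) v :
  altsum (fun u => \sum_i F i u) v = \sum_i altsum (F i) v.
Proof. by rewrite exchange_big; apply: eq_bigr => s _; rewrite mulr_sumr. Qed.

Lemma sgnM n (s t : 'S_n) : (-1) ^+ (s * t)%g = (-1) ^+ s * (-1) ^+ t :> R.
Proof. by rewrite odd_permM signr_addb. Qed.

Lemma sgn_sqr n (s : 'S_n) : (-1) ^+ s * (-1) ^+ s = 1 :> R.
Proof. by rewrite -signr_addb addbb. Qed.

Lemma altsum_perm n (F : ('I_n -> E) -> R) v (t : 'S_n) :
  altsum F (fun i => v (t i)) = (-1) ^+ t * altsum F v.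
Proof.
rewrite /altsum mulr_sumr [RHS](reindex_inj (mulIg t))/=; apply: eq_bigr => s _.
rewrite sgnM mulrA [_ * (_ * _)]mulrCA sgn_sqr mulr1; congr (_ * F _).
by apply/funext => i; rewrite permM.
Qed.

(** Here the slots of [F] are permuted, in [altsum_perm] the vectors; reindexing the sum by a left
    or a right translation absorbs either. *)
Lemma altsum_perm_arg n (F : ('I_n -> E) -> R) v (t : 'S_n) :
  altsum (fun u => F (fun i => u (t i))) v = (-1) ^+ t * altsum F v.
Proof.
rewrite /altsum mulr_sumr [RHS](reindex_inj (mulgI t))/=; apply: eq_bigr => s _.
rewrite sgnM mulrA mulrA sgn_sqr mul1r; congr (_ * F _).
by apply/funext => i; rewrite permM.
Qed.

(** Each inner permutation is absorbed by reindexing the outer sum, and its sign cancels, so [#|T|]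
    equal terms remain. With [h] the extension of the permutations of a block, this removes the
    inner antisymmetrization in iterated wedges and derivatives. *)
Lemma altsum_absorb n (T : finType) (h : T -> 'S_n) (F : ('I_n -> E) -> R) v :
  altsum (fun u => \sum_t (-1) ^+ h t * F (fun i => u (h t i))) v =
  #|T|%:R * altsum F v.
Proof.
rewrite altsum_sum mulr_natl -sumr_const; apply: eq_bigr => t _.
by rewrite altsumZ altsum_perm_arg mulrA sgn_sqr mul1r.
Qed.

Definition multilinear n (F : ('I_n -> E) -> R) :=
  forall v i (c : R) (u w : E),
     F [eta v with i |-> c *: u + w] =
     c * F [eta v with i |-> u] + F [eta v with i |-> w].

Lemma upd_perm n (v : 'I_n -> E) i u (s : 'S_n) :
  (fun j => [eta v with i |-> u] (s j)) =
  [eta (fun j => v (s j)) with s^-1%g i |-> u].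
Proof.
by apply/funext => j /=; rewrite (can2_eq (permK s) (permKV s)).
Qed.

Lemma altsum_multilinear n (F : ('I_n -> E) -> R) :
  multilinear F -> multilinear (altsum F).
Proof.
move=> mF v i c u w; rewrite /altsum mulr_sumr -big_split/=; apply: eq_bigr => s _.
by rewrite !upd_perm mF mulrDr mulrCA.
Qed.

Lemma altsum_alternating n (F : ('I_n -> E) -> R) :
  multilinear F -> alternating (altsum F : aform E n).
Proof.
move=> mF; split; first exact: altsum_multilinear.
move=> v i j ij vij.
have : altsum F (fun l => v (tperm i j l)) = altsum F v.
  congr altsum; apply/funext => l; case: tpermP => [->|->|//]; by rewrite vij.
rewrite altsum_perm odd_tperm ij expr1 mulN1r => /eqP.
by rewrite eqNr => /eqP.
Qed.

Lemma alternatingZ n c (a : aform E n) :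
  alternating a -> alternating (fun v => c * a v : R^o).
Proof.
move=> [m z]; split=> [v i d u w|v i j ij vij]; first by rewrite m; ring.
by rewrite (z v i j)// mulr0.
Qed.

Lemma alternating_lin n c (a b : aform E n) :
  alternating a -> alternating b -> alternating (c *: a + b).
Proof.
move=> [ma za] [mb zb]; split=> [v i d u w|v i j ij vij].
  change (c * a [eta v with i |-> d *: u + w] + b [eta v with i |-> d *: u + w] =
    d * (c * a [eta v with i |-> u] + b [eta v with i |-> u]) +
    (c * a [eta v with i |-> w] + b [eta v with i |-> w])).
  by rewrite ma mb; ring.
change (c * a v + b v = 0).
by rewrite (za v i j)// (zb v i j)// mulr0 addr0.
Qed.

Lemma alternating_perm n (a : aform E n) v (s : 'S_n) :
  alternating a -> a (fun i => v (s i)) = (-1) ^+ s * a v.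
Proof.
move=> [m z]; have [ts -> dts] := prod_tpermP s.
elim: ts dts v => [_ v|t ts IH /= /andP[dt dts] v].
  by rewrite big_nil odd_perm1 expr0 mul1r; congr (a _); apply/funext => i; rewrite perm1.
rewrite big_cons sgnM odd_tperm; move: (t.1) (t.2) dt => i j ij.
rewrite /dpair/= in ij; rewrite ij expr1.
pose v' l := v ((\prod_(t <- ts) tperm t.1 t.2)%g l).
transitivity (a (fun l => v' (tperm i j l))).
  by congr (a _); apply/funext => l; rewrite /v' permM.
rewrite -mulrA -IH// -/v' mulN1r.
pose f x y := a [eta [eta v' with i |-> x] with j |-> y].
have fl x x' y : f (x + x') y = f x y + f x' y.
  rewrite /f; have C z' : [eta [eta v' with i |-> z'] with j |-> y] =
      [eta [eta v' with j |-> y] with i |-> z'] :> ('I_n -> E).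
    apply/funext => l /=; case: (eqVneq l j) => [->|//].
    by rewrite eq_sym (negbTE ij).
  by rewrite !C -[x in x + x']scale1r m mul1r.
have fr x y y' : f x (y + y') = f x y + f x y'.
  by rewrite /f -[y in y + y']scale1r m mul1r.
have ff x : f x x = 0.
  by apply: (z _ i j) => //=; rewrite eqxx (negbTE ij) eqxx.
(* Polarization: with the sum of the two vectors in both slots, only the two mixed terms survive,
   and they are opposite. *)
have : f (v' i + v' j) (v' i + v' j) = 0 by exact: ff.
rewrite fl !fr !ff add0r addr0 => /eqP; rewrite addr_eq0 => /eqP.
have -> : f (v' i) (v' j) = a v'.
  rewrite /f; congr (a _); apply/funext => l /=.
  by case: eqVneq => [->//|_]; case: eqVneq => [->|].
move=> ->; rewrite opprK /f; congr (a _); apply/funext => l /=.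
case: tpermP => [->|->|/eqP/negbTE -> /eqP/negbTE ->//].
  by rewrite (negbTE ij) eqxx.
by rewrite eqxx.
Qed.

Lemma altsum_alternatingE n (a : aform E n) v :
  alternating a -> altsum a v = n`!%:R * a v.
Proof.
move=> aa; rewrite /altsum; under eq_bigr do rewrite alternating_perm// mulrA sgn_sqr mul1r.
by rewrite sumr_const card_Sn mulr_natl.
Qed.

End AltSum.

(** * The wedge product *)

Section Wedge.
Variables (R : realType) (E : lmodType R).
Local Notation aform := (aform E).

Section Blocks.
Variables (p q r : nat) (e : (p + q = r)%N).
Definition fst_block (i : 'I_p) : 'I_r := cast_ord e (lshift q i).
Definition snd_block (i : 'I_q) : 'I_r := cast_ord e (rshift p i).
Lemma fst_block_inj : injective fst_block.
Proof. by move=> i j /(congr1 val)/= ij; apply/val_inj. Qed.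
Lemma snd_block_inj : injective snd_block.
Proof. by move=> i j /(congr1 val)/= /addnI ij; apply/val_inj. Qed.
Lemma fst_snd_block i j : fst_block i != snd_block j.
Proof. by rewrite -val_eqE/=; move: (ltn_ord i); lia. Qed.
Lemma snd_fst_block i j : snd_block i != fst_block j.
Proof. by rewrite eq_sym fst_snd_block. Qed.
Lemma blockP i : (exists j, i = fst_block j) \/ (exists j, i = snd_block j).
Proof.
have [ip|pi] := ltnP i p; [left; exists (Ordinal ip)|right]; first exact/val_inj.
have iq : (i - p < q)%N by move: (ltn_ord i); lia.
by exists (Ordinal iq); apply/val_inj; rewrite /= subnKC.
Qed.
End Blocks.

Lemma wedgeE p q r (e : (p + q = r)%N) (a : aform p) (b : aform q) v :
  wedge e a b v = (p`!%:R * q`!%:R)^-1 *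
    altsum (fun u => a (fun i => u (fst_block e i)) * b (fun j => u (snd_block e j))) v.
Proof. by []. Qed.

Lemma fact_neq0 n : n`!%:R != 0 :> R.
Proof. by rewrite pnatr_eq0 -lt0n fact_gt0. Qed.

Lemma wedge_linl p q r (e : (p + q = r)%N) c (a a' : aform p) (b : aform q) :
  wedge e (c *: a + a') b = c *: wedge e a b + wedge e a' b.
Proof.
apply/funext => v.
change (wedge e (c *: a + a') b v = c * wedge e a b v + wedge e a' b v).
rewrite !wedgeE mulrCA -mulrDr; congr (_ * _); rewrite -altsumZ -altsumD.
by apply: eq_altsum => s; rewrite mulrA -mulrDl.
Qed.

Lemma wedge_linr p q r (e : (p + q = r)%N) c (a : aform p) (b b' : aform q) :
  wedge e a (c *: b + b') = c *: wedge e a b + wedge e a b'.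
Proof.
apply/funext => v.
change (wedge e a (c *: b + b') v = c * wedge e a b v + wedge e a b' v).
rewrite !wedgeE mulrCA -mulrDr; congr (_ * _); rewrite -altsumZ -altsumD.
by apply: eq_altsum => s; rewrite mulrCA -mulrDr.
Qed.

Lemma upd_block p r (h : 'I_p -> 'I_r) (h_inj : injective h) (v : 'I_r -> E) i u :
  (fun j => [eta v with h i |-> u] (h j)) = [eta (fun j => v (h j)) with i |-> u].
Proof. by apply/funext => j /=; rewrite (inj_eq h_inj). Qed.

Lemma upd_other_block p r (h : 'I_p -> 'I_r) (v : 'I_r -> E) i u :
  (forall j, h j != i) -> (fun j => [eta v with i |-> u] (h j)) = (fun j => v (h j)).
Proof. by move=> hi; apply/funext => j /=; rewrite (negbTE (hi j)). Qed.

Lemma wedge_multilinear p q r (e : (p + q = r)%N) (a : aform p) (b : aform q) :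
  multilinear a -> multilinear b ->
  multilinear (fun u : 'I_r -> E =>
    a (fun i => u (fst_block e i)) * b (fun j => u (snd_block e j))).
Proof.
move=> ma mb v i c u w; case: (blockP e i) => -[j ->].
- rewrite !(upd_block (@fst_block_inj _ _ _ e)) ma.
  rewrite !(upd_other_block _ _ (fun l => snd_fst_block e l j)); ring.
- rewrite !(upd_block (@snd_block_inj _ _ _ e)) mb.
  rewrite !(upd_other_block _ _ (fun l => fst_snd_block e l j)); ring.
Qed.

Lemma wedge_alternating p q r (e : (p + q = r)%N) (a : aform p) (b : aform q) :
  alternating a -> alternating b -> alternating (wedge e a b).
Proof.
move=> [ma _] [mb _].
exact/alternatingZ/(altsum_alternating (wedge_multilinear e ma mb)).
Qed.

Lemma wedge1 p (e : (0 + p = p)%N) (a : aform p) :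
  alternating a -> wedge e (fun=> 1) a = a.
Proof.
move=> aa; apply/funext => v; rewrite wedgeE mul1r.
under [altsum _ _]eq_altsum => s.
  rewrite mul1r (_ : (fun j => _) = (fun j => v (s j))); last first.
    by apply/funext => j; congr (v (s _)); apply/val_inj.
  over.
by rewrite altsum_alternatingE// mulKf// fact_neq0.
Qed.

(** The exchange of the two blocks of slots carries one product into the other, and its sign is
    (-1)^(p q). *)
Lemma wedgeC p q r (e : (p + q = r)%N) (e' : (q + p = r)%N) (a : aform p) (b : aform q) :
  wedge e a b = (-1) ^+ (p * q) *: wedge e' b a.
Proof.
apply/funext => v.
change (wedge e a b v = (-1) ^+ (p * q) * wedge e' b a v).
rewrite !wedgeE mulrCA [q`!%:R * _]mulrC; congr (_ * _).
have -> : (-1) ^+ (p * q) = (-1) ^+ bswap e' :> R.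
  by rewrite odd_bswap signr_odd mulnC.
rewrite -altsum_perm_arg; apply: eq_altsum => s; rewrite mulrC.
congr (b _ * a _); apply/funext => i; congr (v (s _)); apply/val_inj => /=.
- by rewrite bswapE/= ltn_ord addnC.
- by rewrite bswapE/= addKn ltnNge leq_addr.
Qed.

(** Both sides are 1/(p! q! r!) times the antisymmetrization of the triple product [F]: absorbing
    the inner wedge produces the factorial of its degree, which the outer normalization cancels. *)
Lemma wedgeA p q r pq qr t (e1 : (p + q = pq)%N) (e2 : (pq + r = t)%N)
    (e3 : (q + r = qr)%N) (e4 : (p + qr = t)%N)
    (x : aform p) (y : aform q) (z : aform r) :
  wedge e2 (wedge e1 x y) z = wedge e4 x (wedge e3 y z).
Proof.
apply/funext => v; rewrite !wedgeE.
pose F (u : 'I_t -> E) : R := x (fun i => u (fst_block e2 (fst_block e1 i))) *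
  y (fun i => u (fst_block e2 (snd_block e1 i))) * z (fun i => u (snd_block e2 i)).
transitivity ((p`!%:R * q`!%:R)^-1 / r`!%:R * altsum F v).
  have fi := @fst_block_inj _ _ _ e2.
  rewrite (@eq_altsum _ _ _ _ (fun u => (p`!%:R * q`!%:R)^-1 *
      \sum_(h : 'S_pq) (-1) ^+ perm_ext fi h * F (fun i => u (perm_ext fi h i)))).
    by rewrite altsumZ altsum_absorb card_Sn !invfM; field; rewrite !fact_neq0.
  move=> s; rewrite wedgeE -mulrA mulr_suml; congr (_ * _).
  apply: eq_bigr => h _; rewrite odd_perm_ext /F !mulrA; congr (_ * x _ * y _ * z _);
    apply/funext => i; rewrite ?perm_ext_in// perm_ext_out// => j.
  exact: fst_snd_block.
have fi := @snd_block_inj _ _ _ e4.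
rewrite [in RHS](@eq_altsum _ _ _ _ (fun u => (q`!%:R * r`!%:R)^-1 *
    \sum_(h : 'S_qr) (-1) ^+ perm_ext fi h * F (fun i => u (perm_ext fi h i)))).
  by rewrite altsumZ altsum_absorb card_Sn !invfM; field; rewrite !fact_neq0.
move=> s; rewrite wedgeE mulrCA mulr_sumr; congr (_ * _).
apply: eq_bigr => h _; rewrite odd_perm_ext /F mulrCA !mulrA; congr (_ * x _ * y _ * z _);
  apply/funext => i; congr (v (s _)).
- rewrite (_ : fst_block e2 _ = fst_block e4 i) ?perm_ext_out//; last exact/val_inj.
  by move=> j; exact: snd_fst_block.
- rewrite (_ : fst_block e2 _ = snd_block e4 (fst_block e3 i)) ?perm_ext_in//.
  exact/val_inj.
- rewrite (_ : snd_block e2 _ = snd_block e4 (snd_block e3 i)) ?perm_ext_in//.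
  by apply/val_inj => /=; lia.
Qed.

End Wedge.

(** * Exterior derivatives over an algebra with commuting derivations *)

Section AltSumSign.
Variables (R : realType) (E : lmodType R).

(** An odd symmetry of [F] makes its antisymmetrization equal to its own opposite. It is applied to
    the transposition of the two slots of a symmetric second derivative. *)
Lemma altsum_invariant0 n (F : ('I_n -> E) -> R) v (t : 'S_n) : odd_perm t ->
  (forall u, F (fun i => u (t i)) = F u) -> altsum F v = 0.
Proof.
move=> ot Ft; have : altsum (fun u => F (fun i => u (t i))) v = altsum F v.
  by apply: eq_altsum => s; exact: (Ft (fun i => v (s i))).
by rewrite altsum_perm_arg ot expr1 mulN1r => /eqP; rewrite eqNr => /eqP.
Qed.

(** A permutation of n + 1 indices amounts to the image i of 0 and a permutation of the others;
    surjectivity follows from injectivity by counting. *)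
Lemma sum_lift_perm n (F : 'S_n.+1 -> R) :
  \sum_s F s = \sum_(i < n.+1) \sum_(t : 'S_n) F (lift_perm ord0 i t).
Proof.
rewrite pair_big/=.
pose h (it : 'I_n.+1 * 'S_n) : 'S_n.+1 := lift_perm ord0 it.1 it.2.
have h_inj : injective h.
  move=> [i t] [j t']; rewrite /h/= => ht.
  have ij : i = j by rewrite -(lift_perm_id ord0 i t) ht lift_perm_id.
  subst j; congr pair; apply/permP => l; apply: (@lift_inj _ i).
  by rewrite -!(lift_perm_lift ord0) ht.
rewrite (reindex h)//=; apply: onW_bij; apply: inj_card_bij => //.
by rewrite card_prod !card_Sn card_ord factS.
Qed.

(** All n! permutations that send 0 to i contribute the same term, because the antisymmetry of [A]
    cancels the sign of the remaining permutation. This writes the exterior derivative as an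
    antisymmetrization. *)
Lemma alternating_sum_altsum n (A : E -> ('I_n -> E) -> R) (v : 'I_n.+1 -> E) :
  (forall e u (t : 'S_n), A e (fun i => u (t i)) = (-1) ^+ t * A e u) ->
  \sum_(i < n.+1) (-1) ^+ i * A (v i) (fun j => v (lift i j)) =
  n`!%:R^-1 * altsum (fun u => A (u ord0) (fun j => u (lift ord0 j))) v.
Proof.
move=> At; rewrite /altsum sum_lift_perm mulr_sumr; apply: eq_bigr => i _.
have At' t : (-1) ^+ lift_perm ord0 i t * A (v (lift_perm ord0 i t ord0))
    (fun j => v (lift_perm ord0 i t (lift ord0 j))) =
    (-1) ^+ i * A (v i) (fun j => v (lift i j)).
  rewrite lift_perm_id (_ : (fun j => v (lift_perm _ _ _ _)) =
    (fun j => (fun l => v (lift i l)) (t j))); last first.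
    by apply/funext => j; rewrite lift_perm_lift.
  rewrite (At (v i) (fun l => v (lift i l)) t) odd_lift_perm /= signr_addb signr_odd.
  by rewrite -mulrA; congr (_ * _); rewrite mulrA sgn_sqr mul1r.
under eq_bigr do rewrite At'.
by rewrite sumr_const card_Sn -[(_ * _) *+ _]mulr_natl mulKf// fact_neq0.
Qed.

End AltSumSign.

(** The common features of smooth functions on an open subset of a simplex and on
    an open subset of a normed space: [P] is the open subset, [good] are the functions
    smooth on it, and nothing is required of derivatives outside [P]. *)
Record is_calculus (R : realType) (E : lmodType R) (X : Type) (P : X -> Prop)
    (good : (X -> R) -> Prop) (D : E -> (X -> R^o) -> X -> R^o) : Prop := IsCalculus {
  good_lin : forall a f g, good f -> good g -> good (fun x => a * f x + g x);
  good_mul : forall f g, good f -> good g -> good (fun x => f x * g x);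
  good_cst : forall a, good (fun=> a);
  good_der : forall v f, good f -> good (D v f);
  good_eq : forall f g, good f -> (forall x, P x -> f x = g x) -> good g;
  der_eq : forall v f g x, good f -> (forall y, P y -> f y = g y) -> P x ->
    D v f x = D v g x;
  der_lin : forall v a f g x, good f -> good g -> P x ->
    D v (fun y => a * f y + g y) x = a * D v f x + D v g x;
  der_mul : forall v f g x, good f -> good g -> P x ->
    D v (fun y => f y * g y) x = D v f x * g x + f x * D v g x;
  der_vec : forall a u v f x, good f -> P x ->
    D (a *: u + v) f x = a * D u f x + D v f x;
  der_comm : forall u v f x, good f -> P x -> D u (D v f) x = D v (D u f) x }.

Section Calculus.
Variables (R : realType) (E : lmodType R) (X : Type) (P : X -> Prop).
Variables (good : (X -> R) -> Prop) (D : E -> (X -> R^o) -> X -> R^o).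
Hypothesis C : is_calculus P good D.
Local Notation aform := (aform E).

Lemma good_add f g : good f -> good g -> good (fun x => f x + g x).
Proof.
move=> gf gg; apply: (good_eq C (good_lin C 1 gf gg)) => x _.
by rewrite mul1r.
Qed.

Lemma good_scale a f : good f -> good (fun x => a * f x).
Proof. by move=> gf; apply: (good_mul C) => //; exact: (good_cst C). Qed.

Lemma good_sum (I : Type) (r : seq I) (f : I -> X -> R) :
  (forall i, good (f i)) -> good (fun x => \sum_(i <- r) f i x).
Proof.
move=> gf; elim: r => [|i r IH].
  by apply: (good_eq C (good_cst C 0)) => x _; rewrite big_nil.
by apply: (good_eq C (good_add (gf i) IH)) => x _; rewrite big_cons.
Qed.

Lemma der_add v f g x : good f -> good g -> P x ->
  D v (fun y => f y + g y) x = D v f x + D v g x.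
Proof.
move=> gf gg Px; rewrite -[D v f x]mul1r -(der_lin C)//.
apply: (der_eq C) => //; first exact: good_add.
by move=> y _; rewrite mul1r.
Qed.

Lemma der_cst v a x : P x -> D v (fun=> a) x = 0.
Proof.
move=> Px; have g0 := good_cst C 0; have g1 := good_cst C 1.
have D0 : D v (fun=> 0) x = 0.
  transitivity (D v (fun=> -1 * 0 + 0) x).
    by congr (D v _ x); apply/funext => y; rewrite mulr0 addr0.
  by rewrite (der_lin C)// mulN1r addNr.
have D1 : D v (fun=> 1) x = 0.
  have : D v (fun=> 1) x = D v (fun=> 1 * 1) x.
    by congr (D v _ x); apply/funext => y; rewrite mulr1.
  rewrite (der_mul C)// mul1r mulr1 => /eqP.
  by rewrite -subr_eq subrr eq_sym => /eqP.
transitivity (D v (fun=> a * 1 + 0) x).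
  by congr (D v _ x); apply/funext => y; rewrite mulr1 addr0.
by rewrite (der_lin C)// D0 D1 mulr0 addr0.
Qed.

Lemma der_scale v a f x : good f -> P x -> D v (fun y => a * f y) x = a * D v f x.
Proof.
move=> gf Px; rewrite (der_mul C)//; last exact: (good_cst C).
by rewrite der_cst// mul0r add0r.
Qed.

Lemma der_sum v (I : Type) (r : seq I) (f : I -> X -> R) x :
  (forall i, good (f i)) -> P x ->
  D v (fun y => \sum_(i <- r) f i y) x = \sum_(i <- r) D v (f i) x.
Proof.
move=> gf Px; elim: r => [|i r IH].
  rewrite big_nil -[RHS](der_cst v 0 Px); congr (D v _ x).
  by apply/funext => y; rewrite big_nil.
rewrite big_cons -IH -der_add//; last exact: good_sum.
by congr (D v _ x); apply/funext => y; rewrite big_cons.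
Qed.

Definition good_form p (w : X -> aform p) :=
  (forall x, P x -> alternating (w x)) /\ (forall v, good (fun x => w x v)).

(** The single summand in which the first vector differentiates; its antisymmetrization is p! times
    the exterior derivative. *)
Definition ext_dif_term p (w : X -> aform p) (x : X) (u : 'I_p.+1 -> E) : R :=
  D (u ord0) (fun y => w y (fun j => u (lift ord0 j))) x.

Lemma ext_dif_altsum p (w : X -> aform p) x v : P x -> good_form w ->
  ext_dif D w x v = p`!%:R^-1 * altsum (ext_dif_term w x) v.
Proof.
move=> Px [aw gw].
apply: (@alternating_sum_altsum R E p (fun e u => D e (fun y => w y u) x)) => e u t.
rewrite -der_scale//; apply: (der_eq C) => // y Py.
exact: alternating_perm (aw y Py).
Qed.

Lemma ext_dif_term_multilinear p (w : X -> aform p) x : P x -> good_form w ->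
  multilinear (ext_dif_term w x).
Proof.
move=> Px [aw gw] v i c u u'; rewrite /ext_dif_term.
case: (unliftP ord0 i) => [j|] ->.
- rewrite !(upd_block (@lift_inj _ ord0)) /=.
  rewrite -(der_lin C)//; apply: (der_eq C) => // y Py.
  by case: (aw y Py) => + _; apply.
- have n0 l : lift ord0 l != ord0 :> 'I_p.+1 by rewrite eq_sym neq_lift.
  by rewrite !(upd_other_block _ _ n0) /= (der_vec C).
Qed.

Lemma good_form_dif p (w : X -> aform p) : good_form w -> good_form (ext_dif D w).
Proof.
move=> gfw; split=> [x Px|v].
- rewrite (_ : ext_dif D w x = (fun v => p`!%:R^-1 * altsum (ext_dif_term w x) v)).
    exact/alternatingZ/(altsum_alternating (ext_dif_term_multilinear Px gfw)).
  by apply/funext => v; exact: ext_dif_altsum.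
- case: gfw => aw gw; apply: good_sum => i; apply: good_scale.
  exact: (good_der C).
Qed.

Lemma good_form_wedge p q r (e : (p + q = r)%N) (a : X -> aform p) (b : X -> aform q) :
  good_form a -> good_form b -> good_form (fun x => wedge e (a x) (b x)).
Proof.
move=> [aa ga] [ab gb]; split=> [x Px|v].
  by apply: wedge_alternating; [exact: aa|exact: ab].
apply: good_scale; apply: good_sum => s; apply: good_scale.
by apply: (good_mul C); [exact: ga|exact: gb].
Qed.

Lemma ext_dif_eq p (w w' : X -> aform p) x v : (forall v, good (fun x => w x v)) ->
  (forall y, P y -> w y = w' y) -> P x -> ext_dif D w x v = ext_dif D w' x v.
Proof.
move=> gw ww' Px; apply: eq_bigr => i _; congr (_ * _).
by apply: (der_eq C) => // y Py; rewrite ww'.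
Qed.

Lemma ext_dif_lin p c (a b : X -> aform p) x : P x -> good_form a -> good_form b ->
  ext_dif D (fun y => c *: a y + b y) x = c *: ext_dif D a x + ext_dif D b x.
Proof.
move=> Px [_ ga] [_ gb]; apply/funext => v.
change (ext_dif D (fun y => c *: a y + b y) x v = c * ext_dif D a x v + ext_dif D b x v).
rewrite /ext_dif mulr_sumr -big_split/=; apply: eq_bigr => i _.
by rewrite (der_lin C)// mulrDr mulrCA.
Qed.

(** * The Leibniz rule for the exterior derivative *)

Section Leibniz.
Variables (p q r : nat) (e : (p + q = r)%N).
Variables (a : X -> aform p) (b : X -> aform q) (x : X).
Hypotheses (Px : P x) (ga : good_form a) (gb : good_form b).

(** With [leibniz_right], the two halves of the product rule before antisymmetrization; slot 0 holds
    the direction of differentiation. *)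
Definition leibniz_left (u : 'I_r.+1 -> E) : R :=
  D (u ord0) (fun y => a y (fun i => u (lift ord0 (fst_block e i)))) x *
  b x (fun j => u (lift ord0 (snd_block e j))).

Definition leibniz_right (u : 'I_r.+1 -> E) : R :=
  a x (fun i => u (lift ord0 (fst_block e i))) *
  D (u ord0) (fun y => b y (fun j => u (lift ord0 (snd_block e j)))) x.

(** The derivative of [a] antisymmetrizes over the first p + 1 slots. Absorbing this gives (p + 1)!,
    which replaces the normalization 1/((p + 1)! q!) and the factor 1/p! of the derivative by 1/(p!
    q!). *)
Lemma wedge_dif_left (e1 : (p.+1 + q = r.+1)%N) v :
  wedge e1 (ext_dif D a x) (b x) v = (p`!%:R * q`!%:R)^-1 * altsum leibniz_left v.
Proof.
have fi := @fst_block_inj _ _ _ e1.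
rewrite wedgeE (@eq_altsum _ _ _ _ (fun u => p`!%:R^-1 *
    \sum_(h : 'S_p.+1) (-1) ^+ perm_ext fi h *
      leibniz_left (fun i => u (perm_ext fi h i)))).
  rewrite altsumZ altsum_absorb card_Sn.
  by field; rewrite !fact_neq0.
move=> s; rewrite ext_dif_altsum// -mulrA mulr_suml; congr (_ * _).
apply: eq_bigr => h _; rewrite odd_perm_ext -mulrA; congr (_ * _).
have f0 : ord0 = fst_block e1 ord0 by exact/val_inj.
have fl i : lift ord0 (fst_block e i) = fst_block e1 (lift ord0 i) by exact/val_inj.
have sl i : lift ord0 (snd_block e i) = snd_block e1 i.
  by apply/val_inj; rewrite /= /bump/= addSn.
rewrite /ext_dif_term /leibniz_left; congr (_ * _).
  congr (D _ _ x); first by rewrite [in RHS]f0 perm_ext_in.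
  by apply/funext => y; congr (a y _); apply/funext => i; rewrite fl perm_ext_in.
congr (b x _); apply/funext => j; rewrite sl perm_ext_out// => i.
exact: fst_snd_block.
Qed.

(** The wedge antisymmetrizes over all slots but slot 0; absorbing this gives r!, which cancels the
    1/r! of the derivative, and the product rule splits what is left. *)
Lemma ext_dif_wedge v :
  ext_dif D (fun y => wedge e (a y) (b y)) x v =
  (p`!%:R * q`!%:R)^-1 * (altsum leibniz_left v + altsum leibniz_right v).
Proof.
have [[aa ga'] [ab gb']] := (ga, gb).
rewrite ext_dif_altsum//; last exact: good_form_wedge.
have li := @lift_inj _ (ord0 : 'I_r.+1).
rewrite (@eq_altsum _ _ _ _ (fun u => (p`!%:R * q`!%:R)^-1 *
    \sum_(h : 'S_r) (-1) ^+ perm_ext li h *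
      (leibniz_left (fun i => u (perm_ext li h i)) +
       leibniz_right (fun i => u (perm_ext li h i))))).
  rewrite altsumZ (@altsum_absorb _ _ _ _ _ (fun u => leibniz_left u + leibniz_right u)).
  by rewrite card_Sn altsumD; field; rewrite !fact_neq0.
move=> s; rewrite /ext_dif_term /wedge der_scale//; last first.
  apply: good_sum => h; apply: good_scale; exact: (good_mul C).
congr (_ * _); rewrite der_sum//; last first.
  by move=> h; apply: good_scale; exact: (good_mul C).
apply: eq_bigr => h _; rewrite der_scale//; last exact: (good_mul C).
rewrite odd_perm_ext; congr (_ * _); rewrite (der_mul C)//.
have h0 : perm_ext li h ord0 = ord0.
  by rewrite perm_ext_out// => i; rewrite eq_sym neq_lift.
rewrite /leibniz_left /leibniz_right h0; congr (_ * _ + _ * _).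
- congr (D _ _ x); apply/funext => y; congr (a y _).
  by apply/funext => i; rewrite perm_ext_in.
- by congr (b x _); apply/funext => i; rewrite perm_ext_in.
- by congr (a x _); apply/funext => i; rewrite perm_ext_in.
- congr (D _ _ x); apply/funext => y; congr (b y _).
  by apply/funext => i; rewrite perm_ext_in.
Qed.

End Leibniz.

(** The exchange of blocks, extended to fix slot 0, turns a derivative of the second factor into one
    of the first. *)
Lemma altsum_leibniz_right p q r (e : (p + q = r)%N) (e' : (q + p = r)%N)
    (a : X -> aform p) (b : X -> aform q) x v :
  altsum (leibniz_right e a b x) v = (-1) ^+ (p * q) * altsum (leibniz_left e' b a x) v.
Proof.
have li := @lift_inj _ (ord0 : 'I_r.+1).
have -> : (-1) ^+ (p * q) = (-1) ^+ perm_ext li (bswap e') :> R.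
  by rewrite odd_perm_ext odd_bswap signr_odd mulnC.
rewrite -altsum_perm_arg; apply: eq_altsum => s.
have h0 : perm_ext li (bswap e') ord0 = ord0.
  by rewrite perm_ext_out// => i; rewrite eq_sym neq_lift.
rewrite /leibniz_left /leibniz_right h0 mulrC; congr (_ * _).
- congr (D _ _ x); apply/funext => y; congr (b y _).
  apply/funext => i; rewrite perm_ext_in; congr (v (s (lift _ _))); apply/val_inj.
  by rewrite /= bswapE/= ltn_ord addnC.
- congr (a x _); apply/funext => i; rewrite perm_ext_in; congr (v (s (lift _ _))).
  by apply/val_inj; rewrite /= bswapE/= addKn ltnNge leq_addr.
Qed.

Lemma ext_dif_leibniz p q r (e : (p + q = r)%N) (e1 : (p.+1 + q = r.+1)%N)
    (e2 : (p + q.+1 = r.+1)%N) (a : X -> aform p) (b : X -> aform q) x :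
  P x -> good_form a -> good_form b ->
  ext_dif D (fun y => wedge e (a y) (b y)) x =
  wedge e1 (ext_dif D a x) (b x) + (-1) ^+ p *: wedge e2 (a x) (ext_dif D b x).
Proof.
move=> Px ga gb; apply/funext => v.
have e' : (q + p = r)%N by rewrite addnC.
have e1' : (q.+1 + p = r.+1)%N by rewrite addSn e'.
(* With the derivative of [b] in front, both terms fall under [wedge_dif_left]; the accumulated
   exponent p + p (q + 1) has the parity of p q. *)
rewrite (wedgeC e2 e1').
change (ext_dif D (fun y => wedge e (a y) (b y)) x v =
  wedge e1 (ext_dif D a x) (b x) v +
  (-1) ^+ p * ((-1) ^+ (p * q.+1) * wedge e1' (ext_dif D b x) (a x) v)).
rewrite ext_dif_wedge// (wedge_dif_left e)// (wedge_dif_left e')//.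
rewrite (altsum_leibniz_right e e') mulrDr; congr (_ + _).
rewrite [q`!%:R * _]mulrC !mulrA -exprD; congr (_ * _).
by rewrite [RHS]mulrC; congr (_ * _); apply: sign_odd_eq; parity.
Qed.

(** The inner derivative antisymmetrizes over all slots but slot 0, which the outer one absorbs; the
    remaining second derivative [F] is symmetric in its first two slots. *)
Lemma ext_dif_dif p (w : X -> aform p) x : P x -> good_form w ->
  ext_dif D (ext_dif D w) x = 0.
Proof.
move=> Px gfw; have [aw gw] := gfw; apply/funext => v.
rewrite ext_dif_altsum//; last exact: good_form_dif.
have li := @lift_inj _ (ord0 : 'I_p.+2).
pose F (u : 'I_p.+2 -> E) : R :=
  D (u ord0) (D (u (lift ord0 ord0)) (fun y => w y (fun j => u (lift ord0 (lift ord0 j))))) x.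
rewrite (@eq_altsum _ _ _ _ (fun u => p`!%:R^-1 *
    \sum_(h : 'S_p.+1) (-1) ^+ perm_ext li h * F (fun i => u (perm_ext li h i)))).
  rewrite altsumZ altsum_absorb.
  rewrite (@altsum_invariant0 _ _ _ F v (tperm ord0 (lift ord0 ord0))) ?mulr0//.
    by rewrite odd_tperm neq_lift.
  move=> u; rewrite /F tpermL tpermR (der_comm C)//; congr (D _ (D _ _) x).
  apply/funext => y; congr (w y _); apply/funext => j.
  by rewrite tpermD// neq_lift// (inj_eq li) neq_lift.
move=> s; rewrite /ext_dif_term.
rewrite (@der_eq _ _ _ _ _ _ C _ _ (fun y => p`!%:R^-1 * \sum_(h : 'S_p.+1)
    (-1) ^+ h * ext_dif_term w y (fun i => v (s (lift ord0 (h i)))))) //.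
- rewrite der_scale//; last first.
    by apply: good_sum => h; apply: good_scale; exact: (good_der C).
  congr (_ * _); rewrite der_sum//; last first.
    by move=> h; apply: good_scale; exact: (good_der C).
  apply: eq_bigr => h _; rewrite der_scale//; last exact: (good_der C).
  rewrite odd_perm_ext; congr (_ * _).
  have h0 : perm_ext li h ord0 = ord0.
    by rewrite perm_ext_out// => i; rewrite eq_sym neq_lift.
  rewrite /F h0 perm_ext_in; congr (D _ (D _ _) x); apply/funext => y; congr (w y _).
  by apply/funext => i; rewrite perm_ext_in.
- by case: (good_form_dif gfw) => _; apply.
- by move=> y Py; rewrite ext_dif_altsum.
Qed.

(** ** Pullbacks *)

Section Pullback.
Variables (m p : nat).
Local Notation V := 'rV[R]_m.

Lemma multilinear_expand n (F : ('I_n -> V) -> R) v i (z : V) : multilinear F ->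
  F [eta v with i |-> z] = \sum_l z 0 l * F [eta v with i |-> delta_mx 0 l].
Proof.
move=> mF; have lF : lin (fun z : V => F [eta v with i |-> z] : R^o) by exact: mF.
rewrite {1}[z]row_sum_delta.
exact: (etrans (lin_sum lF _ _ _) (eq_bigr _ (fun l _ => linZ lF _ _))).
Qed.

Variable W : X -> Defs.aform V p.
Hypotheses (mW : forall x, P x -> multilinear (W x)).
Hypotheses (gW : forall v, good (fun x => W x v)).
Variable u : X -> 'I_p -> V.
Hypothesis gu : forall i l, good (fun x => u x i 0 l).

(** [D] acts on scalar functions only, so a vector-valued map is differentiated by coordinates. *)
Definition der_row v (f : X -> V) x : V := \row_l D v (fun y => f y 0 l) x.

(* [mix k c w] takes its first [k] vectors from [w]; the function
   [x |-> W x (u x)] is differentiated by letting its arguments vary one by one. *)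
Let mix k (c w : 'I_p -> V) (i : 'I_p) : V := if (i < k)%N then w i else c i.

Let mix0 c w : mix 0 c w = c. Proof. by apply/funext. Qed.
Let mix_all c w : mix p c w = w.
Proof. by apply/funext => i; rewrite /mix ltn_ord. Qed.

Let mixS (k : 'I_p) c w : mix k.+1 c w = [eta mix k c w with k |-> w k].
Proof.
apply/funext => i; rewrite /mix /= ltnS leq_eqVlt -val_eqE/=.
by case: eqVneq => [/val_inj ->|].
Qed.

Let mix_upd (k : 'I_p) c w z :
  [eta mix k c w with k |-> z] = mix k [eta c with k |-> z] w :> ('I_p -> V).
Proof.
apply/funext => i; rewrite /mix /=; case: eqVneq => [->|//].
by rewrite ltnn.
Qed.

Let mix_expand (k : 'I_p) c w x : P x ->
  W x (mix k.+1 c w) = \sum_l w k 0 l * W x (mix k [eta c with k |-> delta_mx 0 l] w).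
Proof.
move=> Px; rewrite mixS multilinear_expand//; last exact: mW.
by apply: eq_bigr => l _; rewrite mix_upd.
Qed.

Let mix_good k c : (k <= p)%N -> good (fun x => W x (mix k c (u x))).
Proof.
elim: k c => [|k IH] c kp.
  by apply: (good_eq C (gW c)) => x _; rewrite mix0.
apply: (@good_eq _ _ _ _ _ _ C (fun x => \sum_l u x (Ordinal kp) 0 l *
    W x (mix k [eta c with Ordinal kp |-> delta_mx 0 l] (u x)))).
  by apply: good_sum => l; apply: (good_mul C) => //; exact/IH/ltnW.
by move=> x Px; rewrite (mix_expand (Ordinal kp)).
Qed.

(** Induction on the number k of varying arguments. The last one is expanded in the standard basis,
    which reduces to the product rule: derivatives of its coefficients give the new summand, and the
    induction hypothesis treats the rest. *)
Let mix_der k c v x : (k <= p)%N -> P x ->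
  D v (fun y => W y (mix k c (u y))) x =
  D v (fun y => W y (mix k c (u x))) x +
  \sum_(i < p | (i < k)%N)
    W x [eta mix k c (u x) with i |-> der_row v (u^~ i) x].
Proof.
move=> + Px; elim: k c => [|k IH] c kp.
  by rewrite big_pred0 ?addr0.
pose kk := Ordinal kp.
have ul l : good (fun y => u y kk 0 l) by [].
have gm l : good (fun y => W y (mix k [eta c with kk |-> delta_mx 0 l] (u y))).
  exact/mix_good/ltnW.
rewrite (@der_eq _ _ _ _ _ _ C _ _ (fun y => \sum_l u y kk 0 l *
    W y (mix k [eta c with kk |-> delta_mx 0 l] (u y))))//; first last.
- by move=> y Py; rewrite (mix_expand kk).
- exact: mix_good.
rewrite der_sum//; last by move=> l; exact: (good_mul C).
under eq_bigr do rewrite (der_mul C)// (IH _ (ltnW kp)) mulrDr.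
rewrite big_split/= big_split/= addrC -addrA; congr (_ + _).
  rewrite (@der_eq _ _ _ _ _ _ C _ (fun y => W y (mix k.+1 c (u x)))
    (fun y => \sum_l u x kk 0 l *
      W y (mix k [eta c with kk |-> delta_mx 0 l] (u x))))//; last first.
    by move=> y Py; rewrite (mix_expand kk).
  rewrite der_sum//; last by move=> l; exact: good_scale.
  by apply: eq_bigr => l _; rewrite der_scale.
rewrite (bigD1 kk)//= [RHS]addrC; congr (_ + _); last first.
  rewrite (_ : [eta mix k.+1 c (u x) with kk |-> der_row v (u^~ kk) x] =
      mix k.+1 c [eta u x with kk |-> der_row v (u^~ kk) x] :> ('I_p -> V)).
    rewrite (mix_expand kk)//; apply: eq_bigr => l _.
    rewrite /= eqxx mxE; congr (_ * W x _); apply/funext => i; rewrite /mix /=.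
    by case: eqVneq => [->|//]; rewrite ltnn.
  apply/funext => i; rewrite /mix /=; case: eqVneq => [->|//]; by rewrite /= ltnSn.
under eq_bigr do rewrite mulr_sumr.
rewrite exchange_big/= [RHS](eq_bigl (fun i : 'I_p => (i < k)%N)); last first.
  move=> i; rewrite ltnS leq_eqVlt -val_eqE/= andb_orl.
  case: eqVneq => /= [->|_]; rewrite ?ltnn ?andbT ?andbF//.
apply: eq_bigr => i ik.
have nik : i != kk by rewrite -val_eqE/= neq_ltn ik.
transitivity (W x (mix k.+1 c [eta u x with i |-> der_row v (u^~ i) x])).
  rewrite (mix_expand kk)//; apply: eq_bigr => l _ /=.
  rewrite eq_sym (negbTE nik); congr (_ * W x _); apply/funext => j; rewrite /mix /=.
  by case: (eqVneq j i) => [->|//]; rewrite ik.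
congr (W x _); apply/funext => j; rewrite /mix /=.
by case: (eqVneq j i) => [->|//]; rewrite ltnS ltnW.
Qed.

Lemma multilinear_good : good (fun x => W x (u x)).
Proof.
apply: (good_eq C (mix_good 0 (leqnn p))) => x _.
by rewrite mix_all.
Qed.

Lemma multilinear_der v x : P x ->
  D v (fun y => W y (u y)) x =
  D v (fun y => W y (u x)) x +
  \sum_i W x [eta u x with i |-> der_row v (u^~ i) x].
Proof.
move=> Px; have := mix_der 0 v (leqnn p) Px; rewrite mix_all.
rewrite (_ : (fun y => W y (mix p 0 (u y))) = (fun y => W y (u y))); last first.
  by apply/funext => y; rewrite mix_all.
by move=> ->; congr (_ + _); apply: eq_bigl => i; rewrite ltn_ord.
Qed.

End Pullback.

(** * Exterior derivative of a pullback *)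

Section PullbackDif.
Variables (m : nat) (phi : X -> 'rV[R]_m) (O : set 'rV[R]_m).
Hypothesis gphi : forall l, good (fun x => phi x 0 l).
Hypothesis phiO : forall x, P x -> O (phi x).
Hypothesis chain_good : forall f : 'rV[R]_m -> R^o, smooth_on O f -> good (f \o phi).
Hypothesis chain_der : forall (f : 'rV[R]_m -> R^o) v x, smooth_on O f -> P x ->
  D v (f \o phi) x = 'D_(der_row v phi x) f (phi x).

(** [der_row (v i) phi x] is the differential of [phi] at x applied to the i-th vector. *)
Definition pullback p (w : 'rV[R]_m -> Defs.aform 'rV[R]_m p) : X -> aform p :=
  fun x v => w (phi x) (fun i => der_row (v i) phi x).

Variables (p : nat) (w : 'rV[R]_m -> Defs.aform 'rV[R]_m p).
Hypotheses (aw : forall y, O y -> alternating (w y)).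
Hypotheses (sw : forall v, smooth_on O (fun y => w y v : R^o)).

Let gder v l : good (fun x => der_row v phi x 0 l).
Proof.
by apply: (good_eq C (good_der C v (gphi l))) => x _; rewrite mxE.
Qed.

Lemma der_row_vec x a u v : P x ->
  der_row (a *: u + v) phi x = a *: der_row u phi x + der_row v phi x.
Proof. by move=> Px; apply/rowP => l; rewrite !mxE (der_vec C). Qed.

Let mw x : P x -> multilinear (w (phi x)).
Proof. by move=> Px; case: (aw (phiO Px)). Qed.

Lemma good_form_pullback : good_form (pullback w).
Proof.
split=> [x Px|v]; last first.
  apply: (@multilinear_good _ _ (w \o phi)) => //=.
  by move=> e; exact: (chain_good (sw e)).
have [m' z'] := aw (phiO Px); split=> [v i c a b|v i j ij vij]; last first.
  by apply: (z' _ i j) => //; rewrite vij.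
have updE y : (fun j => der_row ([eta v with i |-> y] j) phi x) =
    [eta (fun j => der_row (v j) phi x) with i |-> der_row y phi x].
  by apply/funext => j /=; case: eqVneq.
by rewrite /pullback !updE der_row_vec// m'.
Qed.

Lemma ext_dif_pullback x v : P x ->
  ext_dif D (pullback w) x v =
  ext_dif (fun e (f : 'rV[R]_m -> R^o) => 'D_e f) w (phi x)
    (fun i => der_row (v i) phi x).
Proof.
move=> Px; rewrite /ext_dif.
(* The second derivatives [H] of [phi] are symmetric, hence disappear in the
   alternating sum. *)
pose H (e e' : E) := der_row e (der_row e' phi) x.
have HC e e' : H e e' = H e' e.
  apply/rowP => l; rewrite !mxE.
  have F e0 e1 : D e0 (fun y => der_row e1 phi y 0 l) x =
      D e0 (D e1 (fun y => phi y 0 l)) x.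
    by apply: (der_eq C) => // y _; rewrite mxE.
  by rewrite !F (der_comm C).
pose A (e : E) (u : 'I_p -> E) : R := \sum_j
  w (phi x) [eta (fun j => der_row (u j) phi x) with j |-> H e (u j)].
(* The product rule for a multilinear function: the first sum differentiates the coefficients of
   [w], by the chain rule, the second differentiates the vectors put into it. *)
have -> : \sum_(i < p.+1) (-1) ^+ i *
    D (v i) (fun y => pullback w y (fun j => v (lift i j))) x =
  \sum_(i < p.+1) (-1) ^+ i * 'D_(der_row (v i) phi x)
    (fun y => w y (fun j => der_row (v (lift i j)) phi x) : R^o) (phi x) +
  \sum_(i < p.+1) (-1) ^+ i * A (v i) (fun j => v (lift i j)).
  rewrite -big_split/=; apply: eq_bigr => i _; rewrite -mulrDr; congr (_ * _).
  rewrite /pullback (@multilinear_der _ _ (w \o phi) _ _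
    (fun y j => der_row (v (lift i j)) phi y))//=.
    by congr (_ + _); rewrite -(chain_der _ _ Px).
  by move=> e; exact: (chain_good (sw e)).
rewrite (@alternating_sum_altsum R E p A); last first.
  move=> e u t; rewrite /A mulr_sumr [RHS](reindex_inj (@perm_inj _ t))/=.
  apply: eq_bigr => j _.
  rewrite -(alternating_perm _ t (aw (phiO Px))); congr (w _ _); apply/funext => i /=.
  by rewrite (inj_eq perm_inj); case: eqVneq.
rewrite altsum_sum [X in _ + _ * X]big1 ?mulr0 ?addr0// => j _.
apply: (altsum_invariant0 _ (t := tperm ord0 (lift ord0 j))).
  by rewrite odd_tperm neq_lift.
move=> u; rewrite tpermL tpermR HC; congr (w _ _); apply/funext => i /=.
case: eqVneq => // ij; rewrite tpermD ?neq_lift//.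
by rewrite (inj_eq lift_inj) eq_sym.
Qed.

End PullbackDif.

End Calculus.

(** * Smooth functions *)

Section NearEq.
Variables (R : realType) (V W : normedModType R).

(** Differentiability depends on the germ only: the first-order expansion of [f] also serves for
    [g]. *)
Lemma near_eq_differentiable (f g : V -> W) x :
  (\forall y \near x, f y = g y) -> differentiable f x -> differentiable g x.
Proof.
move=> fg /diff_locallyP[cf ef].
have eg : g \o shift x = cst (g x) + 'd f x +o_ 0 id.
  apply/eqaddoP => eps eps0; have /eqaddoP/(_ eps eps0) := ef.
  have : \forall h \near (0 : V), f (h + x) = g (h + x).
    by rewrite (near_shift x 0)/=; apply: filterS fg => y; rewrite /= sub0r addrNK.
  apply: filterS2 => h fgh.
  rewrite [X in `|X| <= _](_ : _ = f (h + x) - (f x + 'd f x h))//.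
  rewrite [X in _ -> `|X| <= _](_ : _ = g (h + x) - (g x + 'd f x h))//.
  by rewrite fgh (nbhs_singleton fg).
have dg := diff_unique cf eg.
by apply/diff_locallyP; rewrite dg.
Qed.

End NearEq.

(** * Calculus of functions of class C^r *)

Section CnTheory.
Variables (R : realType).
Implicit Types V W : normedModType R.

Lemma Cn_eq V W r (U : set V) (f g : V -> W) : open U ->
  (forall x, U x -> f x = g x) -> Cn r U f -> Cn r U g.
Proof.
move=> oU; elim: r f g => [|r IH] f g fg /=.
  move=> cf x Ux; have nU : nbhs x U by exact: open_nbhs_nbhs.
  rewrite /prop_for /continuous_at -(fg x Ux); apply: cvg_trans (cf x Ux).
  by apply: near_eq_cvg; apply: filterS nU => y Uy; rewrite fg.
move=> [df Df]; split=> [x Ux|v].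
  apply: near_eq_differentiable (df x Ux).
  by apply: filterS (open_nbhs_nbhs (conj oU Ux)) => y; exact: fg.
apply: IH (Df v) => x Ux; apply: near_eq_derive.
by apply: filterS (open_nbhs_nbhs (conj oU Ux)) => y; exact: fg.
Qed.

Lemma smooth_on_eq V W (U : set V) (f g : V -> W) : open U ->
  (forall x, U x -> f x = g x) -> smooth_on U f -> smooth_on U g.
Proof. by move=> oU fg sf r; exact: Cn_eq (sf r). Qed.

Lemma Cn_sub V W r (U U' : set V) (f : V -> W) : U' `<=` U -> Cn r U f -> Cn r U' f.
Proof.
move=> UU; elim: r f => [|r IH] f /=; first by move=> cf x /UU; exact: cf.
by move=> [df Df]; split=> [x /UU|v]; [exact: df|exact: IH].
Qed.

Lemma smooth_on_sub V W (U U' : set V) (f : V -> W) :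
  U' `<=` U -> smooth_on U f -> smooth_on U' f.
Proof. by move=> UU sf r; exact: Cn_sub (sf r). Qed.

Lemma CnW V W r (U : set V) (f : V -> W) : Cn r.+1 U f -> Cn r U f.
Proof.
elim: r f => [|r IH] f [df Df].
  by move=> x Ux; exact/differentiable_continuous/df.
by split=> // v; apply: IH; exact: Df.
Qed.

Lemma smooth_differentiable V W (U : set V) (f : V -> W) x :
  smooth_on U f -> U x -> differentiable f x.
Proof. by move=> /(_ 1%N)[+ _]; apply. Qed.

Lemma smooth_derivable V W (U : set V) (f : V -> W) x v :
  smooth_on U f -> U x -> derivable f x v.
Proof. by move=> sf Ux; exact/diff_derivable/(smooth_differentiable sf). Qed.

Lemma smooth_continuous V W (U : set V) (f : V -> W) x :
  smooth_on U f -> U x -> {for x, continuous f}.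
Proof. by move=> /(_ 0%N); apply. Qed.

Lemma smooth_derive V W (U : set V) (f : V -> W) v :
  smooth_on U f -> smooth_on U ('D_v f).
Proof. by move=> sf r; case: (sf r.+1) => _; apply. Qed.

Lemma derive_linear V W (L : {linear V -> W}) v x : continuous L -> 'D_v L x = L v.
Proof.
move=> cL; rewrite deriveE; last exact: linear_differentiable.
by rewrite diff_lin.
Qed.

Lemma Cn_cst V W r (U : set V) (w : W) : Cn r U (cst w).
Proof.
elim: r w => [|r IH] w /=; first by move=> x _; exact: cvg_cst.
split=> [x _|v]; first exact: differentiable_cst.
rewrite (_ : 'D_v (cst w) = cst 0); first exact: IH.
by apply/funext => x; rewrite derive_cst.
Qed.

Lemma smooth_cst V W (U : set V) (w : W) : smooth_on U (cst w).
Proof. by move=> r; exact: Cn_cst. Qed.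

Lemma smooth_linear V W (U : set V) (L : {linear V -> W}) :
  continuous L -> smooth_on U L.
Proof.
move=> cL [|r] /=; first by move=> x _; exact: cL.
split=> [x _|v]; first exact: linear_differentiable.
rewrite (_ : 'D_v L = cst (L v)); first exact: Cn_cst.
by apply/funext => x; rewrite derive_linear.
Qed.

Lemma derive_comp V V' W (g : V -> V') (f : V' -> W) v x :
  differentiable g x -> differentiable f (g x) ->
  'D_v (f \o g) x = 'D_('D_v g x) f (g x).
Proof.
move=> dg df; rewrite !deriveE//; last exact: differentiable_comp.
by rewrite diff_comp.
Qed.

Lemma derive_vec V W (f : V -> W) a u v x : differentiable f x ->
  'D_(a *: u + v) f x = a *: 'D_u f x + 'D_v f x.
Proof. by move=> df; rewrite !deriveE// linearP. Qed.

Lemma Cn_post V W W' (L : {linear W -> W'}) r (U : set V) (f : V -> W) :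
  open U -> continuous L -> Cn r U f -> Cn r U (L \o f).
Proof.
move=> oU cL; elim: r f => [|r IH] f /=.
  by move=> cf x Ux; apply: continuous_comp; [exact: cf|exact: cL].
move=> [df Df]; split=> [x Ux|v].
  by apply: differentiable_comp; [exact: df|exact: linear_differentiable].
apply: Cn_eq (IH _ (Df v)) => // x Ux /=.
rewrite derive_comp ?derive_linear//; first exact: df.
exact: linear_differentiable.
Qed.

Lemma smooth_post V W W' (L : {linear W -> W'}) (U : set V) (f : V -> W) :
  open U -> continuous L -> smooth_on U f -> smooth_on U (L \o f).
Proof. by move=> oU cL sf r; exact: Cn_post. Qed.

Lemma derive_lin V W a (f g : V -> W) v x : derivable f x v -> derivable g x v ->
  'D_v (fun x => a *: f x + g x) x = a *: 'D_v f x + 'D_v g x.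
Proof.
move=> df dg; have daf : derivable (a \*: f) x v by exact: derivableZ.
by have := deriveD daf dg; rewrite deriveZ.
Qed.

Lemma Cn_lin V W r (U : set V) a (f g : V -> W) : open U ->
  Cn r U f -> Cn r U g -> Cn r U (fun x => a *: f x + g x).
Proof.
move=> oU; elim: r f g => [|r IH] f g /=.
  move=> cf cg x Ux; apply: cvgD; last exact: cg.
  by apply: cvgZl_tmp; exact: cf.
move=> [df Df] [dg Dg]; split=> [x Ux|v].
  by apply: differentiableD; [apply: differentiableZ; exact: df|exact: dg].
apply: Cn_eq (IH _ _ (Df v) (Dg v)) => // x Ux /=.
by rewrite derive_lin//; apply: diff_derivable; [exact: df|exact: dg].
Qed.

Lemma smooth_lin V W (U : set V) a (f g : V -> W) : open U ->
  smooth_on U f -> smooth_on U g -> smooth_on U (fun x => a *: f x + g x).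
Proof. by move=> oU sf sg r; exact: Cn_lin. Qed.

Lemma Cn_sum V W r (U : set V) n (f : 'I_n -> V -> W) : open U ->
  (forall i, Cn r U (f i)) -> Cn r U (fun x => \sum_i f i x).
Proof.
move=> oU cf.
suff : forall s : seq 'I_n, Cn r U (fun x => \sum_(i <- s) f i x) by exact.
elim=> [|i s IH].
  by apply: Cn_eq (@Cn_cst _ _ r U 0) => // x _; rewrite big_nil.
apply: Cn_eq (Cn_lin 1 oU (cf i) IH) => // x _.
by rewrite big_cons scale1r.
Qed.

Lemma derive_mul V (f g : V -> R^o) v x : derivable f x v -> derivable g x v ->
  'D_v (fun x => f x * g x : R^o) x = 'D_v f x * g x + f x * 'D_v g x.
Proof.
move=> df dg; have := deriveM df dg; rewrite -[f * g]/(fun x => f x * g x) => ->.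
by rewrite addrC; congr (_ + _); exact: mulrC.
Qed.

Lemma Cn_mul V r (U : set V) (f g : V -> R^o) : open U ->
  Cn r U f -> Cn r U g -> Cn r U (fun x => f x * g x : R^o).
Proof.
move=> oU; elim: r f g => [|r IH] f g.
  by move=> cf cg x Ux; apply: cvgM; [exact: cf|exact: cg].
move=> cf cg; have [[df Df] [dg Dg]] := (cf, cg).
split=> [x Ux|v]; first by apply: differentiableM; [exact: df|exact: dg].
apply: Cn_eq (Cn_lin 1 oU (IH _ _ (Df v) (CnW cg)) (IH _ _ (CnW cf) (Dg v))) => // x Ux /=.
rewrite scale1r derive_mul//; apply: diff_derivable; [exact: df|exact: dg].
Qed.

Lemma smooth_mul V (U : set V) (f g : V -> R^o) : open U ->
  smooth_on U f -> smooth_on U g -> smooth_on U (fun x => f x * g x : R^o).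
Proof. by move=> oU sf sg r; exact: Cn_mul. Qed.

Definition coord m (j : 'I_m) (x : 'rV[R]_m) : R^o := x 0 j.

Fact coord_linear m (j : 'I_m) : linear (coord j).
Proof. by move=> a x y; rewrite /coord !mxE. Qed.
HB.instance Definition _ m j :=
  GRing.isLinear.Build R 'rV[R]_m R^o _ (@coord m j) (@coord_linear m j).

Lemma coord_cont m (j : 'I_m) : continuous (coord j).
Proof. by move=> x; exact: coord_continuous. Qed.

Lemma smooth_coord V m (U : set V) (f : V -> 'rV[R]_m) j : open U ->
  smooth_on U f -> smooth_on U (fun x => f x 0 j : R^o).
Proof. by move=> oU; exact/(smooth_post (L := coord j) oU)/coord_cont. Qed.

Lemma derive_coord V m (f : V -> 'rV[R]_m) j v x : differentiable f x ->
  'D_v (fun y => f y 0 j : R^o) x = 'D_v f x 0 j.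
Proof.
move=> df; rewrite (_ : (fun y => _) = coord j \o f)//.
rewrite derive_comp//; last exact/linear_differentiable/coord_cont.
by rewrite derive_linear//; exact: coord_cont.
Qed.

Lemma derive_row V m (f : 'rV[R]_m -> R^o) (g : V -> 'rV[R]_m) v x :
  differentiable g x -> differentiable f (g x) ->
  'D_v (f \o g) x = \sum_j 'D_v (fun y => g y 0 j : R^o) x * 'D_(delta_mx 0 j) f (g x).
Proof.
move=> dg df; rewrite derive_comp// [X in 'D_X f _]row_sum_delta.
rewrite deriveE// linear_sum; apply: eq_bigr => j _.
by rewrite linearZ -deriveE// derive_coord.
Qed.

(** The chain rule differentiates [f] in a direction that varies with the point, out of reach of the
    induction. Expanded in coordinates, the derivative is a sum of products of derivatives of the
    coordinates of [g] with ['D_(delta_mx 0 j) f \o g], in fixed directions. *)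
Lemma Cn_comp V m r (U : set V) (O : set 'rV[R]_m) (g : V -> 'rV[R]_m)
    (f : 'rV[R]_m -> R^o) : open U -> (forall x, U x -> O (g x)) ->
  Cn r U g -> Cn r O f -> Cn r U (f \o g).
Proof.
move=> oU gO; elim: r f => [|r IH] f.
  by move=> cg cf x Ux; apply: continuous_comp; [exact: cg|exact/cf/gO].
move=> cg cf; have [[dg Dg] [df Df]] := (cg, cf); split=> [x Ux|v].
  by apply: differentiable_comp; [exact: dg|exact/df/gO].
have cs : Cn r U (fun x => \sum_j 'D_v (fun y => g y 0 j : R^o) x *
    ('D_(delta_mx 0 j) f \o g) x : R^o).
  apply: Cn_sum => // j; apply: Cn_mul => //; last exact: (IH _ (CnW cg) (Df _)).
  apply: Cn_eq (Cn_post (L := coord j) oU (@coord_cont _ j) (Dg v)) => // x Ux /=.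
  by rewrite derive_coord//; exact: dg.
apply: Cn_eq cs => // x Ux; rewrite derive_row//; first exact: dg.
exact/df/gO.
Qed.

Lemma smooth_comp V m (U : set V) (O : set 'rV[R]_m) (g : V -> 'rV[R]_m)
    (f : 'rV[R]_m -> R^o) : open U -> (forall x, U x -> O (g x)) ->
  smooth_on U g -> smooth_on O f -> smooth_on U (f \o g).
Proof. by move=> oU gO sg sf r; exact: (Cn_comp oU gO (sg r) (sf r)). Qed.

Definition axis m (j : 'I_m) (a : R^o) : 'rV[R]_m := a *: delta_mx 0 j.

Fact axis_linear m (j : 'I_m) : linear (axis j).
Proof. by move=> a x y; rewrite /axis scalerDl scalerA. Qed.
HB.instance Definition _ m j :=
  GRing.isLinear.Build R R^o 'rV[R]_m _ (@axis m j) (@axis_linear m j).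

Lemma axis_cont m (j : 'I_m) : continuous (axis j).
Proof. by move=> a; exact: scalel_continuous. Qed.

Lemma smooth_row V m (U : set V) (g : V -> 'rV[R]_m) : open U ->
  (forall j, smooth_on U (fun x => g x 0 j : R^o)) -> smooth_on U g.
Proof.
move=> oU sg r; apply: (@Cn_eq _ _ _ _ (fun x => \sum_j g x 0 j *: delta_mx 0 j)) => //.
  by move=> x _; rewrite [RHS]row_sum_delta.
apply: Cn_sum => // j.
exact: (Cn_post (L := axis j) oU (@axis_cont _ j) (sg j r)).
Qed.

Lemma smooth_comp_row V m n (U : set V) (O : set 'rV[R]_m) (g : V -> 'rV[R]_m)
    (f : 'rV[R]_m -> 'rV[R]_n) : open U -> open O -> (forall x, U x -> O (g x)) ->
  smooth_on U g -> smooth_on O f -> smooth_on U (f \o g).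
Proof.
move=> oU oO gO sg sf; apply: smooth_row => // j.
apply: (smooth_comp (f := fun y => f y 0 j) oU gO sg).
exact: smooth_coord.
Qed.

End CnTheory.

(** * Symmetry of second derivatives *)

Section Schwarz.
Variables (R : realType) (V : normedModType R).

Lemma is_derive_line (f : V -> R^o) (p u : V) s : differentiable f (p + s *: u) ->
  is_derive s (1 : R) (fun t : R => f (p + t *: u) : R^o) ('D_u f (p + s *: u)).
Proof.
move=> df; have dl : derivable f (p + s *: u) u by exact: diff_derivable.
have E : (fun h : R => h^-1 *: (((fun t : R => f (p + t *: u) : R^o) \o shift s) (h *: (1 : R)) -
      f (p + s *: u))) =
    (fun h : R => h^-1 *: ((f \o shift (p + s *: u)) (h *: u) - f (p + s *: u))).
  apply/funext => h /=; congr (_ *: (f _ - _)).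
  by rewrite [h *: 1]mulr1 scalerDl addrCA.
split; first by rewrite /derivable E.
by rewrite /derive E.
Qed.

Lemma line_increment (f : V -> R^o) (p u : V) (h : R) : 0 < h ->
  (forall s, 0 <= s <= h -> differentiable f (p + s *: u)) ->
  exists2 s, 0 <= s <= h & f (p + h *: u) - f p = h * 'D_u f (p + s *: u).
Proof.
move=> h0 df.
have [| |s] := @MVT R (fun t => f (p + t *: u)) (fun t => 'D_u f (p + t *: u)) 0 h h0.
- move=> s; rewrite in_itv/= => /andP[/ltW s0 /ltW sh].
  by apply: is_derive_line; apply: df; rewrite s0.
- apply: derivable_within_continuous => s; rewrite in_itv/= => sh.
  by have [] := is_derive_line (df s sh).
- rewrite in_itv/= => /andP[/ltW s0 /ltW sh]; rewrite scale0r addr0 subr0 => E.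
  by exists s; rewrite ?s0// E mulrC.
Qed.

(** The mean value theorem twice: along u for the difference [g] of two translates of [f], then
    along v for the derivative of [f] in direction u. *)
Lemma second_increment (f : V -> R^o) (U : set V) (x u v : V) (h : R) : open U ->
  smooth_on U f -> 0 < h ->
  (forall s t, 0 <= s <= h -> 0 <= t <= h -> U (x + s *: u + t *: v)) ->
  exists s t, [/\ 0 <= s <= h, 0 <= t <= h &
    f (x + h *: u + h *: v) - f (x + h *: u) - (f (x + h *: v) - f x) =
    h * (h * 'D_v ('D_u f) (x + s *: u + t *: v))].
Proof.
move=> oU sf h0 hU.
pose g (y : V) : R^o := f (y + h *: v) - f y.
have hh : 0 <= h <= h by rewrite (ltW h0)/=.
have zh : 0 <= (0 : R) <= h by rewrite (ltW h0) andbT.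
have dft s t : 0 <= s <= h -> 0 <= t <= h -> differentiable f (x + s *: u + t *: v).
  by move=> sh th; exact: (smooth_differentiable sf (hU s t sh th)).
have dtr y : differentiable (fun y => y + h *: v) y by exact: differentiableD.
have dsh s : 0 <= s <= h -> differentiable (fun y => f (y + h *: v)) (x + s *: u).
  move=> sh; apply: (@differentiable_comp _ _ _ _ (fun y => y + h *: v) f).
    exact: dtr.
  exact: dft.
have df0 s : 0 <= s <= h -> differentiable f (x + s *: u).
  by move=> sh; have := dft s 0 sh zh; rewrite scale0r addr0.
have [s sh E1] : exists2 s, 0 <= s <= h & g (x + h *: u) - g x = h * 'D_u g (x + s *: u).
  apply: (@line_increment g x u h h0) => s sh.
  by apply: differentiableB; [exact: dsh|exact: df0].
have [t th E2] : exists2 t, 0 <= t <= h &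
    'D_u f (x + s *: u + h *: v) - 'D_u f (x + s *: u) =
    h * 'D_v ('D_u f) (x + s *: u + t *: v).
  apply: (@line_increment ('D_u f) (x + s *: u) v h h0) => t th.
  exact: (smooth_differentiable (smooth_derive u sf) (hU s t sh th)).
have dg : 'D_u g (x + s *: u) =
    'D_u (fun y => f (y + h *: v) : R^o) (x + s *: u) - 'D_u f (x + s *: u).
  apply: (deriveB (f := fun y => f (y + h *: v) : R^o) (g := f)).
    exact/diff_derivable/dsh.
  exact/diff_derivable/df0.
have dtr' : 'D_u (fun y => y + h *: v) (x + s *: u) = u.
  rewrite (_ : (fun y => y + h *: v) = id + cst (h *: v))//.
  rewrite deriveD; [|exact: derivable_id|exact: derivable_cst].
  by rewrite derive_id derive_cst addr0.
have df1 := derive_comp u (dtr (x + s *: u)) (dft s h sh hh).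
rewrite dtr' in df1.
exists s, t; split => //; rewrite -E2 -df1.
by transitivity (g (x + h *: u) - g x); [|rewrite E1 dg].
Qed.

(* The second increment of [f] over a small parallelogram is [h ^+ 2] times a mixed
   derivative at a nearby point, for either order of differentiation. *)
Lemma derive_sym (f : V -> R^o) (U : set V) (x u v : V) : open U -> U x ->
  smooth_on U f -> 'D_u ('D_v f) x = 'D_v ('D_u f) x.
Proof.
move=> oU Ux sf; apply/eqP; rewrite -subr_eq0 -normr_le0; apply/ler_addgt0Pr => e e0.
rewrite add0r.
have e20 : 0 < e / 2 by rewrite divr_gt0.
have c1 := smooth_continuous (smooth_derive u (smooth_derive v sf)) Ux.
have c2 := smooth_continuous (smooth_derive v (smooth_derive u sf)) Ux.
have /cvgrPdist_lt/(_ _ e20) N1 := c1.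
have /cvgrPdist_lt/(_ _ e20) N2 := c2.
have N0 : nbhs x U by exact: open_nbhs_nbhs.
have /nbhs_ballP[d /= d0 dB] : nbhs x (U `&`
  ([set y | `|'D_u ('D_v f) x - 'D_u ('D_v f) y| < e / 2] `&`
   [set y | `|'D_v ('D_u f) x - 'D_v ('D_u f) y| < e / 2]) : set V).
  exact: filterI N0 (filterI N1 N2).
(* The summand 1 keeps c positive if u and v vanish; with h = d / (2 c) the parallelogram stays
   within distance d / 2 of x. *)
pose c := `|u| + `|v| + 1.
have c0 : 0 < c by rewrite /c ltr_pwDr// addr_ge0.
pose h := d / c / 2.
have h0 : 0 < h by rewrite !divr_gt0.
have hB s t : 0 <= s <= h -> 0 <= t <= h -> ball x d (x + s *: u + t *: v).
  move=> /andP[s0 sh] /andP[t0 th]; rewrite -ball_normE/= -addrA opprD addNKr normrN.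
  apply: (le_lt_trans (ler_normD _ _)); rewrite !normrZ !ger0_norm//.
  apply: (@le_lt_trans _ _ (h * c)).
    rewrite /c mulrDr mulrDr mulr1 -[leLHS]addr0; apply: lerD; last exact: ltW.
    by apply: lerD; exact: ler_wpM2r.
  by rewrite /h mulrAC divfK ?gt_eqF// gtr_pMr// invf_lt1 ?ltr1n.
have [s1 [t1 [s1h t1h E1]]] := second_increment oU sf h0 (fun s t sh th => (dB _ (hB s t sh th)).1).
have hB' s t : 0 <= s <= h -> 0 <= t <= h -> ball x d (x + s *: v + t *: u).
  by move=> sh th; rewrite addrAC; exact: hB.
have [s2 [t2 [s2h t2h E2]]] := second_increment oU sf h0 (fun s t sh th => (dB _ (hB' s t sh th)).1).
have [_ [_ +]] := dB _ (hB _ _ s1h t1h).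
have [_ [+ _]] := dB _ (hB' _ _ s2h t2h).
move: E1 E2; rewrite /=.
move: ('D_v ('D_u f) (x + s1 *: u + t1 *: v)) => A.
move: ('D_u ('D_v f) (x + s2 *: v + t2 *: u)) => B.
move: ('D_u ('D_v f) x) ('D_v ('D_u f) x) => B0 A0 E1 E2.
(* The second increment does not depend on the order of u and v, so the mixed derivatives agree,
   though at two different points. *)
have -> : A = B.
  have E : h * (h * A) = h * (h * B).
    apply: (etrans (esym E1)); apply: etrans E2; rewrite (addrAC x).
    move: (f _) (f _) (f _) (f _) => a1 a2 a3 a4.
    by rewrite !opprB addrACA [RHS]addrACA [- a2 - a3]addrC.
  by move: E => /(mulfI (lt0r_neq0 h0))/(mulfI (lt0r_neq0 h0)).
move=> L1 L2; rewrite -(subrKA B).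
apply: (le_trans (ler_normD _ _)); rewrite [e]splitr; apply: lerD; first exact: ltW.
by rewrite distrC ltW.
Qed.

End Schwarz.

(** * Smooth functions on the simplices *)

Section SimplexCalculus.
Variables (R : realType) (n : nat).
Implicit Types (W : normedModType R) (x y : simplex R n) (v : tangent R n).

Lemma simplex_ge0 x i : 0 <= bary x 0 i.
Proof. by case: x => x /= /andP[/forallP]. Qed.
Lemma simplex_sum x : \sum_i bary x 0 i = 1.
Proof. by case: x => x /= /andP[_ /eqP]. Qed.
Lemma tangent_sum v : \sum_i tvec v 0 i = 0.
Proof. by case: v => v /= /eqP. Qed.

Fact toward_vertex_subproof x i (h : R) : 0 <= h <= 1 ->
  [forall j, 0 <= (bary x + h *: (delta_mx 0 i - bary x)) 0 j] &&
  (\sum_j (bary x + h *: (delta_mx 0 i - bary x)) 0 j == 1).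
Proof.
move=> /andP[h0 h1]; apply/andP; split.
- apply/forallP => j; rewrite !mxE.
  rewrite (_ : _ + _ = (1 - h) * bary x 0 j + h * ((0 == 0 :> 'I_1) && (j == i))%:R);
    last by ring.
  apply: addr_ge0; apply: mulr_ge0 => //; last exact: simplex_ge0.
  by rewrite subr_ge0.
- apply/eqP; under eq_bigr do rewrite !mxE.
  rewrite big_split/= -mulr_sumr big_split/= sumrN simplex_sum.
  rewrite (bigD1 i)//= eqxx big1 ?addr0 ?subrr ?mulr0 ?addr0//.
  by move=> j /negbTE ->.
Qed.

(* The tangent space is spanned by the vectors from [x] to the vertices, and [F]
   vanishes along each of the corresponding segments. *)
Lemma derive_vanishing W (U : set 'rV[R]_n.+1) (F : 'rV[R]_n.+1 -> W) x v :
  open U -> U x -> differentiable F (bary x) -> (forall y, U y -> F y = 0) ->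
  'D_(tvec v) F (bary x) = 0.
Proof.
move=> oU Ux dF F0.
have D0 i : 'D_(delta_mx 0 i - bary x) F (bary x) = 0.
  set w := _ - _; have /cvg_ex[l /= cl] : derivable F (bary x) w by exact: diff_derivable.
  rewrite /derive (cvg_lim _ cl)//.
  (* The segment is known to stay in the simplex only for h >= 0, so the derivative is computed as a
     limit from the right. *)
  apply: (cvg_unique _ (cvg_dnbhs_at_right cl)) => //=.
  apply: (@cvg_trans _ ((fun=> 0 : W) @ 0^'+)); last exact: cvg_cst.
  apply: near_eq_cvg.
  have cw : (fun h : R => bary x + h *: w) h @[h --> (0 : R)] --> bary x + 0 *: w.
    by apply: cvgD; [exact: cvg_cst|exact: scalel_continuous].
  have nU : \forall h \near (0 : R)^'+, U (bary x + h *: w).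
    apply: cvg_at_right_filter cw _ _; apply: open_nbhs_nbhs.
    by rewrite scale0r addr0.
  near=> h.
  have h01 : 0 <= h <= 1.
    apply/andP; split; first exact: ltW.
    by near: h; exact: nbhs_right_le.
  have yU : U (bary x + h *: w) by near: h.
  have := F0 (Simplex (toward_vertex_subproof x i h01)) yU => /= Fy.
  by rewrite [h *: w + _]addrC Fy (F0 x Ux) subrr scaler0.
(* The coordinates of a tangent vector add up to 0, so the multiples of x cancel. *)
have -> : tvec v = \sum_i tvec v 0 i *: (delta_mx 0 i - bary x).
  under eq_bigr do rewrite scalerBr.
  by rewrite sumrB -scaler_suml tangent_sum scale0r subr0 -row_sum_delta.
rewrite deriveE// linear_sum big1// => i _.
by rewrite linearZ /= -(deriveE _ dF) D0 scaler0.
Unshelve. all: by end_near.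
Qed.

Lemma local_extension_derive W (g : simplex R n -> W) x v F G :
  local_extension g x F -> local_extension g x G ->
  'D_(tvec v) F (bary x) = 'D_(tvec v) G (bary x).
Proof.
move=> [U [oU Ux sF Fg]] [U' [oU' Ux' sG Gg]].
have dF := smooth_differentiable sF Ux; have dG := smooth_differentiable sG Ux'.
apply/eqP; rewrite -subr_eq0; apply/eqP.
rewrite -deriveB; [|exact: diff_derivable|exact: diff_derivable].
apply: (@derive_vanishing _ (U `&` U')) => //.
- exact: openI.
- exact: differentiableB.
- by move=> y [Uy Uy']; rewrite -[LHS]/(F y - G y) Fg// Gg// subrr.
Qed.

(** Frees the derivative from the extension chosen by [xget]: any convenient extension computes
    it. *)
Lemma tderiveE W (g : simplex R n -> W) x v F :
  local_extension g x F -> tderive v g x = 'D_(tvec v) F (bary x).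
Proof.
move=> eF; apply: local_extension_derive => //; last exact: eF.
exact: (xgetI (fun=> 0) eF).
Qed.

Lemma local_extension_near W (g : simplex R n -> W) x F : local_extension g x F ->
  exists U, [/\ open U, U (bary x), smooth_on U F, forall y, U (bary y) -> F y = g y &
    forall y, U (bary y) -> local_extension g y F].
Proof.
move=> [U [oU Ux sF Fg]]; exists U; split => //.
by move=> y Uy; exists U.
Qed.

Lemma local_extension_der W (g : simplex R n -> W) x F v :
  local_extension g x F -> local_extension (tderive v g) x ('D_(tvec v) F).
Proof.
move=> eF; have [U [oU Ux sF Fg eU]] := local_extension_near eF.
exists U; split => //; first exact: smooth_derive.
by move=> y Uy; rewrite (tderiveE v (eU y Uy)).
Qed.

Lemma local_extension_eq W (g g' : simplex R n -> W) (O : set 'rV[R]_n.+1) x F :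
  open O -> O (bary x) -> (forall y, O (bary y) -> g y = g' y) ->
  local_extension g x F -> local_extension g' x F.
Proof.
move=> oO Ox gg' [U [oU Ux sF Fg]]; exists (U `&` O); split => //.
- exact: openI.
- by apply: smooth_on_sub sF => y [].
- by move=> y [Uy Oy]; rewrite Fg// gg'.
Qed.

Lemma local_extension2 W W' (g : simplex R n -> W) (g' : simplex R n -> W') x F F' :
  local_extension g x F -> local_extension g' x F' ->
  exists U, [/\ open U, U (bary x), smooth_on U F /\ smooth_on U F' &
    forall y, U (bary y) -> F y = g y /\ F' y = g' y].
Proof.
move=> [U [oU Ux sF Fg]] [U' [oU' Ux' sF' Fg']]; exists (U `&` U'); split => //.
- exact: openI.
- split; first by apply: smooth_on_sub sF => y [].
  by apply: smooth_on_sub sF' => y [].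
- by move=> y [Uy Uy']; rewrite Fg// Fg'.
Qed.

(** The open set [O] is the whole space for forms on a simplex, and cuts out the preimage of a chart
    domain for forms pulled back from a manifold. *)
Lemma simplex_calculus (O : set 'rV[R]_n.+1) : open O ->
  is_calculus (fun x => O (bary x))
    (fun g : simplex R n -> R => forall x, O (bary x) -> smooth_at (g : _ -> R^o) x)
    (@tderive R n R^o).
Proof.
move=> oO; split.
- move=> a f g gf gg x Ox; have [[F eF] [G eG]] := (gf x Ox, gg x Ox).
  have [U [oU Ux [sF sG] E]] := local_extension2 eF eG.
  exists (fun y : 'rV[R]_n.+1 => a *: F y + G y), U; split => //; first exact: smooth_lin.
  by move=> y /E[-> ->].
- move=> f g gf gg x Ox; have [[F eF] [G eG]] := (gf x Ox, gg x Ox).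
  have [U [oU Ux [sF sG] E]] := local_extension2 eF eG.
  exists (fun y : 'rV[R]_n.+1 => F y * G y), U; split => //; first exact: smooth_mul.
  by move=> y /E[-> ->].
- move=> a x Ox; exists (cst a), setT; split => //; first exact: openT.
  exact: smooth_cst.
- move=> v f gf x Ox; have [F eF] := gf x Ox.
  by exists ('D_(tvec v) F); exact: local_extension_der.
- move=> f g gf fg x Ox; have [F eF] := gf x Ox; exists F.
  exact: (local_extension_eq oO Ox fg eF).
- move=> v f g x gf fg Ox; have [F eF] := gf x Ox.
  by rewrite (tderiveE v eF) (tderiveE v (local_extension_eq oO Ox fg eF)).
- move=> v a f g x gf gg Ox; have [[F eF] [G eG]] := (gf x Ox, gg x Ox).
  have [U [oU Ux [sF sG] E]] := local_extension2 eF eG.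
  have eH : local_extension (fun y => a * f y + g y : R^o) x (fun y : 'rV[R]_n.+1 => a *: F y + G y).
    by exists U; split => //; [exact: smooth_lin|move=> y /E[-> ->]].
  rewrite (tderiveE v eF) (tderiveE v eG) (tderiveE v eH) derive_lin//.
    exact: smooth_derivable sF Ux.
  exact: smooth_derivable sG Ux.
- move=> v f g x gf gg Ox; have [[F eF] [G eG]] := (gf x Ox, gg x Ox).
  have [U [oU Ux [sF sG] E]] := local_extension2 eF eG.
  have eH : local_extension (fun y => f y * g y : R^o) x (fun y : 'rV[R]_n.+1 => F y * G y : R^o).
    by exists U; split => //; [exact: smooth_mul|move=> y /E[-> ->]].
  have [Fx Gx] := E x Ux.
  rewrite (tderiveE v eF) (tderiveE v eG) (tderiveE v eH) derive_mul ?Fx ?Gx//.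
    exact: smooth_derivable sF Ux.
  exact: smooth_derivable sG Ux.
- move=> a u v f x gf Ox; have [F eF] := gf x Ox.
  rewrite !(tderiveE _ eF); apply: derive_vec.
  by have [U [oU Ux sF _ _]] := local_extension_near eF; exact: smooth_differentiable sF Ux.
- move=> u v f x gf Ox; have [F eF] := gf x Ox.
  rewrite (tderiveE u (local_extension_der v eF)) (tderiveE v (local_extension_der u eF)).
  by have [U [oU Ux sF _ _]] := local_extension_near eF; exact: derive_sym sF.
Qed.

(** * Chain rules for maps defined on a simplex *)

Section Chain.
Variables (m : nat) (phi : simplex R n -> 'rV[R]_m).

Lemma smooth_at_coord x j : smooth_at phi x -> smooth_at (fun y => phi y 0 j : R^o) x.
Proof.
move=> [F [U [oU Ux sF Fg]]]; exists (fun y : 'rV[R]_n.+1 => F y 0 j), U; split => //.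
- exact: smooth_coord.
- by move=> y /Fg ->.
Qed.

Lemma tderive_row x v : smooth_at phi x ->
  der_row (@tderive R n R^o) v phi x = tderive v phi x.
Proof.
move=> [F eF]; have [U [oU Ux sF Fg _]] := local_extension_near eF.
apply/rowP => j; rewrite mxE (tderiveE v eF) -derive_coord; last first.
  exact: smooth_differentiable sF Ux.
apply: tderiveE; exists U; split => //; first exact: smooth_coord.
by move=> y /Fg ->.
Qed.

Lemma local_extension_comp_row k (O : set 'rV[R]_m) (f : 'rV[R]_m -> 'rV[R]_k) x F :
  local_extension phi x F -> open O -> O (phi x) -> smooth_on O f ->
  local_extension (f \o phi) x (f \o F).
Proof.
move=> eF oO Ox sf; have [U [oU Ux sF Fg _]] := local_extension_near eF.
have cF (z : 'rV[R]_n.+1) : U z -> {for z, continuous F} by exact: smooth_continuous.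
have oU' : open (U `&` F @^-1` O).
  rewrite openE => y [Uy Oy]; apply: filterI; first exact: open_nbhs_nbhs.
  by apply: (cF y Uy); exact: open_nbhs_nbhs.
exists (U `&` F @^-1` O); split => //.
- by split => //; rewrite /= Fg.
- apply: (smooth_comp_row oU' oO) sf; first by move=> y [].
  by apply: smooth_on_sub sF => y [].
- by move=> y [Uy _]; rewrite /= Fg.
Qed.

Lemma local_extension_comp (O : set 'rV[R]_m) (f : 'rV[R]_m -> R^o) x F :
  local_extension phi x F -> open O -> O (phi x) -> smooth_on O f ->
  local_extension (f \o phi) x (f \o F).
Proof.
move=> eF oO Ox sf; have [U [oU Ux sF Fg _]] := local_extension_near eF.
have cF (z : 'rV[R]_n.+1) : U z -> {for z, continuous F} by exact: smooth_continuous.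
have oU' : open (U `&` F @^-1` O).
  rewrite openE => y [Uy Oy]; apply: filterI; first exact: open_nbhs_nbhs.
  by apply: (cF y Uy); exact: open_nbhs_nbhs.
exists (U `&` F @^-1` O); split => //.
- by split => //; rewrite /= Fg.
- apply: (smooth_comp oU' _ _ sf); first by move=> y [].
  by apply: smooth_on_sub sF => y [].
- by move=> y [Uy _]; rewrite /= Fg.
Qed.

Lemma tderive_comp W (O : set 'rV[R]_m) (f : 'rV[R]_m -> W) x F v :
  local_extension phi x F -> O (phi x) -> smooth_on O f ->
  local_extension (f \o phi) x (f \o F) ->
  tderive v (f \o phi) x = 'D_(tderive v phi x) f (phi x).
Proof.
move=> eF Ox sf eC; have [U [oU Ux sF Fg _]] := local_extension_near eF.
rewrite (tderiveE v eF) (tderiveE v eC) derive_comp ?Fg//.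
- exact: smooth_differentiable sF Ux.
- exact: smooth_differentiable sf Ox.
Qed.

End Chain.

End SimplexCalculus.

(** * Derivatives along vertex maps *)

Section SimplexPush.
Variables (R : realType) (m n : nat) (f : 'I_m.+1 -> 'I_n.+1).

Lemma local_extension_push (W : normedModType R) (g : simplex R n -> W) x F :
  local_extension g (spush f x) F -> local_extension (g \o spush f) x (F \o push f).
Proof.
move=> [U [oU Ux sF Fg]]; exists (push f @^-1` U); split => //.
- by apply: open_comp => // y _; exact: push_continuous.
- exact: (smooth_on_linear (@push_continuous _ _ _ f) sF).
- by move=> y Uy; exact: (Fg (spush f y) Uy).
Qed.

Lemma tderive_push (W : normedModType R) (g : simplex R n -> W) x v :
  smooth_at g (spush f x) ->
  tderive v (g \o spush f) x = tderive (tpush f v) g (spush f x).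
Proof.
move=> [F eF]; rewrite (tderiveE _ eF) (tderiveE _ (local_extension_push eF)).
have [U [oU Ux sF _ _]] := local_extension_near eF.
have dp (y : 'rV[R]_m.+1) : differentiable (push f : 'rV[R]_m.+1 -> 'rV[R]_n.+1) y.
  exact/linear_differentiable/push_continuous.
rewrite (derive_comp _ (dp _) (smooth_differentiable sF Ux)).
by rewrite derive_linear//; exact: push_continuous.
Qed.

End SimplexPush.

Lemma open_calculus (R : realType) (V : normedModType R) (O : set V) : open O ->
  is_calculus O (fun g : V -> R => smooth_on O (g : V -> R^o))
    (fun v (f : V -> R^o) => 'D_v f).
Proof.
move=> oO; split.
- by move=> a f g sf sg; exact: smooth_lin.
- by move=> f g sf sg; exact: smooth_mul.
- by move=> a; exact: smooth_cst.
- by move=> v f; exact: smooth_derive.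
- by move=> f g sf fg; exact: smooth_on_eq sf.
- move=> v f g x sf fg Ox; apply: near_eq_derive.
  by apply: filterS (open_nbhs_nbhs (conj oO Ox)) => y; exact: fg.
- move=> v a f g x sf sg Ox; apply: derive_lin.
    exact: smooth_derivable sf Ox.
  exact: smooth_derivable sg Ox.
- move=> v f g x sf sg Ox; apply: derive_mul.
    exact: smooth_derivable sf Ox.
  exact: smooth_derivable sg Ox.
- move=> a u v f x sf Ox; apply: derive_vec; exact: smooth_differentiable sf Ox.
- by move=> u v f x sf Ox; exact: derive_sym sf.
Qed.

(** * Smooth forms on the simplices *)

Section ADRTheory.
Variable R : realType.

Section Level.
Variable n : nat.
Local Notation A := (ADR_lev R n).
Local Notation P := (fun x : simplex R n => setT (bary x)).
Local Notation good := (fun g : simplex R n -> R =>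
  forall x, P x -> smooth_at (g : _ -> R^o) x).

Let C : is_calculus P good (@tderive R n R^o) := simplex_calculus openT.

Lemma smooth_formP p (w : dR_form R n p) :
  smooth_form w <-> good_form P good w.
Proof.
split=> -[aw sw]; split.
- by move=> x _; exact: aw.
- by move=> v x _; exact: sw.
- by move=> x; exact: aw.
- by move=> v x; exact: sw.
Qed.

Lemma ADR_linear_mul :
  (forall p q r (e : (p + q = r)%N) (y : gcar A q),
     lin (fun x : gcar A p => gmul e x y)) /\
  (forall p q r (e : (p + q = r)%N) (x : gcar A p), lin (@gmul _ A p q r e x)).
Proof.
by split=> p q r e y a x x'; apply/funext => t; [exact: wedge_linl|exact: wedge_linr].
Qed.

Lemma alternating0 (E : lmodType R) (a : aform E 0) : alternating a.
Proof. by split=> v []. Qed.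

Lemma alternating_zero (E : lmodType R) p : alternating (0 : aform E p).
Proof.
split=> [v i c u w|//].
by change ((0 : R) = c * 0 + 0); rewrite mulr0 addr0.
Qed.

Lemma wedger1 (E : lmodType R) p (e : (p + 0 = p)%N) (a : aform E p) :
  alternating a -> wedge e a (fun=> 1) = a.
Proof.
by move=> aa; rewrite (wedgeC e (add0n p)) muln0 scale1r wedge1.
Qed.

Lemma smooth_form_lin p a (x y : dR_form R n p) :
  smooth_form x -> smooth_form y -> smooth_form (a *: x + y).
Proof.
move=> [ax sx] [ay sy]; split=> [t|v]; first exact: alternating_lin.
move=> z; exact: (@good_lin _ _ _ _ _ _ C a (fun t => x t v) (fun t => y t v)
  (fun t _ => sx v t) (fun t _ => sy v t) z I).
Qed.

Lemma ADR_is_dga : is_dga A.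
Proof.
have [l1 l2] := ADR_linear_mul.
split.
- split.
  + move=> p; split=> [x|v x]; first exact: alternating_zero.
    exact: (good_cst C 0 x I).
  + by move=> p a x y; exact: smooth_form_lin.
  + split=> [x|v x]; first exact: alternating0.
    exact: (good_cst C 1 x I).
  + move=> p q r e x y /smooth_formP sx /smooth_formP sy.
    by apply/smooth_formP; exact: (good_form_wedge C e sx sy).
- by split=> p q r e a x y z _ _ _; [exact: l1|exact: l2].
- split.
  + by move=> p e x [ax _]; apply/funext => t; exact: wedge1.
  + by move=> p e x [ax _]; apply/funext => t; exact: wedger1.
  + move=> p q r pq qr s e1 e2 e3 e4 x y z _ _ _; apply/funext => t.
    exact: wedgeA.
- split.
  + split=> [p x /smooth_formP sx|p a x y /smooth_formP sx /smooth_formP sy].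
      by apply/smooth_formP; exact: (good_form_dif C).
    by apply/funext => t; exact: (ext_dif_lin C).
  + by move=> p x /smooth_formP sx; apply/funext => t; exact: (ext_dif_dif C).
- move=> p q r e e1 e2 x y /smooth_formP sx /smooth_formP sy.
  by apply/funext => t; exact: (ext_dif_leibniz C).
Qed.

End Level.

(** * Pullback of smooth forms along vertex maps *)

Lemma tpush_comp l m n (f : 'I_l.+1 -> 'I_m.+1) (g : 'I_m.+1 -> 'I_n.+1)
    (v : tangent R l) : tpush g (tpush f v) = tpush (g \o f) v.
Proof.
apply/val_inj/rowP => j; rewrite /= !mxE (partition_big f (fun i => g i == j))//=.
apply: eq_bigr => i /eqP gij; rewrite mxE; apply: eq_bigl => h.
by rewrite andb_idl// => /eqP ->; apply/eqP.
Qed.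

Lemma tpush_id n (v : tangent R n) : tpush id v = v.
Proof. by apply/val_inj/rowP => j; rewrite /= mxE big_pred1_eq. Qed.

Lemma tpush_lin m n (f : 'I_m.+1 -> 'I_n.+1) a (u v : tangent R m) :
  tpush f (a *: u + v) = a *: tpush f u + tpush f v.
Proof. by apply/val_inj; rewrite /= linearP. Qed.

Lemma alternating_comp (E E' : lmodType R) p (L : E -> E') (a : aform E' p) :
  (forall c u v, L (c *: u + v) = c *: L u + L v) ->
  alternating a -> alternating (fun v => a (fun i => L (v i)) : R^o).
Proof.
move=> lL [m z]; split=> [v i c u w|v i j ij vij]; last first.
  by apply: (z _ i j) => //; rewrite vij.
have updE y : (fun j => L ([eta v with i |-> y] j)) =
    [eta (fun j => L (v j)) with i |-> L y].
  by apply/funext => j /=; case: eqVneq.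
by rewrite !updE lL m.
Qed.

Lemma dR_pull_comp l m n (f : 'I_l.+1 -> 'I_m.+1) (g : 'I_m.+1 -> 'I_n.+1) p
    (w : dR_form R n p) : dR_pull f (dR_pull g w) = dR_pull (g \o f) w.
Proof.
apply/funext => x; apply/funext => v; rewrite /dR_pull spush_comp; congr (w _ _).
by apply/funext => i; rewrite tpush_comp.
Qed.

Lemma dR_pull_id n (f : 'I_n.+1 -> 'I_n.+1) p (w : dR_form R n p) :
  f =1 id -> dR_pull f w = w.
Proof.
move=> /funext ->; apply/funext => x; apply/funext => v; rewrite /dR_pull spush_id.
by congr (w _ _); apply/funext => i; rewrite tpush_id.
Qed.

Lemma dR_pull_eq m n (f g : 'I_m.+1 -> 'I_n.+1) p (w : dR_form R n p) :
  f =1 g -> dR_pull f w = dR_pull g w.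
Proof. by move=> /funext ->. Qed.

Lemma smooth_form_pull m n (f : 'I_m.+1 -> 'I_n.+1) p (w : dR_form R n p) :
  smooth_form w -> smooth_form (dR_pull f w).
Proof.
move=> [aw sw]; split=> [x|v x].
  exact: (alternating_comp (tpush_lin f) (aw (spush f x))).
have [F eF] := sw (fun i => tpush f (v i)) (spush f x).
by exists (F \o push f); exact: local_extension_push eF.
Qed.

(** The vertex map is affine, so its action on tangent vectors is the same at all points and only
    the coefficients of the form get differentiated. *)
Lemma dR_pull_dif m n (f : 'I_m.+1 -> 'I_n.+1) p (w : dR_form R n p) :
  smooth_form w ->
  dR_pull f (ext_dif (@tderive R n R^o) w) = ext_dif (@tderive R m R^o) (dR_pull f w).
Proof.
move=> [aw sw]; apply/funext => x; apply/funext => v.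
rewrite /dR_pull /ext_dif; apply: eq_bigr => i _; congr (_ * _).
by rewrite -tderive_push.
Qed.

Lemma dR_pull_is_dga_map m n (f : 'I_m.+1 -> 'I_n.+1) :
  is_dga_map (A := ADR_lev R n) (B := ADR_lev R m) (fun p => dR_pull f (p := p)).
Proof.
split.
- by split=> // p x; exact: smooth_form_pull.
- by [].
- by move=> p q r e x y _ _; apply/funext => t; apply/funext => v.
- by move=> p x; exact: dR_pull_dif.
Qed.

Lemma ADR_is_involution n : is_involution (ADR_lev R n).
Proof.
have [[_ fm] f1 fM fd] := dR_pull_is_dga_map (@rev_ord n.+1).
split.
- by split=> // p x; exact: smooth_form_pull.
- by move=> p x; exact: fd.
- by move=> p x _; rewrite /= dR_pull_comp dR_pull_id// => i; exact: rev_ordK.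
- exact: f1.
- move=> p q r e e' x y mx my; rewrite [LHS]fM//.
  by apply/funext => t; exact: wedgeC.
Qed.

Lemma ADR_reflexive : is_reflexive_dga (ADR R).
Proof.
split.
- by move=> n; split; [exact: ADR_is_dga|exact: ADR_is_involution].
- by move=> n i; exact: dR_pull_is_dga_map.
- by move=> n i; exact: dR_pull_is_dga_map.
- move=> n i p x _; rewrite /= !dR_pull_comp; exact/dR_pull_eq/rev_coface.
- move=> n i p x _; rewrite /= !dR_pull_comp; exact/dR_pull_eq/rev_codegen.
Qed.

End ADRTheory.

(** * The de Rham algebra of a manifold *)

Section DeRhamTheory.
Variables (R : realType) (m : nat) (M : manifold R m).
Local Notation V := 'rV[R]_m.
Local Notation A := (deRham M).
Local Notation DV := (fun v (f : V -> R^o) => 'D_v f).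

Lemma chart_image_open (c : chart M) : open (chart_image c).
Proof. by apply: coord_open => //; exact: dom_open. Qed.

Lemma chart_imageP (c : chart M) x : chart_dom c x -> chart_image c (chart_coord c x).
Proof. by move=> cx; exists x. Qed.

Definition overlap (c c' : chart M) : set V :=
  chart_coord c @` (chart_dom c `&` chart_dom c').
Definition transition (c c' : chart M) : V -> V := chart_coord c' \o chart_inv c.

Lemma overlap_open c c' : open (overlap c c').
Proof. by apply: coord_open => [|x []//]; apply: openI; exact: dom_open. Qed.

Lemma transitionE c c' x : chart_dom c x -> transition c c' (chart_coord c x) = chart_coord c' x.
Proof. by move=> cx; rewrite /transition /= coordK. Qed.

Lemma transition_image c c' y : overlap c c' y -> chart_image c' (transition c c' y).
Proof. by move=> [x [cx cx'] <-]; rewrite transitionE//; exact: chart_imageP. Qed.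

Lemma overlap_image c c' y : overlap c c' y -> chart_image c y.
Proof. by move=> [x [cx _] <-]; exact: chart_imageP. Qed.

Section Forms.
Variables (p : nat) (w : local_forms M p).
Hypothesis gw : global_form w.

Lemma global_form_out c y : ~ chart_image c y -> w c y = 0.
Proof. by case: gw => + _ _ _ => h cy; apply/funext => v; exact: h. Qed.

Lemma global_form_alternating c y : chart_image c y -> alternating (w c y).
Proof. by case: gw => _ + _ _; apply. Qed.

Lemma global_form_good c :
  good_form (chart_image c) (fun g : V -> R => smooth_on (chart_image c) (g : V -> R^o)) (w c).
Proof.
split=> [y|v]; first exact: global_form_alternating.
by case: gw => _ _ + _; apply.
Qed.

Lemma global_form_transition c c' y : overlap c c' y ->
  w c y = pullback DV (transition c c') (w c') y.
Proof.
move=> [x [cx cx'] <-]; apply/funext => v; case: gw => _ _ _ /(_ c c' x v cx cx') ->.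
rewrite /pullback transitionE//; congr (w c' _ _); apply/funext => i.
apply/rowP => j; rewrite mxE derive_coord//.
by apply: (smooth_differentiable (transition_smooth c c')); exists x.
Qed.

End Forms.

(** On an overlap, [w] in one chart is the pullback of [w] in the other along the transition map.
    This makes the differential of a global form global. *)
Lemma transition_dif p (w : local_forms M p) c c' y v : global_form w ->
  overlap c c' y ->
  ext_dif DV (w c) y v = ext_dif DV (w c') (transition c c' y)
    (fun i => 'D_(v i) (transition c c') y).
Proof.
move=> gw oy; have oO := @overlap_open c c'.
have st : smooth_on (overlap c c') (transition c c') by exact: transition_smooth.
have C := open_calculus oO.
rewrite (ext_dif_eq C v (w' := pullback DV (transition c c') (w c')))//; first last.
- by move=> z oz; exact: global_form_transition.
- move=> u; apply: (@smooth_on_sub _ _ _ (chart_image c)); first exact: overlap_image.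
  by case: (global_form_good gw c) => _; apply.
rewrite (@ext_dif_pullback _ _ _ _ _ _ C m (transition c c') (chart_image c'))//.
- congr (ext_dif _ _ _ _); apply/funext => i; apply/rowP => j; rewrite mxE.
  by rewrite derive_coord//; exact: smooth_differentiable st oy.
- by move=> l; exact: smooth_coord.
- by move=> z; exact: transition_image.
- by move=> f sf; apply: (smooth_comp oO _ st sf) => z; exact: transition_image.
- move=> f u z sf oz; rewrite derive_comp.
  + congr ('D_ _ f _); apply/rowP => j; rewrite mxE derive_coord//.
    exact: smooth_differentiable st oz.
  + exact: smooth_differentiable st oz.
  + exact: smooth_differentiable sf (transition_image oz).
- by move=> z; exact: global_form_alternating.
- by move=> u; case: (global_form_good gw c') => _; apply.
Qed.

Lemma local_form_eq p (w w' : local_forms M p) : (forall c y, w c y = w' c y) -> w = w'.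
Proof.
by move=> ww'; apply: functional_extensionality_dep => c; apply/funext => y; exact: ww'.
Qed.

Lemma deRham_difE p (w : gcar A p) c y : chart_image c y -> gdif w c y = ext_dif DV (w c) y.
Proof. by move=> cy; rewrite /=; case: asboolP. Qed.

Lemma deRham_dif_out p (w : gcar A p) c y : ~ chart_image c y -> gdif w c y = 0.
Proof. by move=> cy; rewrite /=; case: asboolP. Qed.

Lemma deRham_oneE c y : chart_image c y -> gone A c y = (fun=> 1).
Proof. by move=> cy; apply/funext => v; rewrite /=; case: asboolP. Qed.

Lemma wedge0 (E : lmodType R) p q r (e : (p + q = r)%N) (b : aform E q) :
  wedge e (0 : aform E p) b = 0.
Proof. exact: (lin0 (fun a x y => wedge_linl e a x y b)). Qed.

Lemma wedger0 (E : lmodType R) p q r (e : (p + q = r)%N) (a : aform E p) :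
  wedge e a (0 : aform E q) = 0.
Proof. exact: (lin0 (fun c x y => wedge_linr e c a x y)). Qed.

Lemma deRham_is_dga : is_dga A.
Proof.
have C c := open_calculus (@chart_image_open c).
have G p (x : gcar A p) : gmem A x -> forall c, good_form (chart_image c)
    (fun g : V -> R => smooth_on (chart_image c) (g : V -> R^o)) (x c).
  by move=> mx c; exact: global_form_good.
split.
- split.
  + move=> p; split=> //.
    * by move=> c y _; exact: alternating_zero.
    * by move=> c v; exact: smooth_cst.
  + move=> p a x y mx my; have [[ox ax sx tx] [oy ay sy ty]] := (mx, my); split.
    * move=> c z v cz; change (a * x c z v + y c z v = 0).
      by rewrite ox// oy// mulr0 addr0.
    * by move=> c z cz; apply: alternating_lin; [exact: ax|exact: ay].
    * by move=> c v; apply: smooth_lin => //; exact: chart_image_open.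
    * move=> c c' z v cz cz'.
      change (a * x c (chart_coord c z) v + y c (chart_coord c z) v =
        a * x c' (chart_coord c' z)
          (fun i => 'D_(v i) (chart_coord c' \o chart_inv c) (chart_coord c z)) +
        y c' (chart_coord c' z)
          (fun i => 'D_(v i) (chart_coord c' \o chart_inv c) (chart_coord c z))).
      by rewrite -tx// -ty.
  + split.
    * by move=> c y v cy /=; case: asboolP.
    * by move=> c y cy; exact: alternating0.
    * move=> c v; apply: smooth_on_eq (@smooth_cst _ _ _ _ (1 : R^o)).
        exact: chart_image_open.
      by move=> y cy; rewrite deRham_oneE.
    * by move=> c c' x v cx cx'; rewrite !deRham_oneE//; exact: chart_imageP.
  + move=> p q r e x y mx my; split.
    * by move=> c z v cz /=; rewrite (global_form_out mx cz) wedge0.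
    * move=> c z cz; apply: wedge_alternating; exact: global_form_alternating.
    * by move=> c v; case: (good_form_wedge (C c) e (G _ _ mx c) (G _ _ my c)) => _; apply.
    * move=> c c' z v cz cz'; rewrite /= !wedgeE; congr (_ * _).
      have [[_ _ _ tx] [_ _ _ ty]] := (mx, my).
      by apply: eq_bigr => s _; rewrite (tx c c')// (ty c c').
- split=> p q r e a x y z _ _ _; apply: local_form_eq => c t.
  + exact: wedge_linl.
  + exact: wedge_linr.
- split.
  + move=> p e x mx; apply: local_form_eq => c t /=.
    (* Outside the image of the chart the unit is 0, and so is every global form. *)
    have [ct|ct] := pselect (chart_image c t); last first.
      by rewrite (global_form_out mx ct) wedger0.
    by rewrite [X in wedge e X](deRham_oneE ct) wedge1//; exact: global_form_alternating.
  + move=> p e x mx; apply: local_form_eq => c t /=.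
    have [ct|ct] := pselect (chart_image c t); last first.
      by rewrite (global_form_out mx ct) wedge0.
    by rewrite [X in wedge e _ X](deRham_oneE ct) wedger1//; exact: global_form_alternating.
  + move=> p q r pq qr s e1 e2 e3 e4 x y z _ _ _; apply: local_form_eq => c t.
    exact: wedgeA.
- split.
  + split=> [p x mx|p a x y mx my].
    * have gd c := good_form_dif (C c) (G _ _ mx c); split.
      - by move=> c y v cy; rewrite deRham_dif_out.
      - by move=> c y cy; rewrite deRham_difE//; case: (gd c) => + _; apply.
      - move=> c v; case: (gd c) => _ /(_ v); apply: smooth_on_eq.
          exact: chart_image_open.
        by move=> y cy; rewrite deRham_difE.
      - move=> c c' z v cz cz'; rewrite !deRham_difE; try exact: chart_imageP.
        by rewrite (transition_dif v mx (c' := c'))// ?transitionE//; exists z.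
    * apply: local_form_eq => c t.
      have [ct|ct] := pselect (chart_image c t); last first.
        rewrite [RHS](_ : _ = a *: gdif x c t + gdif y c t)//.
        by rewrite !deRham_dif_out// scaler0 addr0.
      rewrite [RHS](_ : _ = a *: gdif x c t + gdif y c t)// !deRham_difE//.
      exact: (ext_dif_lin (C c) a ct (G _ _ mx c) (G _ _ my c)).
  + move=> p x mx; apply: local_form_eq => c t.
    have [ct|ct] := pselect (chart_image c t); last by rewrite deRham_dif_out.
    (* [gdif x] is known to be the exterior derivative only on the image of the chart; as this image
       is open, the outer derivative sees no difference. *)
    rewrite deRham_difE// -[RHS](ext_dif_dif (C c) ct (G _ _ mx c)).
    apply/funext => v; apply/esym; apply: (ext_dif_eq (C c)) => //.
      by case: (good_form_dif (C c) (G _ _ mx c)).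
    by move=> y cy; rewrite deRham_difE.
- move=> p q r e e1 e2 x y mx my; apply: local_form_eq => c t.
  rewrite [RHS](_ : _ = wedge e1 (gdif x c t) (y c t) +
    (-1) ^+ p *: wedge e2 (x c t) (gdif y c t))//.
  have [ct|ct] := pselect (chart_image c t); last first.
    by rewrite !deRham_dif_out// wedge0 wedger0 scaler0 addr0.
  rewrite !deRham_difE//.
  exact: (ext_dif_leibniz (C c) e e1 e2 ct (G _ _ mx c) (G _ _ my c)).
Qed.

Lemma deRham_involutive_dga : is_involutive_dga A.
Proof.
split; first exact: deRham_is_dga.
split=> //= p q r e e' x y _ _; apply: local_form_eq => c t.
exact: wedgeC.
Qed.

(** * Pullback of global forms along smooth simplices *)

Section FormPull.
Variables (n : nat) (s : simplex R n -> M).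
Hypothesis ss : smooth_simplex s.

(** Continuity for the topology induced by [bary] means that the preimage of a chart domain is the
    trace of an open set of the ambient space. *)
Lemma simplex_preimage (c : chart M) : exists O : set 'rV[R]_n.+1,
  open O /\ forall x : simplex R n, O (bary x) <-> chart_dom c (s x).
Proof.
case: ss => cs _.
have : open ((s : initial_topology (@bary R n) -> M) @^-1` chart_dom c).
  by apply: open_comp => [x _|]; [exact: cs|exact: dom_open].
move=> [U oU UE]; exists U; split => // x.
by rewrite -[U (bary x)]/((@bary R n @^-1` U) x) UE.
Qed.

Lemma chart_at_dom (x : M) : chart_dom (chart_at x) x.
Proof. by rewrite /chart_at; case: cid. Qed.

Lemma transition_simplex c c' x : chart_dom c (s x) -> chart_dom c' (s x) ->
  forall v, tderive v (chart_coord c' \o s) x =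
    'D_(tderive v (chart_coord c \o s) x) (transition c c') (chart_coord c (s x)).
Proof.
move=> cx cx' v; have [_ /(_ c x cx)[F eF]] := ss.
have ox : overlap c c' (chart_coord c (s x)) by exists (s x).
have st : smooth_on (overlap c c') (transition c c') by exact: transition_smooth.
have eC := local_extension_comp_row eF (@overlap_open c c') ox st.
rewrite -(tderive_comp v eF ox st eC).
have [U [oU Us]] := simplex_preimage c.
(* The two composites agree only where [s] lies in the domain of [c]; this is a neighbourhood of x,
   so the same extension serves both. *)
have eC' : local_extension (chart_coord c' \o s) x (transition c c' \o F).
  apply: local_extension_eq eC; [exact: oU|exact/Us|].
  by move=> y /Us cy; rewrite /= -[RHS](transitionE c' cy).
by rewrite (tderiveE v eC) (tderiveE v eC').
Qed.

Section Chart.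
Variables (c : chart M) (O : set 'rV[R]_n.+1).
Hypotheses (oO : open O) (Os : forall x : simplex R n, O (bary x) <-> chart_dom c (s x)).
Local Notation phi := (chart_coord c \o s).
Local Notation good := (fun g : simplex R n -> R =>
  forall x, O (bary x) -> smooth_at (g : _ -> R^o) x).

Let C : is_calculus (fun x => O (bary x)) good (@tderive R n R^o) := simplex_calculus oO.

Let sphi x : O (bary x) -> smooth_at phi x.
Proof. by move=> /Os cx; case: ss => _; apply. Qed.

(** [form_pull] changes its chart from point to point; a single chart on a neighbourhood is needed
    before anything can be differentiated. *)
Lemma form_pull_chart p (w : local_forms M p) x : global_form w -> O (bary x) ->
  form_pull s w x = pullback (@tderive R n R^o) phi (w c) x.
Proof.
move=> gw Ox; have cx := (Os x).1 Ox; have dx := chart_at_dom (s x).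
apply/funext => v; rewrite /form_pull /pullback.
set c0 := chart_at (s x) in dx *.
have -> := global_form_transition gw (c := c0) (c' := c) (y := chart_coord c0 (s x)).
  rewrite /pullback transitionE//; congr (w c _ _); apply/funext => i.
  rewrite (tderive_row _ (sphi Ox)) (transition_simplex dx cx).
  apply/rowP => j; rewrite mxE derive_coord//.
  by apply: (smooth_differentiable (transition_smooth c0 c)); exists (s x).
by exists (s x).
Qed.

Let gphi l : good (fun y => phi y 0 l).
Proof. by move=> x Ox; exact/smooth_at_coord/sphi. Qed.

Let phi_image x : O (bary x) -> chart_image c (phi x).
Proof. by move=> /Os; exact: chart_imageP. Qed.

Let chain_good (f : V -> R^o) : smooth_on (chart_image c) f -> good (f \o phi).
Proof.
move=> sf x Ox; have [F eF] := sphi Ox; exists (f \o F).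
exact: (local_extension_comp eF (@chart_image_open c) (phi_image Ox) sf).
Qed.

Let chain_der (f : V -> R^o) v x : smooth_on (chart_image c) f -> O (bary x) ->
  tderive v (f \o phi) x = 'D_(der_row (@tderive R n R^o) v phi x) f (phi x).
Proof.
move=> sf Ox; have [F eF] := sphi Ox; rewrite (tderive_row _ (sphi Ox)).
have eC := local_extension_comp eF (@chart_image_open c) (phi_image Ox) sf.
exact: tderive_comp eF (phi_image Ox) sf eC.
Qed.

Lemma good_form_pull p (w : local_forms M p) : global_form w ->
  good_form (fun x => O (bary x)) good (pullback (@tderive R n R^o) phi (w c)).
Proof.
move=> gw; have [aw sw] := global_form_good gw c.
exact: (good_form_pullback C gphi phi_image chain_good).
Qed.

Lemma form_pull_dif p (w : local_forms M p) x v : global_form w -> O (bary x) ->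
  ext_dif (@tderive R n R^o) (form_pull s w) x v =
  ext_dif DV (w c) (phi x) (fun i => tderive (v i) phi x).
Proof.
move=> gw Ox; have [aw sw] := global_form_good gw c; have [ap sp] := good_form_pull gw.
rewrite -(ext_dif_eq C v sp _ Ox); last by move=> y Oy; rewrite form_pull_chart.
rewrite (ext_dif_pullback C gphi phi_image chain_good chain_der)//.
by congr (ext_dif _ _ _ _); apply/funext => i; exact: tderive_row (sphi Ox).
Qed.

End Chart.

Lemma smooth_form_form_pull p (w : local_forms M p) :
  global_form w -> smooth_form (form_pull s w).
Proof.
move=> gw; split=> [x|v x];
  have [U [oU Us]] := simplex_preimage (chart_at (s x));
  have Ux := (Us x).2 (chart_at_dom (s x));
  have [ap sp] := good_form_pull oU Us gw.
- by rewrite (form_pull_chart Us gw Ux); exact: ap.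
- have [F eF] := sp v x Ux; exists F; apply: local_extension_eq eF; [exact: oU|by []|].
  by move=> y Oy; rewrite (form_pull_chart Us gw Oy).
Qed.

Lemma form_pull_gdif p (w : gcar A p) : gmem A w ->
  form_pull s (gdif w) = ext_dif (@tderive R n R^o) (form_pull s w).
Proof.
move=> gw; apply/funext => x; apply/funext => v.
have [U [oU Us]] := simplex_preimage (chart_at (s x)).
have dx := chart_at_dom (s x).
rewrite (form_pull_dif oU Us v gw ((Us x).2 dx)) /form_pull.
by rewrite deRham_difE//; exact: chart_imageP.
Qed.

(** Both sides use the chart chosen at the same point of [M], so only the chain rule for the vertex
    map is involved. *)
Lemma form_pull_push l (f : 'I_l.+1 -> 'I_n.+1) p (w : local_forms M p) :
  form_pull (s \o spush f) w = dR_pull f (form_pull s w).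
Proof.
apply/funext => x; apply/funext => v; rewrite /dR_pull /form_pull /=.
congr (w _ _ _); apply/funext => i.
apply: (tderive_push (g := chart_coord (chart_at (s (spush f x))) \o s)).
by case: ss => _; apply; exact: chart_at_dom.
Qed.

End FormPull.

Lemma alpha_involutive_dga_map : is_involutive_dga_map (@alpha_map R m M).
Proof.
split; [exact: deRham_involutive_dga|exact/smap_involutive_dga/ADR_reflexive|split|].
- split=> [p w gw|p a x y _ _]; last by [].
  split=> [n s|n i s|n i s].
  + exact: (smooth_form_form_pull (svalP s) gw).
  + exact: (form_pull_push (svalP s)).
  + exact: (form_pull_push (svalP s)).
- apply: smap_eq => n s; apply/funext => x; apply/funext => v.
  rewrite /alpha_map /form_pull deRham_oneE//; apply: chart_imageP.
  exact: chart_at_dom.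
- by [].
- by move=> p w gw; apply: smap_eq => n s; exact: (form_pull_gdif (svalP s) gw).
- move=> p w gw; apply: smap_eq => n s.
  (* The involution of the target flips the simplex and then the resulting form; the two pullbacks
     along the flip cancel, leaving the identity on [w]. *)
  rewrite /= /alpha_map (form_pull_push (svalP s)) dR_pull_comp dR_pull_id//.
  by move=> i; exact: rev_ordK.
Qed.

End DeRhamTheory.

(** * Polynomial forms as smooth forms *)

Section PolynomialSmooth.
Variable R : realType.

Section Level.
Variable n : nat.
Local Notation A := (ADR_lev R n).
Local Notation APL := (APL_alg R n).
Local Notation wform w p := (@word_form R n w p).
Implicit Types (u v w : word n).

Definition fmul p q r (e : (p + q = r)%N) (a : dR_form R n p) (b : dR_form R n q) :
  dR_form R n r := @gmul R A p q r e a b.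

Lemma fmul_linl p q r (e : (p + q = r)%N) b : lin (fun a : dR_form R n p => fmul e a b : dR_form R n r).
Proof. by have [+ _] := ADR_linear_mul R n; apply. Qed.
Lemma fmul_linr p q r (e : (p + q = r)%N) (a : dR_form R n p) :
  lin (fun b : dR_form R n q => fmul e a b : dR_form R n r).
Proof. by have [_ +] := ADR_linear_mul R n; apply. Qed.

Lemma fmulA p q r pq qr t (e1 : (p + q = pq)%N) (e2 : (pq + r = t)%N)
    (e3 : (q + r = qr)%N) (e4 : (p + qr = t)%N) a b c :
  fmul e2 (fmul e1 a b) c = fmul e4 a (fmul e3 b c).
Proof. by apply/funext => z; exact: wedgeA. Qed.

Lemma fmulC p q r (e : (p + q = r)%N) (e' : (q + p = r)%N) a b :
  fmul e a b = (-1) ^+ (p * q) *: fmul e' b a.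
Proof. by apply/funext => z; exact: wedgeC. Qed.

Lemma coordinate_extension (i : 'I_n.+1) (x : simplex R n) :
  local_extension (fun y : simplex R n => bary y 0 i : R^o) x (fun y : 'rV[R]_n.+1 => y 0 i : R^o).
Proof.
exists setT; split => //; first exact: openT.
have := @smooth_linear R 'rV[R]_n.+1 R^o setT (@coord R n.+1 i) (@coord_cont R n.+1 i).
by [].
Qed.

Lemma bary_fun_smooth i : smooth_form (@bary_fun R n i).
Proof.
split=> [x|v x]; first exact: alternating0.
by eexists; exact: coordinate_extension.
Qed.

Lemma bary_dif_smooth i : smooth_form (@bary_dif R n i).
Proof.
split=> [x|v x]; last first.
  exact: (good_cst (simplex_calculus (R := R) (n := n) openT) _ x I).
split=> [v j c u w|v j l]; last by rewrite !ord1.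
by rewrite /bary_dif /= (ord1 j) eqxx /= !mxE.
Qed.

Lemma dif_bary_fun i : gdif (@bary_fun R n i : gcar A 0) = bary_dif i.
Proof.
apply/funext => x; apply/funext => v; rewrite /= /ext_dif big_ord1 mul1r.
rewrite (tderiveE _ (coordinate_extension i x)).
exact: (derive_linear _ _ (@coord_cont R _ i)).
Qed.

Lemma dif_bary_dif i : gdif (@bary_dif R n i : gcar A 1) = 0.
Proof.
apply/funext => x; apply/funext => v; rewrite /= /ext_dif big1// => j _.
by rewrite (der_cst (simplex_calculus (R := R) (n := n) openT))// mulr0.
Qed.

Lemma word_form_smooth w p : smooth_form (wform w p).
Proof.
have dA := ADR_is_dga R n.
elim: w p => [|[[] i] w IH] [|p] /=; try exact: (dga_mem0 dA).
- exact: (dga_mem1 dA).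
- exact: (dga_memM dA _ (bary_dif_smooth i) (IH p)).
- exact: (dga_memM dA _ (bary_fun_smooth i) (IH 0)).
- exact: (dga_memM dA _ (bary_fun_smooth i) (IH p.+1)).
Qed.

(** [word_form w p] is the degree-p component of the form of a word, so each relation needs checking
    only in the one degree of its words. *)
Lemma word_form_deg w p : wdeg w != p -> wform w p = 0.
Proof.
elim: w p => [|[[] i] w IH] p; first by rewrite wdeg_nil; case: p.
- rewrite wdeg_cons add1n; case: p => [//|p]; rewrite eqSS => /IH /= ->.
  exact: (lin0 (fmul_linr _ _)).
- rewrite wdeg_cons add0n => /IH /= ->; exact: (lin0 (fmul_linr _ _)).
Qed.

Lemma word_form_cat u v p q r (e : (p + q = r)%N) : wdeg u = p ->
  wform (u ++ v) r = fmul e (wform u p) (wform v q).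
Proof.
have dA := ADR_is_dga R n.
elim: u p r e => [|[[] i] u IH] p r e.
- rewrite wdeg_nil => p0; subst p r; rewrite [RHS](dga_mul1 dA)//.
  exact: word_form_smooth.
- rewrite wdeg_cons; case: p e => [//|p] e [up]; case: r e => [//|r] e.
  have e' : (p + q = r)%N by lia.
  by rewrite /= (IH p r e')//; exact/esym/fmulA.
- rewrite wdeg_cons => up; rewrite /= (IH p r e)//.
  exact/esym/fmulA.
Qed.

Lemma fmul_bary_sum p (e : (0 + p = p)%N) (a : dR_form R n p) : smooth_form a ->
  \sum_i fmul e (@bary_fun R n i) a = a.
Proof.
move=> sa; rewrite -(lin_sum (fmul_linl _ _)).
have -> : \sum_i @bary_fun R n i = gone A.
  apply/funext => x; apply/funext => v.
  by rewrite fct_sumE fct_sumE -[RHS](simplex_sum x).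
exact: (dga_mul1 (ADR_is_dga R n)).
Qed.

Lemma fmul_bary_dif_sum p r (e : (1 + p = r)%N) (a : dR_form R n p) :
  \sum_i fmul e (@bary_dif R n i) a = 0.
Proof.
rewrite -(lin_sum (fmul_linl _ _)).
have -> : \sum_i @bary_dif R n i = 0.
  apply/funext => x; apply/funext => v.
  by rewrite fct_sumE fct_sumE -[RHS](tangent_sum (v 0)).
exact: (lin0 (fmul_linl _ _)).
Qed.

Lemma word_form_swap (x y : letter n) p :
  wform [:: x; y] p = (-1) ^+ (x.1 && y.1) *: wform [:: y; x] p.
Proof.
have D (a b : letter n) : wdeg [:: a; b] = (a.1 + b.1)%N.
  by rewrite !wdeg_cons wdeg_nil addn0.
have [pE|np] := eqVneq p (x.1 + y.1)%N; last first.
  by rewrite !word_form_deg ?scaler0// D eq_sym// (addnC y.1).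
have d1 (a : letter n) : wdeg [:: a] = a.1 by rewrite wdeg_cons wdeg_nil addn0.
rewrite (word_form_cat (u := [:: x]) [:: y] (esym pE) (d1 x)).
have pE' : (y.1 + x.1 = p)%N by rewrite addnC.
rewrite (word_form_cat (u := [:: y]) [:: x] pE' (d1 y)) (fmulC _ pE').
by congr (_ *: _); apply: sign_odd_eq; move: (x.1) (y.1) => [] [].
Qed.

Lemma word_form_respects p : respects (@APL_rel R n) (fun w => wform w p).
Proof.
apply/APL_respectsP; split=> [u v x y|u v|u v].
- have D a b : wdeg (u ++ [:: a; b] ++ v) = (wdeg u + (a.1 + b.1 + wdeg v))%N.
    by rewrite !wdeg_cat !wdeg_cons wdeg_nil addn0.
  have [pE|np] := eqVneq p (wdeg u + (x.1 + y.1 + wdeg v))%N; last first.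
    by rewrite !word_form_deg ?scaler0// D eq_sym// (addnC y.1).
  have d2 (a b : letter n) : wdeg [:: a; b] = (a.1 + b.1)%N.
    by rewrite !wdeg_cons wdeg_nil addn0.
  rewrite !(word_form_cat _ (esym pE) erefl) (word_form_cat v erefl (d2 x y)).
  have d2' : wdeg [:: y; x] = (x.1 + y.1)%N by rewrite d2 addnC.
  rewrite (word_form_cat v erefl d2') word_form_swap.
  by rewrite (linZ (fmul_linl _ _)) (linZ (fmul_linr _ _)).
- have [pE|np] := eqVneq p (wdeg u + wdeg v)%N; last first.
    rewrite word_form_deg ?wdeg_cat 1?eq_sym// big1// => i _.
    by rewrite word_form_deg// wdeg_cat wdeg_cons add0n eq_sym.
  under eq_bigr do rewrite (word_form_cat _ (esym pE) erefl).
  rewrite (word_form_cat _ (esym pE) erefl) -(lin_sum (fmul_linr _ _)); congr fmul.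
  exact/fmul_bary_sum/word_form_smooth.
- have [pE|np] := eqVneq p (wdeg u + (wdeg v).+1)%N; last first.
    rewrite big1// => i _.
    by rewrite word_form_deg// wdeg_cat wdeg_cons add1n eq_sym.
  under eq_bigr do rewrite (word_form_cat _ (esym pE) erefl).
  rewrite -(lin_sum (fmul_linr _ _)) -[RHS](lin0 (fmul_linr (esym pE) (wform u (wdeg u)))).
  congr fmul; exact: fmul_bary_dif_sum.
Qed.

Definition to_form p (x : APL) : dR_form R n p := @APL_to_ADR R n p x.

Lemma to_form_lin p : lin (@to_form p).
Proof. exact/lin_ext_lin/word_form_respects. Qed.

Lemma to_formE p w : @to_form p (pgen w) = wform w p.
Proof. exact: (lin_ext_pgen (@word_form_respects p)). Qed.

Lemma to_form_smooth p x : smooth_form (@to_form p x).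
Proof.
have dA := ADR_is_dga R n; have [l ->] := presE x.
elim: l => [|[c w] l IH].
  by rewrite big_nil (lin0 (@to_form_lin p)); exact: (dga_mem0 dA).
rewrite big_cons (@to_form_lin p) to_formE.
by apply: (dga_mem_lin dA) IH; exact: word_form_smooth.
Qed.

Lemma to_form_mul p q r (e : (p + q = r)%N) x y : hom p x ->
  @to_form r (amul x y) = fmul e (@to_form p x) (@to_form q y).
Proof.
move=> hx; move: x hx; apply: span_lin_eq.
- exact: (lin_comp (@to_form_lin r) (amul_linl y)).
- exact: (lin_comp (fmul_linl e _) (@to_form_lin p)).
move=> u up; move: y; apply: pres_lin_eq.
- exact: (lin_comp (@to_form_lin r) (amul_linr _)).
- exact: (lin_comp (fmul_linr e _) (@to_form_lin q)).
by move=> v; rewrite amulE !to_formE; exact: word_form_cat.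
Qed.

Lemma to_form_lmul_t p i x : @to_form p (lmul (false, i) x) =
  fmul (erefl : (0 + p = p)%N) (bary_fun i) (@to_form p x).
Proof.
rewrite lmulE; move: x; apply: pres_lin_eq.
- exact: (lin_comp (@to_form_lin p) (amul_linr _)).
- exact: (lin_comp (fmul_linr _ _) (@to_form_lin p)).
by move=> w; rewrite amulE !to_formE.
Qed.

Lemma to_form_lmul_dt p i x : @to_form p.+1 (lmul (true, i) x) =
  fmul (erefl : (1 + p = p.+1)%N) (bary_dif i) (@to_form p x).
Proof.
rewrite lmulE; move: x; apply: pres_lin_eq.
- exact: (lin_comp (@to_form_lin p.+1) (amul_linr _)).
- exact: (lin_comp (fmul_linr _ _) (@to_form_lin p)).
by move=> w; rewrite amulE !to_formE.
Qed.

Lemma to_form_lmul_dt0 i x : @to_form 0 (lmul (true, i) x) = 0.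
Proof.
rewrite lmulE; move: x; apply: pres_lin_eq.
- exact: (lin_comp (@to_form_lin 0) (amul_linr _)).
- exact: lin_cst0.
by move=> w; rewrite amulE !to_formE.
Qed.

(** Both differentials obey the Leibniz rule and agree on letters: that of [bary_fun i] is
    [bary_dif i], and that of [bary_dif i] is 0. *)
Lemma to_form_word_dif p w : wdeg w = p ->
  @to_form p.+1 (word_dif R w) = gdif (wform w p : gcar A p).
Proof.
have dA := ADR_is_dga R n.
elim: w p => [|[[] i] w IH] p.
- rewrite wdeg_nil => <-; rewrite /= (lin0 (@to_form_lin 1)).
  exact/esym/(dga_dif1 dA).
- rewrite wdeg_cons; case: p => [//|p] [wp].
  rewrite [LHS]/= (linN (@to_form_lin _)) to_form_lmul_dt IH//.
  rewrite [RHS](dga_leibniz dA _ (erefl : (2 + p = p.+2)%N) (erefl : (1 + p.+1 = p.+2)%N)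
    (bary_dif_smooth i) (word_form_smooth w p)).
  rewrite dif_bary_dif expr1 scaleN1r [X in X + _](lin0 (fmul_linl _ _)) add0r.
  by [].
- rewrite wdeg_cons add0n => wp.
  rewrite [LHS]/= (linD (@to_form_lin _)) to_form_lmul_t to_formE IH//.
  rewrite [RHS](dga_leibniz dA _ (erefl : (1 + p = p.+1)%N) (erefl : (0 + p.+1 = p.+1)%N)
    (bary_fun_smooth i) (word_form_smooth w p)).
  by rewrite dif_bary_fun expr0 scale1r.
Qed.

Lemma to_form_dif p x : hom p x -> @to_form p.+1 (adif x) = gdif (@to_form p x : gcar A p).
Proof.
have dA := ADR_is_dga R n; have [_ _ _ [[_ dlin] _] _] := dA.
move=> /spanP[l ->]; elim: l => [|[c [w wp]] l IH].
  rewrite big_nil (lin0 (@adif_lin _ _)) !(lin0 (@to_form_lin _)).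
  have m0 := dga_mem0 dA p; have := dlin p (-1) 0 0 m0 m0.
  by rewrite scaler0 addr0 scaleN1r addNr => /= ->.
rewrite big_cons (@adif_lin _ _) (@to_form_lin p.+1) (@to_form_lin p) IH adifE.
rewrite to_formE (to_form_word_dif wp).
rewrite (dlin p); [by []|exact: word_form_smooth|exact: to_form_smooth].
Qed.

End Level.

(** On letters both sides sum over the fibres of [f], which is how [push] acts on coordinates; both
    pullbacks are multiplicative. *)
Lemma to_form_pull m n (f : 'I_m.+1 -> 'I_n.+1) p (x : APL_alg R n) :
  @to_form _ p (APL_pull f x) = dR_pull f (@to_form _ p x).
Proof.
move: x; apply: pres_lin_eq.
- exact: (lin_comp (@to_form_lin m p) (APL_pull_lin f)).
- exact: (lin_comp (F := dR_pull f (p := p)) (fun _ _ _ => erefl) (@to_form_lin n p)).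
move=> w; rewrite APL_pullE to_formE; elim: w p => [|[[] i] w IH] p.
- by rewrite to_formE; case: p.
- rewrite [wpull _ _]/= (lin_sum (@to_form_lin m p)); case: p => [|p].
    by rewrite big1// => j _; exact: to_form_lmul_dt0.
  under eq_bigr do rewrite to_form_lmul_dt IH.
  rewrite -(lin_sum (fmul_linl _ _)).
  have -> : \sum_(j | f j == i) @bary_dif R m j = dR_pull f (bary_dif i).
    apply/funext => x; apply/funext => v.
    by rewrite fct_sumE fct_sumE /dR_pull /bary_dif/= mxE.
  by apply/funext => x; apply/funext => v.
- rewrite [wpull _ _]/= (lin_sum (@to_form_lin m p)).
  under eq_bigr do rewrite to_form_lmul_t IH.
  rewrite -(lin_sum (fmul_linl _ _)).
  have -> : \sum_(j | f j == i) @bary_fun R m j = dR_pull f (bary_fun i).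
    apply/funext => x; apply/funext => v.
    by rewrite fct_sumE fct_sumE /dR_pull /bary_fun/= mxE.
  by apply/funext => x; apply/funext => v.
Qed.

Lemma APL_to_ADR_reflexive : is_reflexive_dga_map (A := APL R) (B := ADR R) (@APL_to_ADR R).
Proof.
split.
- move=> n; split.
  + by split=> [p x _|p a x y _ _]; [exact: to_form_smooth|exact: to_form_lin].
  + exact: to_formE.
  + by move=> p q r e x y hx _; exact: to_form_mul.
  + by move=> p x hx; exact: to_form_dif.
- by move=> n p x _; exact: to_form_pull.
- by move=> n i p x _; exact: to_form_pull.
- by move=> n i p x _; exact: to_form_pull.
Qed.

End PolynomialSmooth.

(** * Maps induced by maps of reflexive sets, and the theorem *)

Lemma smap_pre_involutive (k : fieldType) (A : reflexiveDgaData k) (K L : reflexiveSet)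
    (g : forall n, K n -> L n) : is_reflexive_dga A ->
  (forall n (i : 'I_n.+2) s, g n (face i s) = face i (g n.+1 s)) ->
  (forall n (i : 'I_n.+1) s, g n.+1 (degen i s) = degen i (g n s)) ->
  (forall n s, g n (flip s) = flip (g n s)) ->
  is_involutive_dga_map (smap_pre (A := A) g).
Proof.
move=> rA gf gs gr.
split; [exact: smap_involutive_dga|exact: smap_involutive_dga|split|] => //.
- split=> // p x [xm xf xd]; split=> [n s|n i s|n i s]; rewrite /smap_pre.
  + exact: xm.
  + by rewrite gf xf.
  + by rewrite gs xd.
- by move=> p x _; apply: smap_eq => n s; rewrite /smap_pre/= gr.
Qed.

Lemma gamma_involutive_dga_map (R : realType) m (M : manifold R m) :
  is_involutive_dga_map (@gamma_map R m M).
Proof.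
apply: smap_pre_involutive; first exact: APL_reflexive.
- by move=> n i s; exact: eq_exist.
- by move=> n i s; exact: eq_exist.
- by move=> n s; exact: eq_exist.
Qed.

Lemma beta_involutive_dga_map (R : realType) m (M : manifold R m) :
  is_involutive_dga_map (@beta_map R m M).
Proof.
apply: smap_post_involutive; [exact: APL_reflexive|exact: ADR_reflexive|].
exact: APL_to_ADR_reflexive.
Qed.

Theorem theorem10p14 :
  (forall (k : fieldType) (K : reflexiveSet),
     [pchar k]%R =i pred0 ->
     is_involutive_dga_map
       (smap_post (@tensor_inr k (CPL k) (APL k)) (K := K)) /\
     is_involutive_dga_map
       (smap_post (@tensor_inl k (CPL k) (APL k)) (K := K))) /\
  (forall (R : realType) (m : nat) (M : manifold R m),
     [/\ is_involutive_dga_map (@alpha_map R m M),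
         is_involutive_dga_map (@beta_map R m M) &
         is_involutive_dga_map (@gamma_map R m M)]).
Proof.
split=> [k K _|R m M]; first exact: cochain_polynomial_zigzag.
split; [exact: alpha_involutive_dga_map|exact: beta_involutive_dga_map|].
exact: gamma_involutive_dga_map.
Qed.
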